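(* Let $n<p<\infty$, let $S$ be an arbitrary closed subset of $\mathbb{R}^n$, let $\varepsilon>0$, and let $S_\varepsilon$ denote the $\varepsilon$-neighborhood of $S$. Fix $\theta\ge1$ and let $T:S_\varepsilon\to S$ be a measurable mapping such that $\|T(x)-x\|\le\theta\operatorname{dist}(x,S)$ for every $x\in S_\varepsilon$. Put $\eta:=10\theta+1$. A function $f:S\to\mathbb{R}$ is an element of $W^1_p(\mathbb{R}^n)|_S$ if and only if $f\circ T\in L_p(S_\varepsilon)$ and there exists a constant $\lambda>0$ such that the inequality $$\sum_{i=1}^m\frac{|f(x_i)-f(y_i)|^p}{(\operatorname{diam}Q_i)^{p-n}}\le\lambda$$ holds for every finite family $\{Q_i:i=1,\dots,m\}$ of disjoint cubes contained in $S_\varepsilon$ and every choice of points $x_i,y_i\in(\eta Q_i)\cap S$. Moreover, $$\|f\|_{W^1_p(\mathbb{R}^n)|_S}\sim\|f\circ T\|_{L_p(S_\varepsilon)}+\inf\lambda^{1/p}$$ (the infimum over all such $\lambda$), with constants of equivalence depending only on $n,p,\varepsilon$ and $\theta$.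
   Context: Distances and diameters in $\mathbb{R}^n$ are measured in the norm $\|x\|=\max_i|x_i|$. A cube is a closed cube with sides parallel to the coordinate axes; $\lambda Q$ denotes the dilation of $Q$ about its center by the factor $\lambda$. The $\varepsilon$-neighborhood of $S$ is the set of points at distance less than $\varepsilon$ from $S$. $W^1_p(\mathbb{R}^n)$ is the Sobolev space with norm $\|F\|_{L_p(\mathbb{R}^n)}+\|\nabla F\|_{L_p(\mathbb{R}^n)}$. Since $p>n$, each element of $W^1_p(\mathbb{R}^n)$ is identified with its unique continuous representative. The trace space $W^1_p(\mathbb{R}^n)|_S$ consists of all $f:S\to\mathbb{R}$ for which there is a continuous $F\in W^1_p(\mathbb{R}^n)$ with $F|_S=f$, and $\|f\|_{W^1_p(\mathbb{R}^n)|_S}=\inf\{\|F\|_{W^1_p(\mathbb{R}^n)}:F\in W^1_p(\mathbb{R}^n)\text{ continuous},\ F|_S=f\}$. $A\sim B$ means $A/C\le B\le CA$ for a constant $C\ge1$. *)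

(* Defs.v *)
From HB Require Import structures.
From mathcomp Require Import all_boot all_order all_algebra.
From mathcomp Require Import all_classical all_reals all_analysis.

Set Implicit Arguments.
Unset Strict Implicit.
Unset Printing Implicit Defensive.

Import Order.TTheory GRing.Theory Num.Theory.
Import numFieldNormedType.Exports.

Local Open Scope classical_set_scope.
Local Open Scope ring_scope.

(* R^n is 'rV[R]_n, whose library norm is the maximum norm. Its Borel
   sigma-algebra is presented as the one generated by the coordinates. *)
Section rV_measurable.
Context {R : realType} {n : nat}.

Definition rV_coord (i : 'I_n) (x : 'rV[R]_n) : R := x ord0 i.

Let rV_set0 : g_sigma_preimage rV_coord set0.
Proof. exact: sigma_algebra0. Qed.

Let rV_setC A : g_sigma_preimage rV_coord A -> g_sigma_preimage rV_coord (~` A).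
Proof. exact: sigma_algebraC. Qed.

Let rV_bigcup (F : (set 'rV[R]_n)^nat) :
  (forall i, g_sigma_preimage rV_coord (F i)) ->
  g_sigma_preimage rV_coord (\bigcup_i (F i)).
Proof. exact: sigma_algebra_bigcup. Qed.

HB.instance Definition _ := @isMeasurable.Build default_measure_display
  'rV[R]_n (g_sigma_preimage rV_coord) rV_set0 rV_setC rV_bigcup.

Lemma measurable_rV_coord i : measurable_fun setT (rV_coord i).
Proof.
move=> _ Y mY; rewrite setTI; apply: sub_sigma_algebra => /=.
rewrite -bigcup_seq/=; exists i => /=; first by rewrite mem_index_enum.
by exists Y => //; rewrite setTI.
Qed.

Lemma measurable_fun_rVP d (T : measurableType d) (f : T -> 'rV[R]_n) :
  (forall i, measurable_fun setT (rV_coord i \o f)) -> measurable_fun setT f.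
Proof.
move=> mf _ A mA; rewrite setTI; move: A mA.
have: g_sigma_preimage rV_coord `<=` [set A | measurable (f @^-1` A)].
  apply: smallest_sub.
    split => /=; first by rewrite preimage_set0.
    - by move=> A mA; rewrite setTD preimage_setC; exact: measurableC.
    - by move=> F mF; rewrite preimage_bigcup; exact: bigcup_measurable.
  rewrite -bigcup_seq => A [i _] [B mB <-] /=.
  by rewrite setTI; have := mf i measurableT B mB; rewrite setTI.
exact.
Qed.

End rV_measurable.

(* Lebesgue measure on R^n, first on Borel sets as the n-fold product of the
   measure of R (unit mass at the point of R^0), then completed. *)
Section lebesgue.
Context {R : realType}.

Definition rV_cons n (p : R * 'rV[R]_n) : 'rV[R]_n.+1 :=
  row_mx (p.1)%:M p.2 : 'rV_(1 + n).

Definition rV_uncons n (x : 'rV[R]_n.+1) : R * 'rV[R]_n :=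
  (x ord0 ord0, rsubmx (x : 'rV_(1 + n))).

Lemma rV_consK n : cancel (@rV_cons n) (@rV_uncons n).
Proof.
move=> [a v]; rewrite /rV_uncons /rV_cons row_mxKr/=; congr pair.
transitivity (row_mx a%:M v ord0 (lshift n (@ord0 0))).
  by congr (row_mx _ _ _ _); exact/val_inj.
by rewrite row_mxEl mxE eqxx mulr1n.
Qed.

Lemma rV_unconsK n : cancel (@rV_uncons n) (@rV_cons n).
Proof.
move=> x; rewrite /rV_uncons /rV_cons/=.
have -> : (x ord0 ord0)%:M = lsubmx (x : 'rV_(1 + n)) :> 'rV[R]_1.
  apply/rowP => i; rewrite !ord1 !mxE eqxx mulr1n.
  by congr (fun_of_matrix x _ _); exact/val_inj.
exact: (@hsubmxK R 1 1 n x).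
Qed.

Lemma measurable_rV_cons n : measurable_fun setT (@rV_cons n).
Proof.
apply: measurable_fun_rVP => i.
have [j ->|j ->] := @split_ordP 1 n i.
- rewrite (_ : _ \o _ = fst) //; apply/funext => p /=.
  by rewrite /rV_coord /rV_cons (@row_mxEl R 1 1 n) !ord1 [LHS]mxE eqxx mulr1n.
- rewrite (_ : _ \o _ = rV_coord j \o snd).
    by apply: measurableT_comp => //; exact: measurable_rV_coord.
  by apply/funext => p /=; rewrite /rV_coord /rV_cons (@row_mxEr R 1 1 n).
Qed.

Lemma measurable_rV_uncons n : measurable_fun setT (@rV_uncons n).
Proof.
apply/measurable_fun_pairP; split; first exact: measurable_rV_coord.
apply: measurable_fun_rVP => i.
rewrite (_ : _ \o _ = rV_coord (rshift 1 i)); last first.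
  by apply/funext => x /=; rewrite /rV_coord mxE.
exact: measurable_rV_coord.
Qed.

Section cons_measure.
Context {n : nat} (mu : {sigma_finite_measure set 'rV[R]_n -> \bar R}).

Definition cons_measure : set 'rV[R]_n.+1 -> \bar R :=
  pushforward (@lebesgue_measure R \x mu)%E (@rV_cons n).

Let m : {measure set 'rV[R]_n.+1 -> \bar R} :=
  measure_function_pushforward__canonical__measure_function_Measure
    (@lebesgue_measure R \x mu)%E (@measurable_rV_cons n).

HB.instance Definition _ := Measure.copy cons_measure m.

Let cons_measure_sigma_finite : sigma_finite setT cons_measure.
Proof.
have /sigma_finiteP[F [FT Fnd Foo]] := sigma_finiteT (@lebesgue_measure R).
have /sigma_finiteP[G [GT Gnd Goo]] := sigma_finiteT mu.
exists (fun k => @rV_uncons n @^-1` (F k `*` G k)).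
  rewrite -preimage_bigcup; apply/esym/seteqP; split => // x _.
  have [k _ Fk] : (\bigcup_k F k) (rV_uncons x).1 by rewrite -FT.
  have [l _ Gl] : (\bigcup_k G k) (rV_uncons x).2 by rewrite -GT.
  exists (maxn k l) => //; split.
  - by move: Fk; exact/subsetPset/Fnd/leq_maxl.
  - by move: Gl; exact/subsetPset/Gnd/leq_maxr.
move=> k; have [mF Fk] := Foo k; have [mG Gk] := Goo k; split.
  rewrite -[X in measurable X]setTI; apply: measurable_rV_uncons => //.
  exact: measurableX.
rewrite /cons_measure /pushforward -comp_preimage.
rewrite (_ : _ \o _ = id); last exact/funext/rV_consK.
by rewrite preimage_id product_measure1E// lte_mul_pinfty// ge0_fin_numE.
Qed.

HB.instance Definition _ := Measure_isSigmaFinite.Build _ _ _ cons_measure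
  cons_measure_sigma_finite.

End cons_measure.

Fixpoint borel_lebesgue n : {sigma_finite_measure set 'rV[R]_n -> \bar R} :=
  match n with
  | 0 => dirac (0 : 'rV[R]_0)
  | m.+1 => cons_measure (borel_lebesgue m)
  end.

(* 'rV[R]_n equipped with the sigma-algebra of Lebesgue measurable sets. *)
Definition lebesgue_rV n := caratheodory_type (borel_lebesgue n)^*%mu.

Definition lebesgue n : {measure set (lebesgue_rV n) -> \bar R} :=
  @completed_measure_extension _ _ _ (borel_lebesgue n).

End lebesgue.

Section sobolev.
Context {R : realType} {n : nat}.
Implicit Types (F : 'rV[R]_n -> R) (G : 'rV[R]_n -> 'rV[R]_n).

Local Notation mu := (@lebesgue R n).

Definition partial (i : 'I_n) F : 'rV[R]_n -> R :=
  fun x => 'D_(delta_mx ord0 i) F x.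

(* C^oo: all iterated partial derivatives exist and are continuous. *)
Definition smooth F := forall s : seq 'I_n,
  let H := foldr partial F s in
  continuous H /\ forall i x, derivable H x (delta_mx ord0 i).

Definition test_function F :=
  smooth F /\ compact (closure [set x | F x != 0]).

Definition weak_gradient F G := forall phi, test_function phi -> forall i,
  (\int[mu]_x (F x * partial i phi x) = - \int[mu]_x (G x ord0 i * phi x))%R.

Definition Lp_gradient (p : R) F G :=
  (forall i, (fun x => G x ord0 i) \in Lfun mu p%:E) /\ weak_gradient F G.

Definition W1 (p : R) F :=
  F \in Lfun mu p%:E /\ exists G, Lp_gradient p F G.

(* The weak gradient is determined only almost everywhere: [gradient p F] is
   one representative. *)
Definition gradient (p : R) F : 'rV[R]_n -> 'rV[R]_n := get (Lp_gradient p F).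

Definition W1_norm (p : R) F : \bar R :=
  ('N[mu]_p%:E[EFin \o F] + 'N[mu]_p%:E[EFin \o (fun x => `|gradient p F x|%R)])%E.

Definition W1_extension (p : R) (S : set 'rV[R]_n) (f F : 'rV[R]_n -> R) :=
  [/\ continuous F, W1 p F & forall x, S x -> F x = f x].

(* A function on S is a function on R^n of which only the values on S are
   used; the same convention applies to maps defined on a neighborhood of S. *)
Definition W1_trace (p : R) S (f : 'rV[R]_n -> R) :=
  exists F, W1_extension p S f F.

Definition W1_trace_norm (p : R) S (f : 'rV[R]_n -> R) : \bar R :=
  ereal_inf [set W1_norm p F | F in W1_extension p S f].

End sobolev.

Section cubes.
Context {R : realType} {n : nat}.
Implicit Types (S A : set 'rV[R]_n) (f : 'rV[R]_n -> R).

(* [edist_inf S] is the distance to S, equal to +oo if S is empty. *)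
Definition nbhd (eps : R) S : set 'rV[R]_n :=
  [set x | (edist_inf S x < eps%:E)%E].

Definition diam A : R := sup [set `|z.1 - z.2| | z in A `*` A].

(* The cube of center c and side 2 r. *)
Definition cube (c : 'rV[R]_n) (r : R) : set 'rV[R]_n :=
  [set x | forall i, c ord0 i - r <= x ord0 i <= c ord0 i + r].

(* The cubes are [cube (c i) (r i)]; the dilation of [cube c r] about its center
   by the factor eta is [cube c (eta * r)]. *)
Definition cube_sums_bounded (p eps eta : R) S f (lambda : R) :=
  forall (m : nat) (c : 'I_m -> 'rV[R]_n) (r : 'I_m -> R)
    (x y : 'I_m -> 'rV[R]_n),
  (forall i, 0 < r i) ->
  trivIset setT (fun i => cube (c i) (r i)) ->
  (forall i, cube (c i) (r i) `<=` nbhd eps S) ->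
  (forall i, (cube (c i) (eta * r i) `&` S) (x i)) ->
  (forall i, (cube (c i) (eta * r i) `&` S) (y i)) ->
  \sum_(i < m) `|f (x i) - f (y i)| `^ p /
    diam (cube (c i) (r i)) `^ (p - n%:R) <= lambda.

End cubes.

(* Main.v *)
(* Necessity. Morrey's inequality bounds the increments of F on a cube of radius
   r by C r^(1 - n/q) times the L_q norm of grad F on that cube, for every q > n.
   For n < q < p, a maximal-function estimate over disjoint cubes then bounds the
   sums by the p-th power of the L_p norm of grad F; for q = p, averaging over
   cubes of radius theta * eps bounds the L_p norm of f o T.

   Sufficiency. With d the distance to S, let F be the average of f o T over a
   neighborhood of x of radius d / 50, equal to f on S, cut off where d > eps / 2.
   Its increments at a scale t << d are at most t / d times the oscillation of f
   on S near x, and those at a scale t comparable to d or larger are at most the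
   oscillation itself. A Vitali covering by cubes of radius d / 4, or 10 t where
   d <= 50 t, turns the hypothesis on disjoint cubes into an L_p bound for these
   oscillations divided by the radius, so the difference quotients of F are
   bounded in L_p uniformly in t. A weak limit of them, obtained along an
   ultrafilter by Radon-Nikodym, is a weak derivative of F; as weak gradients are
   unique almost everywhere, the bound holds for [gradient p F]. *)

From HB Require Import structures.
Require Import Defs.
From mathcomp Require Import all_boot all_order all_algebra.
From mathcomp Require Import finmap.
From mathcomp Require Import all_classical all_reals all_analysis.
From mathcomp Require Import measurable_realfun ring lra.

Import Order.TTheory GRing.Theory Num.Theory.
Import numFieldNormedType.Exports.

Set Implicit Arguments.
Unset Strict Implicit.
Unset Printing Implicit Defensive.

Local Open Scope classical_set_scope.
Local Open Scope ring_scope.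

(** * Cubes and Lebesgue measure *)

(** The dilations of disjoint cubes overlap without control, so integrals of |grad F|^p over them
    cannot simply be added. Morrey's inequality with q < p leaves room for a maximal inequality of
    exponent p / q > 1, while q > n keeps t^(-n/q) integrable at 0 in the proof of Morrey's
    inequality. As T is only measurable, f o T can be very irregular. Averaging it with the weight
    max(0, r - |x - z|), which is Lipschitz in x and in r, yields controlled increments without a
    Whitney decomposition or a partition of unity. Nothing is proved about pointwise derivatives of
    F: only its difference quotients are bounded. Weak compactness is obtained in L_1:
    multiplication by a positive integrable weight turns a bounded sequence of L_p into a uniformly
    integrable one, its limit integrals form a charge, and division of the density by the weight
    gives the limit. Its L_p bound is recovered by duality. The numbers 50, 1/4, 10 and 300 are
    choices that make finitely many linear inequalities in d, t, theta and eps hold. *)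

Section rV_geometry.
Context {R : realType} {n : nat}.
Implicit Types (x y c a b : 'rV[R]_n) (r : R).

Lemma rV_norm_le x r : 0 <= r -> (`|x| <= r) <-> (forall i, `|x ord0 i| <= r).
Proof.
move=> r0; rewrite [ `|x|]mx_normrE; split => [/bigmax_leP[_ h] i|h].
  exact: (h (ord0, i)).
by apply/bigmax_leP; split => // -[i j] _; rewrite /= ord1.
Qed.

Lemma rV_coord_le x i : `|x ord0 i| <= `|x|.
Proof. by move: i; apply/rV_norm_le. Qed.

Lemma cubeE c r : 0 <= r -> cube c r = [set x | `|x - c| <= r].
Proof.
move=> r0; apply/seteqP; split => x /=.
  move=> h; apply/(rV_norm_le _ r0) => i; rewrite !mxE ler_distl.
  by have := h i.
move/(rV_norm_le _ r0) => h i; have := h i.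
by rewrite !mxE ler_distl.
Qed.

Lemma cube_center c r : 0 <= r -> cube c r c.
Proof. by move=> r0; rewrite cubeE//= subrr normr0. Qed.

Lemma cube_sub c c' r r' : 0 <= r -> `|c - c'| + r <= r' ->
  cube c r `<=` cube c' r'.
Proof.
move=> r0 h; rewrite !cubeE//; last by rewrite (le_trans _ h)// addr_ge0.
move=> x /= xc; rewrite (_ : x - c' = (c - c') + (x - c)); last first.
  by rewrite [RHS]addrC addrA subrK.
by rewrite (le_trans (ler_normD _ _))// (le_trans _ h)// lerD2l.
Qed.

Lemma compact_box a b : compact [set x : 'rV[R]_n | forall i, a ord0 i <= x ord0 i <= b ord0 i].
Proof.
rewrite (_ : [set x | _] = [set v : 'rV[R]_n | forall i, `[a ord0 i, b ord0 i]%classic (v ord0 i)]).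
  exact: (@rV_compact R n (fun i => `[a ord0 i, b ord0 i]%classic)
      (fun i => @segment_compact R _ _)).
by apply/seteqP; split => x /= h i; have := h i; rewrite in_itv.
Qed.

Lemma cube_box c r :
  cube c r = [set x | forall i, (c - const_mx r) ord0 i <= x ord0 i <= (c + const_mx r) ord0 i].
Proof. by apply/seteqP; split => x /= h i; have := h i; rewrite !mxE. Qed.

Lemma compact_cube c r : compact (cube c r).
Proof. by rewrite cube_box; exact: compact_box. Qed.

End rV_geometry.

Section borel.
Context {R : realType}.

Definition box n (a b : 'rV[R]_n) : set 'rV[R]_n :=
  [set x | forall i, a ord0 i <= x ord0 i <= b ord0 i].

Lemma measurable_forall_coord n (A : 'I_n -> set R) :
  (forall i, measurable (A i)) ->
  measurable [set x : 'rV[R]_n | forall i, A i (x ord0 i)].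
Proof.
move=> mA.
rewrite (_ : [set _ | _] = \bigcap_(i in [set: 'I_n]) (rV_coord i @^-1` A i)).
  apply: fin_bigcap_measurable => // i _.
  by rewrite -[X in measurable X]setTI; exact: measurable_rV_coord.
by apply/seteqP; split => [x h i _|x h i]; [exact: h|exact: (h i I)].
Qed.

Lemma measurable_box n (a b : 'rV[R]_n) : measurable (box a b).
Proof.
rewrite (_ : box a b = [set v : 'rV[R]_n | forall i, `[a ord0 i, b ord0 i]%classic (v ord0 i)]).
  exact: (@measurable_forall_coord n (fun i => `[a ord0 i, b ord0 i]%classic)
      (fun i => measurable_itv _)).
by apply/seteqP; split => x /= h i; have := h i; rewrite in_itv.
Qed.

Lemma measurable_rV_open n (U : set 'rV[R]_n) : open U -> measurable U.
Proof.
move=> oU.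
pose B (qk : 'rV[rat]_n * nat) : set 'rV[R]_n :=
  [set x | forall i, `](ratr (qk.1 ord0 i) - qk.2.+1%:R^-1 : R),
     (ratr (qk.1 ord0 i) + qk.2.+1%:R^-1)[%classic (x ord0 i)].
pose D := [set qk | B qk `<=` U].
rewrite (_ : U = \bigcup_(qk in D) B qk).
  rewrite bigcup_mkcond; apply: countable_bigcupT_measurable => // qk.
  case: ifPn => // _; exact: (@measurable_forall_coord n (fun i => _) (fun i => measurable_itv _)).
apply/seteqP; split => [x Ux|x [qk qkD]]; last exact: qkD.
have /nbhs_ballP[e /= e0 eU] : nbhs x U by apply: open_nbhs_nbhs.
(* A rational center within 1 / (k + 1) of [x] and the half-side 1 / (k + 1) put the whole box
   within 2 / (k + 1) < e of [x]. *)
pose k := Num.truncn (2 / e).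
have ke : 2 * k.+1%:R^-1 < e.
  rewrite -ltr_pdivlMl ?invr_gt0// -[_^-1 * e]invrK invfM invrK.
  rewrite ltf_pV2 ?posrE ?divr_gt0// mulrC.
  by rewrite mulrC; exact: (truncnS_gt (2 / e)).
have k0 : (0 : R) < k.+1%:R^-1 by rewrite invr_gt0.
have hq (i : 'I_n) : exists q : rat, x ord0 i - k.+1%:R^-1 < ratr q < x ord0 i + k.+1%:R^-1.
  have [//|q] := @rat_in_itvoo R (x ord0 i - k.+1%:R^-1) (x ord0 i + k.+1%:R^-1).
    by rewrite ltrBlDr -addrA ltrDl addr_gt0.
  by rewrite in_itv /=; exists q.
pose q : 'rV[rat]_n := \row_i projT1 (cid (hq i)).
have qP i : x ord0 i - k.+1%:R^-1 < ratr (q ord0 i) < x ord0 i + k.+1%:R^-1.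
  by rewrite mxE; case: cid.
exists (q, k); rewrite /D /B /=.
  move=> y /= By; apply: eU.
  rewrite mx_norm_ball /= /ball_ /=.
  apply: le_lt_trans ke; apply/rV_norm_le => [|i]; first by rewrite mulr_ge0// ltW.
  rewrite !mxE.
  move: (By i) (qP i); rewrite in_itv /=.
  move: (k.+1%:R^-1) (ratr _) (x ord0 i) (y ord0 i) => u v s t /andP[? ?] /andP[? ?].
  by rewrite ler_distl; apply/andP; split; lra.
move=> i; rewrite in_itv/=; move: (qP i).
by move: (k.+1%:R^-1) (ratr _) (x ord0 i) => u v s /andP[? ?]; apply/andP; split; lra.
Qed.

Lemma measurable_rV_continuous n (F : 'rV[R]_n -> R) :
  continuous F -> measurable_fun setT F.
Proof.
move=> cF; apply: (measurability _ (RGenOInfty.measurableE R)) => //.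
move=> _ [_ [x ->] <-]; rewrite setTI; apply: measurable_rV_open.
by apply: open_comp => // ? _; exact: cF.
Qed.

(** ['rV[R]_n] and [lebesgue_rV n] have the same points but carry the Borel and the completed
    sigma-algebra. Borel measurability is transferred to the Lebesgue side through this identity
    map. *)
Lemma measurable_lebesgue_id n :
  measurable_fun setT (id : lebesgue_rV n -> 'rV[R]_n).
Proof.
move=> _ A mA; rewrite setTI preimage_id.
exact: (@caratheodory_measurable_mu_ext _ _ _ (borel_lebesgue n)).
Qed.

Lemma measurable_lebesgue n (A : set 'rV[R]_n) : measurable A ->
  measurable (A : set (lebesgue_rV n)).
Proof.
by move=> mA; have := measurable_lebesgue_id measurableT mA; rewrite setTI.
Qed.

Lemma measurable_fun_lebesgue n d (T : measurableType d) (F : 'rV[R]_n -> T) :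
  measurable_fun setT F -> measurable_fun setT (F : lebesgue_rV n -> T).
Proof. by move=> mF; apply: (measurableT_comp mF); exact: measurable_lebesgue_id. Qed.

Lemma measurable_continuous n (F : 'rV[R]_n -> R) :
  continuous F -> measurable_fun setT (F : lebesgue_rV n -> R).
Proof. by move/measurable_rV_continuous; exact: measurable_fun_lebesgue. Qed.

Lemma borel_lebesgue_box n (a b : 'rV[R]_n) : (forall i, a ord0 i <= b ord0 i) ->
  borel_lebesgue n (box a b) = (\prod_(i < n) (b ord0 i - a ord0 i))%:E.
Proof.
elim: n a b => [|n IH] a b ab.
  rewrite big_ord0 /= diracE (_ : _ \in _ = true)//.
  by apply/mem_set => -[].
rewrite /= /cons_measure /pushforward.
rewrite (_ : _ @^-1` _ = `[a ord0 ord0, b ord0 ord0]%classic `*`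
   box (rsubmx (a : 'rV_(1 + n))) (rsubmx (b : 'rV_(1 + n)))); last first.
  apply/seteqP; split => -[t v] /=.
    move=> h; split; first by have := h ord0; rewrite in_itv /= (_ : rV_cons (t, v)
        ord0 ord0 = t)//;
      exact: (congr1 fst (rV_consK (t, v))).
    move=> i /=; have := h (rshift 1 i); rewrite !mxE.
    by rewrite (unsplitK (inr i)).
  rewrite in_itv/= => -[h1 h2] i.
  have [j ->|j ->] := @split_ordP 1 n i.
    rewrite (_ : lshift n j = @ord0 n); last by apply: val_inj; rewrite /= (ord1 j).
    by rewrite (_ : rV_cons (t, v) ord0 ord0 = t)//;
      exact: (congr1 fst (rV_consK (t, v))).
  by have := h2 j; rewrite !mxE (unsplitK (inr j)).
transitivity (lebesgue_measure `[a ord0 ord0, b ord0 ord0]%classic *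
  borel_lebesgue n (box (rsubmx (a : 'rV_(1 + n))) (rsubmx (b : 'rV_(1 + n)))))%E.
  by apply: product_measure1E; [exact: measurable_itv|exact: measurable_box].
rewrite IH; last by move=> i; rewrite !mxE; exact: ab.
rewrite lebesgue_measure_itv /= lte_fin big_ord_recl.
rewrite EFinM; congr (_ * _)%E.
  case: ifPn => //; rewrite -leNgt => h.
  by rewrite (_ : a ord0 ord0 = b ord0 ord0) ?subrr//; apply/eqP; rewrite eq_le ab h.
congr EFin; apply: eq_bigr => i _; rewrite !mxE.
by congr (b _ _ - a _ _); exact/val_inj.
Qed.

Lemma lebesgue_borel n (A : set 'rV[R]_n) : measurable A ->
  lebesgue n A = borel_lebesgue n A.
Proof. by move=> mA; exact: (@measurable_mu_extE _ _ _ (borel_lebesgue n)). Qed.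

Lemma lebesgue_box n (a b : 'rV[R]_n) : (forall i, a ord0 i <= b ord0 i) ->
  lebesgue n (box a b) = (\prod_(i < n) (b ord0 i - a ord0 i))%:E.
Proof. by move=> ab; rewrite lebesgue_borel ?borel_lebesgue_box//; exact: measurable_box. Qed.

Lemma measurable_cube n (c : 'rV[R]_n) r : measurable (cube c r : set (lebesgue_rV n)).
Proof. by apply: measurable_lebesgue; rewrite cube_box; exact: measurable_box. Qed.

Lemma lebesgue_cube n (c : 'rV[R]_n) r : 0 <= r ->
  lebesgue n (cube c r) = ((2 * r) ^+ n)%:E.
Proof.
move=> r0; rewrite cube_box lebesgue_box; last by move=> i; rewrite !mxE; lra.
congr EFin; rewrite -[RHS](_ : \prod_(i < n) (2 * r) = _); last first.
  by rewrite prodr_const card_ord.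
by apply: eq_bigr => i _; rewrite !mxE; lra.
Qed.

(** The pi-system of the uniqueness arguments, both for the scaling of Lebesgue measure and for
    functions with vanishing integrals. Boxes with some a_i > b_i are allowed; they are empty and
    make the family stable under intersection. *)
Definition boxes n : set (set 'rV[R]_n) := [set A | exists a b, A = box a b].

Lemma setI_closed_boxes n : setI_closed (@boxes n).
Proof.
move=> _ _ [a [b ->]] [a' [b' ->]].
exists (\row_i Num.max (a ord0 i) (a' ord0 i)), (\row_i Num.min (b ord0 i) (b' ord0 i)).
apply/seteqP; split => x /=.
  move=> [h1 h2] i; rewrite !mxE ge_max le_min.
  by move: (h1 i) (h2 i) => /andP[-> ->] /andP[-> ->].
move=> h; split => i; have := h i; rewrite !mxE ge_max le_min;
  by move=> /andP[/andP[? ?] /andP[? ?]]; apply/andP; split.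
Qed.

Lemma cube_boxes n (c : 'rV[R]_n) r : boxes (cube c r).
Proof. by rewrite cube_box; eexists; eexists. Qed.

Lemma bigcup_cube n : \bigcup_k (cube (0 : 'rV[R]_n) k%:R) = setT.
Proof.
apply/seteqP; split => // x _; exists (Num.truncn `|x|).+1 => //.
rewrite cubeE//= subr0 ltW//; exact: truncnS_gt.
Qed.

Lemma measurable_boxes n : @measurable _ 'rV[R]_n = <<s @boxes n >>.
Proof.
apply/seteqP; split; last first.
  apply: smallest_sub; first exact: sigma_algebra_measurable.
  by move=> _ [a [b ->]]; exact: measurable_box.
apply: smallest_sub; first exact: smallest_sigma_algebra.
rewrite -bigcup_seq => A [i _] [B mB <-]; rewrite setTI.
suff : @measurable _ (g_sigma_algebraType (@boxes n)) (rV_coord i @^-1` B) by [].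
suff mi : measurable_fun setT (rV_coord i : g_sigma_algebraType (@boxes n) -> R).
  by have := mi measurableT B mB; rewrite setTI.
apply: (measurability _ (RGenCInfty.measurableE R)) => //.
move=> _ [_ [x ->] <-]; rewrite setTI.
(* A half-space is the union of boxes that share its face and grow in all other directions. *)
rewrite (_ : _ @^-1` _ = \bigcup_k (box (\row_j if j == i then x else - k%:R)
   (const_mx k%:R : 'rV[R]_n))).
  by apply: bigcupT_measurable => k; apply: sub_sigma_algebra; eexists; eexists.
apply/seteqP; split => y /=; rewrite /rV_coord in_itv /= andbT.
  move=> xy; exists (Num.truncn `|y|).+1 => // j; rewrite !mxE.
  have : `|y ord0 j| <= (Num.truncn `|y|).+1%:R.
    by rewrite (le_trans (rV_coord_le _ _))// ltW//; exact: truncnS_gt.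
  by rewrite ler_norml => /andP[h ->]; rewrite andbT; case: eqP => [->|].
by move=> [k _] /(_ i); rewrite !mxE eqxx => /andP[].
Qed.

Lemma lebesgue_sigma_finite n : sigma_finite setT (@lebesgue R n).
Proof.
exists (fun k => cube 0 k%:R); first by rewrite bigcup_cube.
move=> k; split; first exact: measurable_cube.
by rewrite lebesgue_cube// ltry.
Qed.

Lemma measurable_affine n (a : R) (b : 'rV[R]_n) :
  measurable_fun setT (fun x : 'rV[R]_n => a *: x + b).
Proof.
apply: measurable_fun_rVP => i.
rewrite (_ : _ \o _ = (fun x => a * rV_coord i x + b ord0 i)); last first.
  by apply/funext => x; rewrite /rV_coord /= !mxE.
by apply: measurable_funD => //; apply: measurable_funM => //; exact: measurable_rV_coord.
Qed.

Lemma preimage_affine_box n (a : R) (b u v : 'rV[R]_n) : 0 < a ->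
  (fun x : 'rV[R]_n => a *: x + b) @^-1` box u v =
  box (a^-1 *: (u - b)) (a^-1 *: (v - b)).
Proof.
move=> a0; apply/seteqP; split => x /= h i; have := h i; rewrite !mxE.
  by rewrite ler_pdivrMl// lerBlDr ler_pdivlMl// lerBrDr.
by rewrite ler_pdivrMl// lerBlDr ler_pdivlMl// lerBrDr.
Qed.

(** Both sides are measures of a Borel set; they agree on [boxes] and are finite on cubes that
    exhaust the space, so they coincide. *)
Lemma lebesgue_affine n (a : R) (b : 'rV[R]_n) (A : set 'rV[R]_n) : 0 < a ->
  measurable A ->
  lebesgue n ((fun x => a *: x + b) @^-1` A) = ((a ^- n)%:E * lebesgue n A)%E.
Proof.
move=> a0 mA.
have mphi : measurable_fun setT (fun x : lebesgue_rV n => a *: (x : 'rV[R]_n) + b : 'rV[R]_n).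
  by apply: measurable_fun_lebesgue; exact: measurable_affine.
pose m1 := measure_function_pushforward__canonical__measure_function_Measure (@lebesgue R n) mphi.
have an0 : 0 <= a ^- n by rewrite invr_ge0 exprn_ge0// ltW.
pose m2 := mscale (NngNum an0)
  (measure_function_pushforward__canonical__measure_function_Measure (@lebesgue R n)
      (@measurable_lebesgue_id n)).
have boxE u v : m1 (box u v) = m2 (box u v).
  have [uv|] := pselect (forall i, u ord0 i <= v ord0 i); last first.
    move=> /existsNP[i /negP]; rewrite -ltNge => vu.
    rewrite (_ : box u v = set0) ?measure0//.
    apply/seteqP; split => // x /(_ i) /andP[h1 h2].
    by have := le_lt_trans (le_trans h1 h2) vu; rewrite ltxx.
  rewrite /m1 /m2 /mscale /= /pushforward preimage_affine_box// preimage_id.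
  rewrite !lebesgue_box//; last first.
    by move=> i; rewrite !mxE ler_pM2l ?invr_gt0// lerD2r.
  rewrite -EFinM; congr EFin.
  transitivity (\prod_(i < n) (a^-1 * (v ord0 i - u ord0 i))).
    by apply: eq_bigr => i _; rewrite !mxE; lra.
  by rewrite big_split /= prodr_const card_ord exprVn.
apply: (measure_unique (@boxes n) (fun k => cube 0 k%:R) (measurable_boxes n)
  (@setI_closed_boxes n) (fun k => cube_boxes _ _) (bigcup_cube n) m1 m2) => //.
  by move=> _ [u [v ->]]; exact: boxE.
move=> k; rewrite [X in m1 X]cube_box [m1 _]boxE /m2 /mscale /= /pushforward preimage_id.
rewrite -[X in lebesgue _ X]cube_box; by rewrite lebesgue_cube// -EFinM ltry.
Qed.

Lemma ge0_integral_affine n (a : R) (b : 'rV[R]_n) (f : 'rV[R]_n -> \bar R) :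
  0 < a -> measurable_fun setT f -> (forall x, 0 <= f x)%E ->
  (\int[lebesgue n]_x f (a *: (x : 'rV[R]_n) + b)%R = (a ^- n)%:E * \int[lebesgue n]_x f x)%E.
Proof.
move=> a0 mf f0.
have mphi : measurable_fun setT (fun x : lebesgue_rV n => a *: (x : 'rV[R]_n) + b : 'rV[R]_n).
  by apply: measurable_fun_lebesgue; exact: measurable_affine.
have an0 : 0 <= a ^- n by rewrite invr_ge0 exprn_ge0// ltW.
pose m1 := measure_function_pushforward__canonical__measure_function_Measure (@lebesgue R n) mphi.
pose m2 := measure_function_pushforward__canonical__measure_function_Measure (@lebesgue R n)
    (@measurable_lebesgue_id n).
have E1 : (\int[m1]_x f x = \int[lebesgue n]_x f (a *: (x : 'rV[R]_n) + b)%R)%E.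
  have := @ge0_integral_pushforward _ _ _ _ R _ mphi (lebesgue n)
      setT f measurableT mf (fun x _ => f0 x).
  by rewrite preimage_setT.
have E2 : (\int[m2]_x f x = \int[lebesgue n]_x f x)%E.
  have := @ge0_integral_pushforward _ _ _ _ R _ (@measurable_lebesgue_id n) (lebesgue n)
      setT f measurableT mf (fun x _ => f0 x).
  by rewrite preimage_setT.
rewrite -E1 -E2 -[X in (X%:E * _)%E]/((NngNum an0)%:num).
rewrite -(@ge0_integral_mscale _ _ R m2 setT measurableT (NngNum an0) f mf (fun x _ => f0 x)).
apply: (eq_measure_integral (mscale (NngNum an0) m2)) => A mA _.
exact: lebesgue_affine.
Qed.

Lemma integrable_affine n (a : R) (b : 'rV[R]_n) (f : 'rV[R]_n -> \bar R) :
  0 < a -> measurable_fun setT f -> (lebesgue n).-integrable setT f ->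
  (lebesgue n).-integrable setT (fun x : lebesgue_rV n => f (a *: (x : 'rV[R]_n) + b)).
Proof.
move=> a0 mf /integrableP[_ foo]; apply/integrableP; split.
  apply: (measurableT_comp mf).
  by apply: measurable_fun_lebesgue; exact: measurable_affine.
rewrite (ge0_integral_affine b a0 (f := fun x => `|f x|%E))//; last first.
  exact: measurableT_comp.
by rewrite lte_mul_pinfty// ?lee_fin ?invr_ge0 ?exprn_ge0// ltW.
Qed.

Lemma integral_affine n (a : R) (b : 'rV[R]_n) (f : 'rV[R]_n -> \bar R) :
  0 < a -> measurable_fun setT f -> (lebesgue n).-integrable setT f ->
  (\int[lebesgue n]_x f (a *: (x : 'rV[R]_n) + b)%R = (a ^- n)%:E * \int[lebesgue n]_x f x)%E.
Proof.
move=> a0 mf intf.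
rewrite [LHS]integralE [in RHS]integralE muleBr//; last first.
  by rewrite fin_num_adde_defl// fin_numN integrable_neg_fin_num.
congr (_ - _)%E.
  rewrite -(ge0_integral_affine b a0 (f := (f ^\+)%E))//.
    by apply: eq_integral => x _; rewrite !funeposE.
  exact: measurable_funepos.
rewrite -(ge0_integral_affine b a0 (f := (f ^\-)%E))//.
  by apply: eq_integral => x _; rewrite !funenegE.
exact: measurable_funeneg.
Qed.

Lemma Rintegral_affine n (a : R) (b : 'rV[R]_n) (f : 'rV[R]_n -> R) :
  0 < a -> measurable_fun setT f -> (lebesgue n).-integrable setT (EFin \o f) ->
  \int[lebesgue n]_x f (a *: (x : 'rV[R]_n) + b) = a ^- n * \int[lebesgue n]_x f x.
Proof.
move=> a0 mf intf; rewrite /Rintegral (integral_affine b a0 (f := EFin \o f))//.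
  by rewrite fineM// integrable_fin_num.
exact: measurableT_comp.
Qed.
End borel.

(** [lebesgue] is declared as a bare measure; Tonelli and Radon-Nikodym need the sigma-finite
    structure packed here. *)
Definition lebesgue_sf (R : realType) n :=
  HB.pack_for {sigma_finite_measure set (lebesgue_rV n) -> \bar R}
   (Measure.sort (@lebesgue R n))
   (Measure_isSigmaFinite.Build _ _ _ (@lebesgue R n) (@lebesgue_sigma_finite R n)).

(** * Smooth bumps and test functions *)

Section smooth1.
Context {R : realType}.
Implicit Types f g : R -> R.

(** The index is shifted by one: [Cn n] means n + 1 times differentiable, so that already [Cn 0]
    provides a derivative. *)
Fixpoint Cn n f : Prop := (forall x : R, derivable f x 1) /\
  (if n is m.+1 then Cn m (derive1 f) else True).

Definition smooth1 f := forall n, Cn n f.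

Lemma CnSE n f : Cn n.+1 f = ((forall x : R, derivable f x 1) /\ Cn n (derive1 f)).
Proof. by []. Qed.

Lemma Cn_derivable n f : Cn n f -> forall x : R, derivable f x 1.
Proof. by case: n => [|n] []. Qed.

Lemma smooth1_derivable f x : smooth1 f -> derivable f x 1.
Proof. by move=> /(_ 0)/Cn_derivable. Qed.

Lemma smooth1_derive f : smooth1 f -> smooth1 (derive1 f).
Proof. by move=> sf n; have [] := sf n.+1. Qed.

Lemma smooth1_continuous f : smooth1 f -> continuous f.
Proof.
move=> sf x; apply: differentiable_continuous; apply/derivable1_diffP.
exact: smooth1_derivable.
Qed.

Lemma CnS n f : Cn n.+1 f -> Cn n f.
Proof.
elim: n f => [|n IH] f; first by rewrite CnSE => -[df _]; split; [exact: df|].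
by rewrite [X in X -> _]CnSE CnSE => -[df /IH cf]; split.
Qed.

Lemma derive1_funE f (f' : R -> R) : (forall x : R, is_derive x 1 f (f' x)) -> derive1 f = f'.
Proof. by move=> h; apply/funext => x; rewrite derive1E; have := h x => -[_ ->]. Qed.

Lemma Cn_intro n f (f' : R -> R) : (forall x : R, is_derive x 1 f (f' x)) ->
  (n = 0 \/ Cn n.-1 f') -> Cn n f.
Proof.
move=> df; have df' (x : R) : derivable f x 1 by have [] := df x.
case: n => [_|n]; first by split; [exact: df'|].
by case=> // cf; rewrite CnSE (derive1_funE df); split.
Qed.

Lemma is_derive_derive1 f (x : R) : derivable f x 1 -> is_derive x 1 f (derive1 f x).
Proof. by move=> df; rewrite derive1E; exact: DeriveDef. Qed.

Lemma CnD n f g : Cn n f -> Cn n g -> Cn n (fun x => f x + g x).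
Proof.
elim: n f g => [|n IH] f g Cf Cg; apply: (@Cn_intro _ _ (fun x => derive1 f x + derive1 g x)).
- by move=> x; apply: is_deriveD; apply: is_derive_derive1; exact: (@Cn_derivable 0).
- by left.
- by move=> x; apply: is_deriveD; apply: is_derive_derive1; exact: (@Cn_derivable n.+1).
- by right; move: Cf Cg; rewrite !CnSE => -[_ cf] [_ cg]; exact: IH.
Qed.

Lemma is_derive1M f g (x : R) : derivable f x 1 -> derivable g x 1 ->
  is_derive x 1 (fun x => f x * g x) (f x * derive1 g x + g x * derive1 f x).
Proof. by move=> df dg; exact: (is_deriveM (is_derive_derive1 df) (is_derive_derive1 dg)). Qed.

Lemma CnM n f g : Cn n f -> Cn n g -> Cn n (fun x => f x * g x).
Proof.
elim: n f g => [|n IH] f g Cf Cg;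
  apply: (@Cn_intro _ _ (fun x => f x * derive1 g x + g x * derive1 f x)).
- by move=> x; apply: is_derive1M; exact: (@Cn_derivable 0).
- by left.
- by move=> x; apply: is_derive1M; exact: (@Cn_derivable n.+1).
- right; move: (Cf) (Cg); rewrite !CnSE => -[_ cf] [_ cg].
  by apply: CnD; apply: IH => //; exact: CnS.
Qed.

Lemma Cn_cst n (c : R) : Cn n (fun=> c).
Proof.
elim: n c => [|n IH] c; apply: (@Cn_intro _ _ (fun=> 0)).
- by left.
- by right; exact: IH.
Qed.

Lemma Cn_id n : Cn n (fun x => x).
Proof.
apply: (@Cn_intro _ _ (fun=> 1)); right; exact: Cn_cst.
Qed.

Lemma is_derive_affine f (a b x : R) : derivable f (a * x + b) 1 ->
  is_derive x 1 (fun x => f (a * x + b)) (a * derive1 f (a * x + b)).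
Proof.
move=> df.
have h : is_derive x 1 (fun x => a * x + b) a.
  have h1 : is_derive x 1 (a \*: id : R -> R) (a *: 1) by exact: is_deriveZ.
  have := @is_deriveD _ _ _ _ _ x 1 _ _ h1 (is_derive_cst b x 1).
  by rewrite addr0 [_ *: _]mulr1.
have := @is_derive1_comp _ f _ x _ _ (is_derive_derive1 df) h.
by rewrite mulrC.
Qed.

Lemma Cn_affine n f (a b : R) : Cn n f -> Cn n (fun x => f (a * x + b)).
Proof.
elim: n f => [|n IH] f Cf; apply: (@Cn_intro _ _ (fun x => a * derive1 f (a * x + b))).
- by move=> x; apply: is_derive_affine; exact: (@Cn_derivable 0).
- by left.
- by move=> x; apply: is_derive_affine; exact: (@Cn_derivable n.+1).
- right; move: Cf; rewrite CnSE => -[_ cf].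
  by apply: CnM; [exact: Cn_cst|exact: (IH (derive1 f))].
Qed.

Lemma smooth1M f g : smooth1 f -> smooth1 g -> smooth1 (fun x => f x * g x).
Proof. by move=> sf sg n; exact: CnM. Qed.

Lemma smooth1D f g : smooth1 f -> smooth1 g -> smooth1 (fun x => f x + g x).
Proof. by move=> sf sg n; exact: CnD. Qed.

Lemma smooth1_cst (c : R) : smooth1 (fun=> c).
Proof. by move=> n; exact: Cn_cst. Qed.

Lemma smooth1_id : smooth1 (fun x => x).
Proof. by move=> n; exact: Cn_id. Qed.

Lemma smooth1_affine f (a b : R) : smooth1 f -> smooth1 (fun x => f (a * x + b)).
Proof. by move=> sf n; exact: Cn_affine. Qed.

(* The k = 0 member is the classical flat function; the family is closed under
   differentiation. *)
Definition flat k (x : R) : R := if 0 < x then x ^- k * expR (- x^-1) else 0.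

Lemma flat_ge0 k x : 0 <= flat k x.
Proof.
rewrite /flat; case: ifPn => // x0; rewrite mulr_ge0 ?expR_ge0// invr_ge0.
by rewrite exprn_ge0// ltW.
Qed.

Lemma flat_le0 k x : x <= 0 -> flat k x = 0.
Proof. by move=> x0; rewrite /flat ltNge x0. Qed.

Lemma flat0_gt0 x : 0 < x -> 0 < flat 0 x.
Proof. by move=> x0; rewrite /flat x0 expr0 invr1 mul1r expR_gt0. Qed.

Lemma flat0_le1 x : flat 0 x <= 1.
Proof.
rewrite /flat; case: ifPn => // x0; rewrite expr0 invr1 mul1r -expR0 ler_expR.
by rewrite oppr_le0 invr_ge0 ltW.
Qed.

Lemma expR_ge_pow (y : R) m : 0 <= y -> y ^+ m / m`!%:R <= expR y.
Proof.
move=> y0.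
have : (\sum_(0 <= k < m.+1) exp_coeff y k <= expR y)%R.
  rewrite /expR; apply: nondecreasing_cvgn_le; last exact: is_cvg_series_exp_coeff.
  by apply: nondecreasing_series => k _ _; exact: exp_coeff_ge0.
rewrite big_nat_recr//=; apply: le_trans; rewrite lerDr sumr_ge0// => i _.
exact: exp_coeff_ge0.
Qed.

(** The term of order k + 1 of the exponential series at 1 / x bounds exp (- 1 / x) by (k + 1)! x^(k
    + 1). This is what makes the difference quotients of [flat] at 0 tend to 0. *)
Lemma flat_le_id k x : 0 < x -> flat k x <= (k.+1)`!%:R * x.
Proof.
move=> x0; rewrite /flat x0 expRN.
have xi : 0 <= x^-1 by rewrite invr_ge0 ltW.
have := expR_ge_pow k.+1 xi.
rewrite -(@lef_pV2 _ (expR _))  ?posrE ?expR_gt0//; last first.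
  by rewrite divr_gt0 ?exprn_gt0 ?invr_gt0// ltr0n fact_gt0.
rewrite invf_div exprVn invrK => h.
apply: (@le_trans _ _ (x ^- k * ((k.+1)`!%:R * x ^+ k.+1))).
  by rewrite ler_wpM2l// invr_ge0 exprn_ge0// ltW.
by rewrite mulrCA exprSr mulKf// lt0r_neq0// exprn_gt0.
Qed.

Lemma is_derive_flat k (x : R) :
  is_derive x 1 (flat k) (- k%:R * flat k.+1 x + flat k.+2 x).
Proof.
have [x0|x0|->] := ltgtP x 0.
- rewrite !flat_le0 ?ltW// mulr0 addr0.
  apply: (@near_eq_is_derive _ _ _ (cst 0)) => //.
  by near=> y; rewrite flat_le0//; near: y; by apply: filterS (lt_nbhsl x0) => y /ltW.
- apply: (@near_eq_is_derive _ _ _ (fun x : R => x ^- k * expR (- x^-1))).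
    by near=> y; rewrite /flat ifT//; near: y; exact: lt_nbhsr.
  have xn0 : x != 0 by rewrite gt_eqF.
  have h1 := @is_deriveV R id x 1 1 xn0 (is_derive_id x 1).
  have h2 := @is_derive1_comp R expR _ x _ _ (is_derive_expR _) (is_deriveN h1).
  have h4 := is_deriveM (is_deriveX k h1) h2.
  move: h4; set g := (X in is_derive _ _ X _).
  have -> : g = (fun y : R => y ^- k * expR (- y^-1)).
    by apply/funext => y; rewrite /g /GRing.mul /= fctE exprVn.
  move=> h4; apply: (is_derive_eq h4).
  rewrite /flat x0 /GRing.scale /= !fctE.
  move: (expR _) => E.
  rewrite -!exprVn; move: (x^-1) => y.
  by case: k {g h4} => [|k] /=; rewrite ?expr0 ?exprS; ring.
- rewrite !flat_le0// mulr0 addr0.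
  (* For h > 0 the quotient [flat k h / h] is [flat k.+1 h], squeezed between 0 and (k + 2)! |h|. *)
  have h : (fun h : R => h^-1 *: (flat k (h *: 1 + 0) - flat k 0)) @ 0^' --> (0 : R).
    apply: (@squeeze_cvgr _ _ _ _ (fun=> 0) (fun h => (k.+2)`!%:R * `|h|)).
    - near=> h; have h0 : h != 0 by near: h; exact: nbhs_dnbhs_neq.
      rewrite (flat_le0 k (lexx 0)) subr0 addr0 /GRing.scale /= mulr1 mulrC.
      have [hl|hg|] := ltgtP h 0; last by move/eqP; rewrite (negbTE h0).
        by rewrite (flat_le0 k (ltW hl)) mul0r lexx /= mulr_ge0.
      have -> : flat k h / h = flat k.+1 h.
        by rewrite /flat hg exprS invfM mulrC mulrA.
      by rewrite flat_ge0 /= gtr0_norm// flat_le_id.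
    - exact: cvg_cst.
    - rewrite -[X in _ --> X](mulr0 (k.+2)`!%:R) -(@normr0 _ R).
      apply: cvgM; first exact: cvg_cst.
      by apply: cvg_norm; rewrite normr0; apply: cvg_within_filter; exact: cvg_id.
  by apply: DeriveDef; [exact: cvgP h|exact: cvg_lim h].
Unshelve. all: end_near. Qed.

Lemma Cn_flat n k : Cn n (flat k).
Proof.
elim: n k => [|n IH] k; apply: (Cn_intro (is_derive_flat k)); first by left.
by right; apply: CnD => //; apply: CnM => //; exact: Cn_cst.
Qed.

Lemma smooth1_flat k : smooth1 (flat k).
Proof. by move=> n; exact: Cn_flat. Qed.

Lemma smooth1_bounded_support f (N : R) : continuous f ->
  (forall x, N < `|x| -> f x = 0) -> exists B, forall x, `|f x| <= B.
Proof.
move=> cf f0.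
have [N0|N0] := leP N 0.
  exists `|f 0| => x; have [->//|x0] := eqVneq x 0.
  by rewrite f0 ?normr0// (le_lt_trans N0)// normr_gt0.
have NN : - N <= N by rewrite (le_trans (y := 0))// ?oppr_le0 ltW.
have cnf : {within `[- N, N], continuous (fun x => `|f x|)}.
  by apply: continuous_subspaceT => x; apply: continuous_comp; [exact: cf|exact: norm_continuous].
have [c _ hc] := EVT_max NN cnf.
exists `|f c| => x; have [xN|xN] := leP `|x| N.
  by apply: hc; rewrite in_itv /= -ler_norml.
by rewrite f0// normr0.
Qed.

Definition hump (x : R) : R := flat 0 (1 - x) * flat 0 (1 + x).

Lemma smooth1_hump : smooth1 hump.
Proof.
rewrite (_ : hump = fun x => flat 0 (- 1 * x + 1) * flat 0 (1 * x + 1)).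
  by apply: smooth1M; apply: smooth1_affine; exact: smooth1_flat.
by apply/funext => x; rewrite /hump mulN1r mul1r addrC [1 + x]addrC.
Qed.

Lemma hump_ge0 x : 0 <= hump x.
Proof. by rewrite mulr_ge0// flat_ge0. Qed.

Lemma hump_le1 x : hump x <= 1.
Proof. by rewrite mulr_ile1// ?flat_ge0// flat0_le1. Qed.

Lemma hump_eq0 x : 1 <= `|x| -> hump x = 0.
Proof.
rewrite ler_normr /hump => /orP[h|h].
  by rewrite (@flat_le0 _ (1 - x)) ?mul0r// subr_le0.
by rewrite (@flat_le0 _ (1 + x)) ?mulr0//; lra.
Qed.

Lemma hump_gt0 x : `|x| < 1 -> 0 < hump x.
Proof. by rewrite ltr_norml => /andP[h1 h2]; rewrite mulr_gt0// flat0_gt0//; lra. Qed.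

End smooth1.

(** * Tensor products of one-variable functions *)

Section tensor.
Context {R : realType} {n : nat}.
Implicit Types (f : 'I_n -> R -> R) (x : 'rV[R]_n).

(** The test functions constructed below are all of this form. A partial derivative acts on one
    factor only, so the class is stable under [partial] and smoothness in n variables reduces to one
    variable. *)
Definition tensor f x : R := \prod_(i < n) f i (x ord0 i).

Definition upd f (i : 'I_n) (g : R -> R) : 'I_n -> R -> R :=
  fun j => if j == i then g else f j.

Lemma tensor_upd f i g x :
  tensor (upd f i g) x = g (x ord0 i) * \prod_(j < n | j != i) f j (x ord0 j).
Proof.
rewrite /tensor (bigD1 i)//= /upd eqxx; congr (_ * _).
by apply: eq_bigr => j /negbTE ->.
Qed.

Lemma continuous_tensor f : (forall i, continuous (f i)) -> continuous (tensor f).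
Proof.
move=> cf x; rewrite /tensor.
elim: (index_enum _) => [|i s IH].
  rewrite (_ : (fun _ => _) = cst 1); first exact: cst_continuous.
  by apply/funext => y; rewrite big_nil.
have c1 : {for x, continuous (fun x : 'rV[R]_n => f i (x ord0 i))}.
  apply: (@continuous_comp 'rV[R]_n R R (fun x : 'rV[R]_n => x ord0 i) (f i) x).
    exact: coord_continuous.
  exact: cf.
rewrite (_ : (fun _ => _) = (fun x0 : 'rV[R]_n => f i (x0 ord0 i)) *
    (fun x0 => \prod_(i <- s) f i (x0 ord0 i))).
  exact: (continuousM c1 IH).
by apply/funext => y; rewrite big_cons.
Qed.

Lemma tensor_line f i x (h : R) :
  tensor f (h *: delta_mx ord0 i + x) = tensor (upd f i (fun=> f i (h + x ord0 i))) x.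
Proof.
rewrite tensor_upd /tensor (bigD1 i)//= !mxE !eqxx mulr1; congr (_ * _).
by apply: eq_bigr => j /negbTE ji; rewrite !mxE ji andbF mulr0 add0r.
Qed.

Lemma is_derive_tensor f i x : derivable (f i) (x ord0 i) 1 ->
  is_derive x (delta_mx ord0 i) (tensor f) (tensor (upd f i (derive1 (f i))) x).
Proof.
move=> df.
have h : (fun h => h^-1 *: (tensor f (h *: delta_mx ord0 i + x) - tensor f x)) @ 0^' -->
   tensor (upd f i (derive1 (f i))) x.
  rewrite tensor_upd; set P := \prod_(_ < _ | _) _.
  rewrite (_ : (fun h : R => _) =
     (fun h => (h^-1 *: (f i (h *: 1 + x ord0 i) - f i (x ord0 i))) * P)); last first.
    apply/funext => h; rewrite tensor_line tensor_upd -/P.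
    by rewrite /tensor (bigD1 i)//= -/P -mulrBl scalerAl /GRing.scale /= mulr1.
  apply: cvgM; last exact: cvg_cst.
  have := df; rewrite derive1E /derive => /cvg_ex[l hl].
  by rewrite (cvg_lim _ hl).
by apply: DeriveDef; [exact: cvgP h|exact: cvg_lim h].
Qed.

Lemma foldr_partial_tensor f (s : seq 'I_n) : (forall i, smooth1 (f i)) ->
  exists g, foldr partial (tensor f) s = tensor g /\ forall i, smooth1 (g i).
Proof.
move=> sf; elim: s => [|i s [g [gE sg]]] /=; first by exists f.
exists (upd g i (derive1 (g i))); split.
  apply/funext => x; rewrite gE /partial.
  by have [_ ->] := is_derive_tensor (smooth1_derivable (x := x ord0 i) (sg i)).
by move=> j; rewrite /upd; case: eqP => // _; exact: smooth1_derive.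
Qed.

Lemma partial_tensor f i : (forall i, smooth1 (f i)) ->
  partial i (tensor f) = tensor (upd f i (derive1 (f i))).
Proof.
move=> sf; apply/funext => x; rewrite /partial.
by have [_ ->] := is_derive_tensor (smooth1_derivable (x := x ord0 i) (sf i)).
Qed.

Lemma smooth_tensor f : (forall i, smooth1 (f i)) -> smooth (tensor f).
Proof.
move=> sf s /=; have [g [-> sg]] := foldr_partial_tensor s sf; split.
  by apply: continuous_tensor => i; exact: smooth1_continuous.
move=> i x.
by have [] := is_derive_tensor (smooth1_derivable (x := x ord0 i) (sg i)).
Qed.

Lemma compact_support_cube (F : 'rV[R]_n -> R) c r :
  (forall x, ~ cube c r x -> F x = 0) -> compact (closure [set x | F x != 0]).
Proof.
move=> F0.
have h : closure [set x | F x != 0] `<=` cube c r.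
  rewrite -[X in _ `<=` X](_ : closure (cube c r) = _).
    apply: closure_subset => x /= /negP Fx; apply: contrapT => /F0 /eqP; exact: Fx.
  apply/esym/closure_id; apply: compact_closed; last exact: compact_cube.
  exact: norm_hausdorff.
exact: (subclosed_compact (@closed_closure _ _) (@compact_cube R n c r) h).
Qed.

Lemma tensor_eq0 f x i : f i (x ord0 i) = 0 -> tensor f x = 0.
Proof. by move=> fi; rewrite /tensor (bigD1 i)//= fi mul0r. Qed.

Lemma tensor_supp f (c : 'rV[R]_n) r : (forall i s, ~~ (c ord0 i - r <= s <= c ord0 i + r) ->
    f i s = 0) ->
  forall x, ~ cube c r x -> tensor f x = 0.
Proof.
by move=> f0 x /existsNP[i /negP xi]; apply: (tensor_eq0 (i := i)); exact: f0.
Qed.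

Lemma test_function_tensor f (c : 'rV[R]_n) r : (forall i, smooth1 (f i)) ->
  (forall i s, ~~ (c ord0 i - r <= s <= c ord0 i + r) -> f i s = 0) ->
  test_function (tensor f).
Proof.
move=> sf f0; split; first exact: smooth_tensor.
by apply: (@compact_support_cube _ c r); exact: tensor_supp.
Qed.

End tensor.

(** * Vitali covering and a maximal inequality *)

Section vitali.
Context {R : realType} {n : nat}.
Implicit Types (c : 'rV[R]_n) (r : R).

Lemma cube_meet_sub c1 c2 r1 r2 : 0 < r1 -> 0 < r2 -> r1 <= r2 ->
  cube c1 r1 `&` cube c2 r2 !=set0 -> cube c1 r1 `<=` cube c2 (3 * r2).
Proof.
move=> r10 r20 r12 [y []]; rewrite !cubeE; try lra; move=> /= y1 y2 x /= x1.
rewrite (_ : x - c2 = (x - c1) + (c1 - y) + (y - c2)); last first.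
  by rewrite !addrA !subrK.
rewrite distrC in y1.
have := ler_normD ((x - c1) + (c1 - y)) (y - c2).
have := ler_normD (x - c1) (c1 - y).
lra.
Qed.

Lemma seq_argmax (I : eqType) (r : I -> R) (s : seq I) : s != [::] ->
  exists2 j, j \in s & forall i, i \in s -> r i <= r j.
Proof.
elim: s => // a s IH _; have [->|/IH[j js jmax]] := eqVneq s [::].
  by exists a; [exact: mem_head|move=> i; rewrite inE => /eqP->].
have [raj|rja] := leP (r a) (r j).
  by exists j; [rewrite inE js orbT|move=> i; rewrite inE => /orP[/eqP->|/jmax]].
exists a; first exact: mem_head.
move=> i; rewrite inE => /orP[/eqP->//|/jmax ij].
by rewrite (le_trans ij)// ltW.
Qed.

(** Greedy selection: a cube of maximal radius is kept, the cubes that meet it lie in its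
    3-dilation, and the induction goes on with those that do not meet it. *)
Lemma finite_vitali (I : eqType) (c : I -> 'rV[R]_n) (r : I -> R) (s : seq I) :
  (forall i, 0 < r i) ->
  exists D : seq I, [/\ uniq D, {subset D <= s},
    trivIset [set` D] (fun i => cube (c i) (r i)) &
    forall i, i \in s -> exists2 j, j \in D & cube (c i) (r i) `<=` cube (c j) (3 * r j)].
Proof.
move=> r0; have [m] := ubnP (size s); elim: m s => // m IH s sm.
have [->|s0] := eqVneq s [::].
  by exists [::]; split => //; move=> i j /=; rewrite inE.
have [j js jmax] := seq_argmax r s0.
pose far i := `[< cube (c i) (r i) `&` cube (c j) (r j) = set0 >].
have farj : ~~ far j.
  apply/asboolPn => /seteqP[/(_ (c j))h _]; apply: h.
  by split; apply: cube_center; exact: ltW.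
have [|D [uD Ds tD cD]] := IH [seq i <- s | far i].
  rewrite -ltnS (leq_trans _ sm)// ltnS size_filter -(count_predC far s) -addn1 leq_add2l.
  by rewrite -has_count; apply/hasP; exists j.
exists (j :: D); split.
- rewrite /= uD andbT; apply/negP => /Ds; rewrite mem_filter => /andP[fj _].
  by rewrite fj in farj.
- move=> i; rewrite inE => /orP[/eqP->//|/Ds]; by rewrite mem_filter => /andP[].
- move=> i k /=; rewrite !inE => /orP[/eqP->|iD] /orP[/eqP->|kD] //.
  + move: (Ds _ kD); rewrite mem_filter => /andP[/asboolP e _].
    by rewrite setIC e => -[].
  + move: (Ds _ iD); rewrite mem_filter => /andP[/asboolP e _].
    by rewrite e => -[].
  + exact: tD.
- move=> i si; have [fi|nfi] := boolP (far i).
    have [|k kD ik] := cD i; first by rewrite mem_filter fi.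
    by exists k => //; rewrite inE kD orbT.
  exists j; first exact: mem_head.
  apply: cube_meet_sub => //; first exact: jmax.
  by apply/set0P/eqP; move/asboolPn : nfi.
Qed.

End vitali.

Section real_integrals.
Context d (T : measurableType d) {R : realType} (mu : {measure set T -> \bar R}).
Implicit Types (f g : T -> R).

Lemma ge0_intZ (k : R) f : 0 <= k -> measurable_fun setT f -> (forall x, 0 <= f x) ->
  (\int[mu]_x (k * f x)%:E = k%:E * \int[mu]_x (f x)%:E)%E.
Proof.
move=> k0 mf f0; under eq_integral do rewrite EFinM.
rewrite ge0_integralZl//; first exact: measurableT_comp.
by move=> x _; rewrite lee_fin.
Qed.

Lemma ge0_le_int f g : measurable_fun setT f -> measurable_fun setT g ->
  (forall x, 0 <= f x) -> (forall x, f x <= g x) ->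
  (\int[mu]_x (f x)%:E <= \int[mu]_x (g x)%:E)%E.
Proof.
move=> mf mg f0 fg; apply: ge0_le_integral => //; try exact: measurableT_comp.
- by move=> x _; rewrite lee_fin.
- by move=> x _; rewrite lee_fin.
Qed.

Lemma ge0_intD f g : measurable_fun setT f -> measurable_fun setT g ->
  (forall x, 0 <= f x) -> (forall x, 0 <= g x) ->
  (\int[mu]_x (f x + g x)%:E = \int[mu]_x (f x)%:E + \int[mu]_x (g x)%:E)%E.
Proof.
move=> mf mg f0 g0; under eq_integral do rewrite EFinD.
by apply: ge0_integralD => //; try exact: measurableT_comp;
  by move=> x _; rewrite lee_fin.
Qed.

Lemma measurable_powR_fun f (s : R) : measurable_fun setT f ->
  measurable_fun setT (fun x => f x `^ s).
Proof. by move=> mf; apply: (measurableT_comp (measurable_powR _)). Qed.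

End real_integrals.

Section sums.
Context d (T : measurableType d) {R : realType} (mu : {measure set T -> \bar R}).
Variable I : choiceType.
Implicit Types (F G : I -> set T) (s : seq I) (f : T -> \bar R).
Local Open Scope ereal_scope.

Lemma sum_integral_disjoint F f s : (forall i, measurable (F i)) -> uniq s ->
  trivIset [set` s] F -> measurable_fun setT f -> (forall x, 0 <= f x) ->
  \sum_(i <- s) \int[mu]_(x in F i) f x <= \int[mu]_x f x.
Proof.
move=> mF us tF mf f0; rewrite -ge0_integral_bigsetU//.
- by apply: ge0_subset_integral => //; exact: bigsetU_measurable.
- exact: measurable_funTS.
Qed.

Lemma measure_bigsetU_le F s : (forall i, measurable (F i)) ->
  mu (\big[setU/set0]_(i <- s) F i) <= \sum_(i <- s) mu (F i).
Proof.
move=> mF; elim: s => [|i s IH]; first by rewrite !big_nil measure0.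
rewrite !big_cons (le_trans (measureU2 _ (mF i) _))//; last exact: leeD2l.
exact: bigsetU_measurable.
Qed.

Lemma sum_measure_disjoint F G s t : (forall i, measurable (F i)) ->
  (forall i, measurable (G i)) -> uniq s -> trivIset [set` s] F ->
  (forall i, i \in s -> F i `<=` \big[setU/set0]_(j <- t) G j) ->
  \sum_(i <- s) mu (F i) <= \sum_(j <- t) mu (G j).
Proof.
move=> mF mG us tF FG; apply: le_trans (measure_bigsetU_le t mG).
set U := \big[_/_]_(j <- t) _.
have mU : measurable U by exact: bigsetU_measurable.
rewrite -[leRHS]mul1e -(integral_cst mu mU 1).
apply: (@le_trans _ _ (\int[mu]_(x in \big[setU/set0]_(i <- s) F i) cst 1 x)).
  rewrite ge0_integral_bigsetU//.
  by apply: lee_sum => i _; rewrite integral_cst// mul1e.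
apply: ge0_subset_integral => //; first exact: bigsetU_measurable.
move=> x; rewrite -bigcup_seq => -[i /= si]; exact: FG.
Qed.

Lemma measurable_truncate (u : T -> R) (t : R) : measurable_fun setT u ->
  measurable_fun setT (fun x => if (u x <= t)%R then 0%R else u x).
Proof.
by move=> mu_; apply: measurable_fun_ifT => //; exact: measurable_fun_ler.
Qed.

End sums.

(* [cb] abstracts [cube], of which only the measure, the monotonicity and the
   Vitali property matter here. *)
Section maximal_abstract.
Context d (T : measurableType d) {R : realType} (mu : {measure set T -> \bar R}).
Context {n : nat} (cb : 'rV[R]_n -> R -> set T).
Hypothesis mcb : forall c r, measurable (cb c r).
Hypothesis mu_cb : forall c r, 0 <= r -> mu (cb c r) = ((2 * r) ^+ n)%:E.
Hypothesis cb_sub : forall c r r', 0 <= r -> r <= r' -> cb c r `<=` cb c r'.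
Hypothesis cb_vitali : forall (I : eqType) (c : I -> 'rV[R]_n) (r : I -> R) (s : seq I),
  (forall i, 0 < r i) ->
  exists D : seq I, [/\ uniq D, {subset D <= s},
    trivIset [set` D] (fun i => cb (c i) (r i)) &
    forall i, i \in s -> exists2 j, j \in D & cb (c i) (r i) `<=` cb (c j) (3 * r j)].
Implicit Types (u : T -> R).

(** On a dilated cube of volume (2 eta r)^n the values of u below [kap * tau] contribute at most tau
    r^n / 2: this fixes [kap]. Where a > tau, the truncated u therefore keeps an integral of at
    least tau r^n / 2. The Vitali subfamily of the dilated cubes is disjoint, so these integrals add
    up, and its 3-dilations cover the original disjoint cubes. *)
Lemma weak_type (eta tau : R) u m (c : 'I_m -> 'rV[R]_n) (r a : 'I_m -> R) :
  1 <= eta -> 0 < tau -> measurable_fun setT u -> (forall x, 0 <= u x) ->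
  (forall i, 0 < r i) -> trivIset setT (fun i => cb (c i) (r i)) ->
  (forall i, ((a i * r i ^+ n)%:E <= \int[mu]_(x in cb (c i) (eta * r i)) (u x)%:E)%E) ->
  ((tau * \sum_(i < m | (tau < a i)%R) r i ^+ n)%:E <=
   (2 * (3 * eta) ^+ n)%:E *
   \int[mu]_x (if u x <= (2 * (2 * eta) ^+ n)^-1 * tau then 0 else u x)%:E)%E.
Proof.
move=> eta1 tau0 mu_ u0 r0 tQ ha.
have eta0 : 0 < eta by lra.
set kap := (2 * (2 * eta) ^+ n)^-1; pose v x := if u x <= kap * tau then 0 else u x.
pose s := [seq i <- index_enum 'I_m | tau < a i].
have er0 i : 0 < eta * r i by rewrite mulr_gt0.
have [D [uD Ds tD cD]] := @cb_vitali _ c (fun i => eta * r i) s er0.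
have mv : measurable_fun setT v by exact: measurable_truncate.
have v0 x : 0 <= v x by rewrite /v; case: ifP.
have h1 : (\sum_(i <- s) mu (cb (c i) (r i)) <=
           \sum_(j <- D) mu (cb (c j) (3 * (eta * r j))))%E.
  apply: sum_measure_disjoint.
  - by move=> i; exact: mcb.
  - by move=> i; exact: mcb.
  - by rewrite filter_uniq// index_enum_uniq.
  - by move=> i j _ _; exact: tQ.
  - move=> i /cD[j jD ij] x xi; rewrite -bigcup_seq; exists j => //=; apply: ij.
    apply: cb_sub xi; first exact: ltW.
    by rewrite ler_peMl// ltW.
have {}h1 : \sum_(i <- s) r i ^+ n <= (3 * eta) ^+ n * \sum_(j <- D) r j ^+ n.
  rewrite -(@ler_pM2l _ (2 ^+ n)) ?exprn_gt0//.
  rewrite -lee_fin; apply: le_trans (le_trans _ h1) _.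
    rewrite mulr_sumr -sumEFin; apply: lee_sum => i _.
    by rewrite mu_cb ?(ltW (r0 i))// exprMn lexx.
  rewrite mulrCA !mulr_sumr -sumEFin; apply: lee_sum => i _.
  rewrite mu_cb; last by rewrite !mulr_ge0 ?ltW.
  by rewrite lee_fin -!exprMn (_ : 2 * _ = 3 * eta * (2 * r i)) ?lexx//; lra.
have h2 j : j \in D -> ((tau / 2 * r j ^+ n)%:E <= \int[mu]_(x in cb (c j) (eta * r j)) (v x)%:E)%E.
  move=> /Ds; rewrite mem_filter => /andP[taj _].
  set Q := cb _ _.
  have mQ : measurable Q by exact: mcb.
  have e1 : (\int[mu]_(x in Q) (u x)%:E <= \int[mu]_(x in Q) (v x)%:E + (tau / 2 * r j ^+ n)%:E)%E.
    have -> : ((tau / 2 * r j ^+ n)%:E = \int[mu]_(x in Q) (cst (kap * tau)%:E) x)%E.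
      rewrite integral_cst// mu_cb ?ltW// -EFinM; congr EFin.
      rewrite /kap !exprMn invfM.
      have e0 : eta ^+ n != 0 by rewrite expf_neq0// gt_eqF.
      have t0 : (2 : R) ^+ n != 0 by rewrite expf_neq0.
      by field; rewrite e0 t0.
    have kt0 : 0 <= kap * tau.
      by rewrite mulr_ge0 ?(ltW tau0)// invr_ge0 mulr_ge0// exprn_ge0//; lra.
    rewrite -ge0_integralD//.
    - apply: ge0_le_integral => //.
      + by move=> x _; rewrite lee_fin.
      + by apply: measurable_funTS; exact: measurableT_comp.
      + apply: emeasurable_funD => //; apply: measurable_funTS; exact: measurableT_comp.
      + move=> x _ /=; rewrite -EFinD lee_fin /v; case: ifP => h; first by rewrite add0r.
        by rewrite lerDl.
    - by move=> x _; rewrite lee_fin.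
    - by apply: measurable_funTS; exact: measurableT_comp.
  have e2 : ((tau * r j ^+ n)%:E <= \int[mu]_(x in Q) (v x)%:E + (tau / 2 * r j ^+ n)%:E)%E.
    apply: le_trans e1; apply: le_trans (ha j).
    by rewrite lee_fin ler_wpM2r ?exprn_ge0 ?ltW.
  rewrite -leeBlDr// -EFinB in e2; apply: le_trans e2.
  by rewrite lee_fin; lra.
have h3 : ((tau / 2 * \sum_(j <- D) r j ^+ n)%:E <= \int[mu]_x (v x)%:E)%E.
  apply: (@le_trans _ _ (\sum_(j <- D) \int[mu]_(x in cb (c j) (eta * r j)) (v x)%:E)%E).
    rewrite mulr_sumr -sumEFin big_seq [leRHS]big_seq; exact: lee_sum.
  apply: sum_integral_disjoint => //.
  - exact: measurableT_comp.
apply: (@le_trans _ _ ((2 * (3 * eta) ^+ n)%:E * (tau / 2 * \sum_(j <- D) r j ^+ n)%:E)%E).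
  rewrite -EFinM lee_fin -big_filter -/s.
  have -> : 2 * (3 * eta) ^+ n * (tau / 2 * \sum_(j <- D) r j ^+ n) =
    tau * ((3 * eta) ^+ n * \sum_(j <- D) r j ^+ n) by field.
  by rewrite ler_wpM2l// ltW.
by rewrite lee_wpmul2l// lee_fin mulr_ge0// exprn_ge0//; lra.
Qed.

(** Dyadic layer-cake formula: the largest level t0 2^k below a is at least a / 2, so a single term
    of the sum is enough. *)
Lemma level_sum (t0 s a : R) N : 0 < t0 -> 0 < s -> t0 < a -> a <= t0 * 2 ^+ N ->
  a `^ s <= 2 `^ s * \sum_(k < N | t0 * 2 ^+ k < a) (t0 * 2 ^+ k) `^ s.
Proof.
move=> t00 s0; elim: N => [|N IH] ta aN.
  by rewrite expr0 mulr1 leNgt ta in aN.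
rewrite big_mkcond big_ord_recr/= -big_mkcond/=.
have [aN'|Na] := leP a (t0 * 2 ^+ N).
  by rewrite addr0; exact: IH.
rewrite mulrDr ler_wpDl//.
  by rewrite mulr_ge0 ?powR_ge0// sumr_ge0// => i _; exact: powR_ge0.
rewrite -powRM//; last by rewrite mulr_ge0 ?exprn_ge0 ?ltW.
rewrite mulrCA -exprS; apply: ge0_ler_powR => //; rewrite ?nnegrE.
- exact: ltW.
- by rewrite (le_trans (ltW t00))// ltW.
- by rewrite mulr_ge0 ?exprn_ge0 ?ltW.
Qed.

(** The powers grow by the factor 2^s > 1 from one level to the next, so their sum is comparable to
    the last one. *)
Lemma geometric_level_sum (t0 s v : R) N : 0 < t0 -> 0 < s ->
  \sum_(k < N | t0 * 2 ^+ k < v) (t0 * 2 ^+ k) `^ s <= 2 `^ s / (2 `^ s - 1) * v `^ s.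
Proof.
move=> t00 s0.
have b1 : 1 < (2 : R) `^ s.
  by have : 1 `^ s < (2 : R) `^ s; [apply: gt0_ltr_powR; rewrite ?nnegrE//; lra|rewrite powR1].
have tk0 k : 0 <= t0 * 2 ^+ k by rewrite mulr_ge0 ?exprn_ge0// ltW.
have tkS k : (t0 * 2 ^+ k.+1) `^ s = 2 `^ s * (t0 * 2 ^+ k) `^ s.
  by rewrite -(powRM _ _ (tk0 k))// exprS mulrCA.
have hsum M : (2 `^ s - 1) * \sum_(k < M) (t0 * 2 ^+ k) `^ s <= (t0 * 2 ^+ M) `^ s.
  elim: M => [|M IH]; first by rewrite big_ord0 mulr0 powR_ge0.
  by rewrite big_ord_recr /= mulrDr tkS mulrBl mul1r; lra.
elim: N => [|N IH].
  by rewrite big_ord0 mulr_ge0 ?powR_ge0// divr_ge0 ?powR_ge0// subr_ge0 ltW.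
have [vN|Nv] := leP v (t0 * 2 ^+ N).
  by rewrite big_mkcond big_ord_recr/= -big_mkcond/= ltNge vN /= addr0.
apply: (@le_trans _ _ (\sum_(k < N.+1) (t0 * 2 ^+ k) `^ s)).
  by rewrite [leRHS](bigID (fun k : 'I_N.+1 => t0 * 2 ^+ k < v))/= lerDl sumr_ge0// => i _;
      exact: powR_ge0.
have b0 : 0 < (2 : R) `^ s - 1 by rewrite subr_gt0.
rewrite -(ler_pM2l b0) mulrA mulrCA divff ?gt_eqF// mulr1.
apply: le_trans (hsum N.+1) _.
rewrite tkS ler_wpM2l ?powR_ge0//.
apply: ge0_ler_powR; rewrite ?nnegrE//; try exact: ltW.
exact: le_trans (tk0 N) (ltW Nv).
Qed.

(** A discrete Marcinkiewicz interpolation. The weak-type bounds at the levels t0 2^k are multiplied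
    by (t0 2^k)^(s - 1) and added. At a point x the truncated u survives only at levels below u x /
    kap, so the weights form a geometric sum of order (u x)^(s - 1); here s > 1 is essential. *)
Lemma maximal_sum_abstract (eta s : R) : 1 <= eta -> 1 < s -> exists2 C : R, 0 < C &
  forall u m (c : 'I_m -> 'rV[R]_n) (r a : 'I_m -> R),
  measurable_fun setT u -> (forall x, 0 <= u x) ->
  (forall i, 0 < r i) -> trivIset setT (fun i => cb (c i) (r i)) ->
  (forall i, 0 <= a i) ->
  (forall i, ((a i * r i ^+ n)%:E <= \int[mu]_(x in cb (c i) (eta * r i)) (u x)%:E)%E) ->
  ((\sum_(i < m) r i ^+ n * a i `^ s)%:E <= C%:E * \int[mu]_x (u x `^ s)%:E)%E.
Proof.
move=> eta1 s1.
have eta0 : 0 < eta by lra.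
pose kap := (2 * (2 * eta) ^+ n)^-1.
have kap0 : 0 < kap by rewrite invr_gt0 mulr_gt0// exprn_gt0// mulr_gt0.
pose K := 2 * (3 * eta) ^+ n.
have K0 : 0 < K by rewrite mulr_gt0// exprn_gt0// mulr_gt0.
have s0 : 0 < s - 1 by lra.
pose C1 := (2 : R) `^ (s - 1) / (2 `^ (s - 1) - 1).
have b1 : 1 < (2 : R) `^ (s - 1) 
  by have : 1 `^ (s - 1) < (2 : R) `^ (s - 1); [apply: gt0_ltr_powR; rewrite ?nnegrE//;
      lra|rewrite powR1].
have C10 : 0 < C1 by rewrite divr_gt0 ?powR_gt0// subr_gt0.
have k1 : 0 < (kap^-1) `^ (s - 1) by rewrite powR_gt0// invr_gt0.
exists (2 `^ s * K * (C1 * (kap^-1) `^ (s - 1))).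
  by apply: mulr_gt0; [apply: mulr_gt0 => //; exact: powR_gt0|exact: mulr_gt0].
move=> u m c r a mu_ u0 r0 tQ a0 ha.
(* A starting level below every positive [a i]; indices with [a i = 0] add nothing to the left-hand
   side. *)
have [t0 t00 ta] : exists2 t0 : R, 0 < t0 & forall i, 0 < a i -> t0 < a i.
  pose F i := if 0 < a i then a i else 1.
  have F0 : 0 < \big[Order.min/1]_(i < m) F i.
    by apply: lt_bigmin => // i _; rewrite /F; case: ifP.
  exists (\big[Order.min/1]_(i < m) F i / 2); first by rewrite divr_gt0.
  move=> i ai; have : \big[Order.min/1]_(i < m) F i <= F i by exact: bigmin_le_cond.
  by rewrite {2}/F ai => h; lra.
have [N aN] : exists N, forall i, a i <= t0 * 2 ^+ N.
  pose N := (Num.truncn ((\sum_i a i) / t0)).+1.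
  exists N => i; rewrite mulrC -ler_pdivrMr//.
  apply: (@le_trans _ _ ((\sum_i a i) / t0)).
    by rewrite ler_pM2r ?invr_gt0// (bigD1 i)//= lerDl sumr_ge0.
  apply: (@le_trans _ _ N%:R); first by rewrite ltW// truncnS_gt.
  by rewrite -natrX ler_nat ltnW// ltn_expl.
have tk0 k : 0 < t0 * 2 ^+ k by rewrite mulr_gt0// exprn_gt0.
have powS (x : R) : 0 <= x -> x `^ s = x `^ (s - 1) * x.
  move=> x0; have [->|xn0] := eqVneq x 0; first by rewrite mulr0 powR0// gt_eqF//; lra.
  rewrite -{3}(powRr1 x0) -powRD; last by rewrite xn0 implybT.
  by congr (_ `^ _); lra.
have step1 : \sum_(i < m) r i ^+ n * a i `^ s <=
  2 `^ s * \sum_(k < N) (t0 * 2 ^+ k) `^ (s - 1) *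
     (t0 * 2 ^+ k * \sum_(i < m | t0 * 2 ^+ k < a i) r i ^+ n).
  apply: (@le_trans _ _ (\sum_(i < m) r i ^+ n * (2 `^ s * \sum_(k < N | t0 * 2 ^+ k < a i)
      (t0 * 2 ^+ k) `^ s))).
    apply: ler_sum => i _; apply: ler_wpM2l; first by rewrite exprn_ge0// ltW.
    have [ai|] := ltP 0 (a i); first by apply: level_sum => //; [lra|exact: ta].
    move=> ai; have -> : a i = 0 by apply/eqP; rewrite eq_le ai a0.
    rewrite powR0 ?gt_eqF//; last lra.
    by rewrite mulr_ge0 ?powR_ge0// sumr_ge0// => k _; exact: powR_ge0.
  rewrite mulr_sumr.
  under eq_bigr => i _ do rewrite mulrCA mulr_sumr mulr_sumr big_mkcond.
  rewrite exchange_big /=; apply: ler_sum => k _.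
  rewrite !mulr_sumr [leRHS]big_mkcond /=; apply: ler_sum => i _.
  case: ifP => // _; rewrite (powS _ (ltW (tk0 _))).
  by rewrite (_ : _ * (_ * (_ * _)) = 2 `^ s * ((t0 * 2 ^+ k) `^ (s - 1)
      * (t0 * 2 ^+ k * r i ^+ n))) ?lexx//; ring.
pose v k x := if u x <= kap * (t0 * 2 ^+ k) then 0 else u x.
have mv k : measurable_fun setT (v k) by exact: measurable_truncate.
have v0 k x : 0 <= v k x by rewrite /v; case: ifP.
have tp0 k : 0 <= (t0 * 2 ^+ k) `^ (s - 1) by exact: powR_ge0.
apply: (@le_trans _ _ ((2 `^ s * K)%:E * \sum_(k < N) ((t0 * 2 ^+ k)
    `^ (s - 1))%:E * \int[mu]_x (v k x)%:E)%E).
  apply: (@le_trans _ _ (2 `^ s * \sum_(k < N) (t0 * 2 ^+ k) `^ (s - 1) *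
     (t0 * 2 ^+ k * \sum_(i < m | t0 * 2 ^+ k < a i) r i ^+ n))%:E); first by rewrite lee_fin.
  rewrite EFinM EFinM -muleA lee_wpmul2l ?lee_fin ?powR_ge0//.
  rewrite -sumEFin ge0_sume_distrr; last first.
    by move=> k _; rewrite mule_ge0 ?lee_fin// integral_ge0// => x _; rewrite lee_fin.
  apply: lee_sum => k _; rewrite EFinM muleCA lee_wpmul2l ?lee_fin//.
  exact: (@weak_type eta (t0 * 2 ^+ k) u m c r a eta1 (tk0 k) mu_ u0 r0 tQ ha).
have -> : (\sum_(k < N) ((t0 * 2 ^+ k) `^ (s - 1))%:E * \int[mu]_x (v k x)%:E =
  \int[mu]_x (\sum_(k < N) ((t0 * 2 ^+ k) `^ (s - 1) * v k x)%:E))%E.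
  rewrite ge0_integral_sum//.
  - by apply: eq_bigr => k _; rewrite ge0_intZ.
  - by move=> k; apply: measurableT_comp => //; exact: measurable_funM.
  - by move=> k x _; rewrite lee_fin mulr_ge0.
have mus : measurable_fun setT (fun x => u x `^ s) by exact: measurable_powR_fun.
rewrite [X in (_ <= X * _)%E]EFinM -muleA; apply: lee_wpmul2l.
  by rewrite lee_fin; apply: mulr_ge0; [exact: powR_ge0|exact: ltW].
have CC0 : 0 <= C1 * (kap^-1) `^ (s - 1) by apply: mulr_ge0; exact: ltW.
rewrite -(ge0_intZ mu CC0 mus (fun x => powR_ge0 _ _)).
under eq_integral do rewrite sumEFin.
apply: ge0_le_int.
- by apply: measurable_sum => k; exact: measurable_funM.
- exact: measurable_funM.
- by move=> x; apply: sumr_ge0 => k _; exact: mulr_ge0.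
move=> x.
have -> : \sum_(k < N) (t0 * 2 ^+ k) `^ (s - 1) * v k x =
   (\sum_(k < N | t0 * 2 ^+ k < u x / kap) (t0 * 2 ^+ k) `^ (s - 1)) * u x.
  rewrite mulr_suml [RHS]big_mkcond; apply: eq_bigr => k _.
  by rewrite /v ltr_pdivlMr// mulrC [in if _ < _ then _ else _]mulrC ltNge; case: leP => _;
      rewrite ?mul0r// mulrC.
rewrite powS// mulrA ler_wpM2r//.
apply: le_trans (geometric_level_sum _ _ t00 s0) _.
have ki0 : 0 <= kap^-1 by rewrite invr_ge0 ltW.
by rewrite (powRM _ (u0 x) ki0) -/C1 mulrA mulrAC lexx.
Qed.

End maximal_abstract.

Lemma maximal_sum {R : realType} {n : nat} (eta s : R) : 1 <= eta -> 1 < s ->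
  exists2 C : R, 0 < C &
  forall (u : lebesgue_rV n -> R) m (c : 'I_m -> 'rV[R]_n) (r a : 'I_m -> R),
  measurable_fun setT u -> (forall x, 0 <= u x) ->
  (forall i, 0 < r i) -> trivIset setT (fun i => cube (c i) (r i)) ->
  (forall i, 0 <= a i) ->
  (forall i, ((a i * r i ^+ n)%:E <=
     \int[lebesgue n]_(x in cube (c i) (eta * r i)) (u x)%:E)%E) ->
  ((\sum_(i < m) r i ^+ n * a i `^ s)%:E <=
     C%:E * \int[lebesgue n]_x (u x `^ s)%:E)%E.
Proof.
apply: (@maximal_sum_abstract _ _ R (lebesgue n) n (@cube R n)).
- exact: measurable_cube.
- exact: lebesgue_cube.
- by move=> c r r' r0 rr'; apply: cube_sub => //; rewrite subrr normr0 add0r.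
- exact: finite_vitali.
Qed.

Lemma powRD_gt0 (R : realType) (x r s : R) : 0 < x -> x `^ (r + s) = x `^ r * x `^ s.
Proof. by move=> x0; rewrite powRD// (gt_eqF x0) implybT. Qed.

(** * Integrals of p-th powers *)

Section Lp_integrals.
Context d (T : measurableType d) {R : realType} (mu : {measure set T -> \bar R}).
Implicit Types (u v f : T -> R) (Q : set T) (p q : R).

(** The p-th power of the $L_p$ norm. Estimates are made on it because it is additive; roots are
    taken only when the norms of the theorem are compared. *)
Definition intp p f : \bar R := (\int[mu]_x (`|f x| `^ p)%:E)%E.

Lemma measurable_normr_fun u : measurable_fun setT u -> measurable_fun setT (fun x => `|u x|).
Proof. by move=> mu_; exact: measurableT_comp. Qed.

Lemma Lnorm_intp p f : 'N[mu]_p%:E[EFin \o f]%E = (intp p f `^ p^-1)%E.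
Proof.
by rewrite unlock /intp; congr (_ `^ _)%E; apply: eq_integral => x _;
  rewrite /= abse_EFin poweR_EFin.
Qed.

Lemma intp_ge0 p f : (0 <= intp p f)%E.
Proof. by apply: integral_ge0 => x _; rewrite lee_fin powR_ge0. Qed.

Lemma Lfun_intp p f : 0 < p ->
  (f \in Lfun mu p%:E) <-> (measurable_fun setT f /\ (intp p f < +oo)%E).
Proof.
move=> p0; have e : (intp p f `^ p^-1 < +oo)%E = (intp p f < +oo)%E.
  have := intp_ge0 p f; case: (intp p f) => [x| |//].
    by rewrite poweR_EFin !ltry.
  by rewrite poweRyr// invr_eq0 gt_eqF.
split.
  move=> /andP[]; rewrite !inE /= => mf nf; split => //.
  by rewrite -e -Lnorm_intp; exact: nf.
move=> [mf nf]; apply/andP; split; rewrite !inE//=.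
by rewrite /finite_norm Lnorm_intp e.
Qed.

Lemma integral_setI_ge0 Q u : measurable Q ->
  (\int[mu]_(x in Q) (u x)%:E = \int[mu]_x (u x * \1_Q x)%:E)%E.
Proof.
move=> mQ; rewrite integral_mkcond; apply: eq_integral => x _.
rewrite patchE indicE; case: ifP => _; first by rewrite mulr1.
by rewrite mulr0.
Qed.

Lemma le_int_set Q u v : measurable Q -> measurable_fun setT u -> measurable_fun setT v ->
  (forall x, 0 <= u x) -> (forall x, Q x -> u x <= v x) ->
  (\int[mu]_(x in Q) (u x)%:E <= \int[mu]_(x in Q) (v x)%:E)%E.
Proof.
move=> mQ mu_ mv u0 uv; apply: ge0_le_integral => //.
- by move=> x _; rewrite lee_fin.
- by apply: measurable_funTS; exact: measurableT_comp.
- by apply: measurable_funTS; exact: measurableT_comp.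
Qed.

Lemma subset_int Q Q' u : measurable Q -> measurable Q' -> measurable_fun setT u ->
  (forall x, 0 <= u x) -> Q `<=` Q' ->
  (\int[mu]_(x in Q) (u x)%:E <= \int[mu]_(x in Q') (u x)%:E)%E.
Proof.
move=> mQ mQ' mu_ u0 QQ; apply: ge0_subset_integral => //.
  by apply: measurable_funTS; exact: measurableT_comp.
by move=> x _; rewrite lee_fin.
Qed.

(** The form in which integrals against test functions and kernels are controlled: u only has to be
    integrable on a set outside which v vanishes. *)
Lemma integrable_supp u v Q M : measurable Q -> measurable_fun setT u ->
  measurable_fun setT v -> (forall x, `|v x| <= M) -> (forall x, ~ Q x -> v x = 0) ->
  (\int[mu]_(x in Q) `|u x|%:E < +oo)%E ->
  mu.-integrable setT (EFin \o (fun x => u x * v x)) /\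
  (`|\int[mu]_x (u x * v x)|%:E <= M%:E * \int[mu]_(x in Q) `|u x|%:E)%E.
Proof.
move=> mQ mu_ mv vM v0 uoo.
have muv : measurable_fun setT (fun x => u x * v x) by exact: measurable_funM.
have M0 : 0 <= M by exact: le_trans (vM point).
have mu1 : measurable_fun setT (fun x => `|u x| * \1_Q x).
  by apply: measurable_funM; [exact: measurable_normr_fun|exact: measurable_indic].
have le1 : (\int[mu]_x `|u x * v x|%:E <= M%:E * \int[mu]_(x in Q) `|u x|%:E)%E.
  rewrite (integral_setI_ge0 _ mQ) -ge0_intZ//.
  apply: ge0_le_int => //.
  - exact: measurable_normr_fun.
  - exact: measurable_funM.
  - move=> x; rewrite normrM indicE; have [xQ|xQ] := boolP (x \in Q).
      by rewrite mulr1 mulrC ler_wpM2r.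
    by rewrite v0 ?normr0 ?mulr0//; move/negP: xQ; rewrite inE.
have io : mu.-integrable setT (EFin \o (fun x => u x * v x)).
  apply/integrableP; split; first exact: measurableT_comp.
  by apply: le_lt_trans le1 _; rewrite lte_mul_pinfty.
split => //; apply: le_trans le1.
rewrite /Rintegral.
have := le_abse_integral mu measurableT (measurable_int mu io).
have fi := integrable_fin_num measurableT io.
by rewrite -[X in (`|X| <= _)%E -> _](fineK fi).
Qed.

Lemma ge0_int_setD Q u v : measurable Q -> measurable_fun setT u -> measurable_fun setT v ->
  (forall x, 0 <= u x) -> (forall x, 0 <= v x) ->
  (\int[mu]_(x in Q) (u x + v x)%:E =
   \int[mu]_(x in Q) (u x)%:E + \int[mu]_(x in Q) (v x)%:E)%E.
Proof.
move=> mQ mu_ mv u0 v0; under eq_integral do rewrite EFinD.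
by apply: ge0_integralD => //; try (by move=> x _; rewrite lee_fin);
  apply: measurable_funTS; exact: measurableT_comp.
Qed.

Lemma ge0_int_setZ Q u k : measurable Q -> measurable_fun setT u -> 0 <= k ->
  (forall x, 0 <= u x) ->
  (\int[mu]_(x in Q) (k * u x)%:E = k%:E * \int[mu]_(x in Q) (u x)%:E)%E.
Proof.
move=> mQ mu_ k0 u0; under eq_integral do rewrite EFinM.
rewrite ge0_integralZl//.
- by apply: measurable_funTS; exact: measurableT_comp.
- by move=> x _; rewrite lee_fin.
Qed.

(** At each point either |u| <= k or |u| <= k^(1 - q) |u|^q. With k chosen to balance the two terms,
    this takes the place of Hölder's inequality. *)
Lemma young_int Q u k q : measurable Q -> measurable_fun setT u -> 0 < k -> 1 <= q ->
  (\int[mu]_(x in Q) `|u x|%:E <=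
   (k `^ (1 - q))%:E * \int[mu]_(x in Q) (`|u x| `^ q)%:E + k%:E * mu Q)%E.
Proof.
move=> mQ mu_ k0 q1.
have mup : measurable_fun setT (fun x => `|u x| `^ q).
  by apply: measurable_powR_fun; exact: measurable_normr_fun.
apply: (@le_trans _ _ (\int[mu]_(x in Q) (k `^ (1 - q) * `|u x| `^ q + k)%:E)%E).
  apply: le_int_set => //; [exact: measurable_normr_fun| |].
    by apply: measurable_funD => //; exact: measurable_funM.
  move=> x _; have [uk|ku] := leP `|u x| k.
    by rewrite (le_trans uk)// lerDr mulr_ge0// powR_ge0.
  apply: (@le_trans _ _ (k `^ (1 - q) * `|u x| `^ q)); last by rewrite lerDl ltW.
  have u0 : 0 < `|u x| by exact: lt_trans ku.
  have -> : `|u x| `^ q = `|u x| * `|u x| `^ (q - 1).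
    rewrite -{2}(powRr1 (ltW u0)) -(powRD_gt0 _ _ u0).
    by congr (_ `^ _); lra.
  rewrite mulrCA; apply: ler_peMr; first exact: ltW.
  apply: (@le_trans _ _ (k `^ (1 - q) * k `^ (q - 1))).
    by rewrite -powRD_gt0// (_ : 1 - q + (q - 1) = 0) ?powRr0//; lra.
  apply: ler_wpM2l; first exact: powR_ge0.
  by apply: ge0_ler_powR; rewrite ?nnegrE ?subr_ge0//; exact: ltW.
have kq0 : 0 <= k `^ (1 - q) by exact: powR_ge0.
rewrite ge0_int_setD//; last 3 first.
- exact: measurable_funM.
- by move=> x; apply: mulr_ge0; rewrite ?powR_ge0.
- by move=> _; exact: ltW.
rewrite ge0_int_setZ ?powR_ge0//.
by rewrite (integral_cst mu mQ k%:E) lexx.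
Qed.

Lemma int_lt_pinfty Q u p : measurable Q -> (mu Q < +oo)%E -> measurable_fun setT u ->
  1 <= p -> (intp p u < +oo)%E -> (\int[mu]_(x in Q) `|u x|%:E < +oo)%E.
Proof.
move=> mQ Qoo mu_ p1 uoo.
apply: le_lt_trans (young_int mQ mu_ ltr01 p1) _.
rewrite powR1 !mul1e lte_add_pinfty//.
apply: le_lt_trans uoo; apply: (subset_int mQ measurableT) => //.
by apply: measurable_powR_fun; exact: measurable_normr_fun.
Qed.

End Lp_integrals.

(** * Morrey's inequality *)

Section is_derive_prod.
Context {R : realType} (I : eqType).
Implicit Types (f : I -> R -> R) (df : I -> R).

Lemma is_derive_prod f df (s : seq I) (t : R) : uniq s ->
  (forall i, is_derive t 1 (f i) (df i)) ->
  is_derive t 1 (fun t => \prod_(i <- s) f i t)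
    (\sum_(i <- s) \prod_(j <- s) (if j == i then df i else f j t)).
Proof.
elim: s => [_ _|a s IH /= /andP[as_ us] dfi].
  rewrite big_nil (_ : (fun _ => _) = cst 1); first exact: is_derive_cst.
  by apply/funext => x; rewrite big_nil.
have h := is_deriveM (dfi a) (IH us dfi).
rewrite (_ : (fun _ => _) = (f a) * (fun t => \prod_(i <- s) f i t)); last first.
  by apply/funext => x; rewrite big_cons.
apply: (is_derive_eq h); rewrite !big_cons eqxx addrC; congr (_ + _).
  rewrite /GRing.scale /= mulrC; congr (_ * _); apply: eq_big_seq => j js.
  by case: eqP => // ja; rewrite -ja js in as_.
rewrite /GRing.scale /= mulr_sumr; apply: eq_big_seq => i si.
by rewrite big_cons; case: eqP => // ai; rewrite ai si in as_.
Qed.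

End is_derive_prod.

Section is_derive_real.
Context {R : realType}.
Implicit Types f g : R -> R.

Lemma is_derive_scale f (a b x df : R) : is_derive x 1 f df ->
  is_derive x 1 (fun y => a * f y + b) (a * df).
Proof.
move=> h; have h1 : is_derive x 1 (a \*: f) (a *: df) by exact: is_deriveZ.
have := @is_deriveD _ _ _ _ _ x 1 _ _ h1 (is_derive_cst b x 1).
by rewrite addr0.
Qed.

Lemma is_derive_mul f g (x df dg : R) : is_derive x 1 f df -> is_derive x 1 g dg ->
  is_derive x 1 (fun y => f y * g y) (f x * dg + g x * df).
Proof. exact: is_deriveM. Qed.

Lemma is_derive_inv (x : R) : x != 0 -> is_derive x 1 (@GRing.inv R) (- x ^- 2).
Proof.
move=> x0; apply: is_derive_eq; first exact: (@is_deriveV R id x 1 1 x0 (is_derive_id x 1)).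
by rewrite /GRing.scale /= mulr1.
Qed.

End is_derive_real.

(** * Dilated kernels and their continuity equation *)

Section kernel.
Context {R : realType}.
Implicit Types (x b r t s : R).

(** A one-dimensional [hump] of center x + t b and radius t r, normalized so that its mass does not
    depend on t. [vkern] multiplies it by (s - x) / t, the velocity at s of the dilation about x
    with parameter t. *)
Definition kern x b r t s : R := (t * r)^-1 * hump (r^-1 * (t^-1 * (s - x) - b)).
Definition vkern x b r t s : R := t^-1 * (s - x) * kern x b r t s.

Lemma smooth1_kern x b r t : smooth1 (kern x b r t).
Proof.
apply: smooth1M; first exact: smooth1_cst.
rewrite (_ : (fun _ => _) = fun s => hump ((r^-1 * t^-1) * s + (r^-1 * (- (t^-1 * x) - b)))).
  by apply: smooth1_affine; exact: smooth1_hump.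
by apply/funext => s; congr hump; ring.
Qed.

Lemma smooth1_vkern x b r t : smooth1 (vkern x b r t).
Proof.
apply: smooth1M; last exact: smooth1_kern.
apply: smooth1M; first exact: smooth1_cst.
by apply: smooth1D; [exact: smooth1_id|exact: smooth1_cst].
Qed.

Lemma kern_ge0 x b r t s : 0 <= r -> 0 <= t -> 0 <= kern x b r t s.
Proof. by move=> r0 t0; rewrite mulr_ge0 ?hump_ge0// invr_ge0 mulr_ge0. Qed.

Lemma kern_le x b r t s : 0 <= r -> 0 <= t -> kern x b r t s <= (t * r)^-1.
Proof.
by move=> r0 t0; rewrite ler_piMr ?hump_le1// invr_ge0 mulr_ge0.
Qed.

Lemma kern_supp x b r t s : 0 < r -> 0 < t ->
  ~~ (x + t * b - t * r <= s <= x + t * b + t * r) -> kern x b r t s = 0.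
Proof.
move=> r0 t0; rewrite -ler_distl -ltNge => h.
rewrite /kern hump_eq0 ?mulr0//.
rewrite (_ : _ * (_ - _) = (t * r)^-1 * (s - (x + t * b))); last first.
  by field; rewrite !gt_eqF.
by rewrite normrM gtr0_norm ?invr_gt0 ?mulr_gt0// ler_pdivlMl ?mulr_gt0// mulr1 ltW.
Qed.

Lemma vkern_supp x b r t s : 0 < r -> 0 < t ->
  ~~ (x + t * b - t * r <= s <= x + t * b + t * r) -> vkern x b r t s = 0.
Proof. by move=> r0 t0 h; rewrite /vkern kern_supp ?mulr0. Qed.

(** On the support the velocity |s - x| / t is at most |b| + r, hence at most 2 r. *)
Lemma vkern_le x b r t s : 0 < r -> 0 < t -> `|b| <= r ->
  `|vkern x b r t s| <= 2 * r * (t * r)^-1.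
Proof.
move=> r0 t0 br; have [h|h] := boolP (x + t * b - t * r <= s <= x + t * b + t * r); last first.
  by rewrite vkern_supp// normr0 mulr_ge0 ?invr_ge0 ?mulr_ge0// ltW.
rewrite -ler_distl in h.
rewrite normrM (ger0_norm (kern_ge0 _ _ _ (ltW r0) (ltW t0))).
apply: ler_pM => //; [exact: kern_ge0 (ltW r0) (ltW t0)| |exact: kern_le (ltW r0) (ltW t0)].
rewrite normrM gtr0_norm ?invr_gt0// ler_pdivrMl//.
rewrite (_ : s - x = (s - (x + t * b)) + t * b); last ring.
rewrite (le_trans (ler_normD _ _))// normrM (gtr0_norm t0).
have : t * `|b| <= t * r by rewrite ler_pM2l.
move=> h2; rewrite (_ : t * (2 * r) = t * r + t * r); last ring.
exact: lerD.
Qed.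

Lemma is_derive_vkern x b r t s : 0 < r -> 0 < t ->
  is_derive s 1 (vkern x b r t)
   (t^-1 * (s - x) * ((t * r)^-1 *
      (r^-1 * t^-1 * derive1 hump (r^-1 * (t^-1 * (s - x) - b)))) +
    (t * r)^-1 * hump (r^-1 * (t^-1 * (s - x) - b)) * t^-1).
Proof.
move=> r0 t0.
have e1 := is_derive_scale t^-1 (- (t^-1 * x)) (is_derive_id s (1 : R)).
have e2 : is_derive s 1 (fun s => hump ((r^-1 * t^-1) * s + (r^-1 * (- (t^-1 * x) - b))))
    ((r^-1 * t^-1) * derive1 hump ((r^-1 * t^-1) * s + (r^-1 * (- (t^-1 * x) - b)))).
  by apply: is_derive_affine; apply: smooth1_derivable; exact: smooth1_hump.
have e3 := is_derive_mul e1 (is_derive_scale (t * r)^-1 0 e2).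
have ew y : r^-1 * t^-1 * y + r^-1 * (- (t^-1 * x) - b) = r^-1 * (t^-1 * (y - x) - b) by ring.
have et y : t^-1 * y + - (t^-1 * x) = t^-1 * (y - x) by ring.
move: e3; rewrite [X in is_derive _ _ X _ -> _](_ : _ = vkern x b r t); last first.
  by apply/funext => y; rewrite /vkern /kern ew /= et addr0.
by rewrite /= !ew !et mulr1 !addr0.
Qed.

(** Continuity equation in one dimension: as t varies the mass is transported by the dilation about
    x, and the derivative in t is minus the divergence of the flux [vkern]. The two explicit
    derivatives are compared. *)
Lemma is_derive_kern_t x b r t s : 0 < r -> 0 < t ->
  is_derive t 1 (fun t => kern x b r t s) (- derive1 (vkern x b r t) s).
Proof.
move=> r0 t0.
have tn0 : t != 0 by rewrite gt_eqF.
have rn0 : r != 0 by rewrite gt_eqF.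
set w := r^-1 * (t^-1 * (s - x) - b).
have db : is_derive w 1 (@hump R) (derive1 hump w).
  by apply: is_derive_derive1; apply: smooth1_derivable; exact: smooth1_hump.
have di := is_derive_inv tn0.
have dw : is_derive t 1 (fun t => r^-1 * (t^-1 * (s - x) - b)) (r^-1 * (s - x) * - t ^- 2).
  rewrite (_ : (fun t => _) = (fun t => (r^-1 * (s - x)) * t^-1 + - (r^-1 * b))).
    exact: is_derive_scale.
  by apply/funext => y; ring.
have dbw := @is_derive1_comp R (@hump R) (fun t => r^-1 * (t^-1 * (s - x) - b)) t _ _ db dw.
have dk : is_derive t 1 (fun t => kern x b r t s)
   ((r^-1 * t^-1) * (derive1 hump w * (r^-1 * (s - x) * - t ^- 2)) + hump w * (r^-1 * - t ^- 2)).
  have h1 : is_derive t 1 (fun t => r^-1 * t^-1) (r^-1 * - t ^- 2).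
    have := is_derive_scale r^-1 0 di.
    by rewrite (_ : (fun y => _) = (fun t => r^-1 * t^-1))//; apply/funext => y; rewrite addr0.
  have := is_derive_mul h1 dbw.
  rewrite [X in is_derive _ _ X _ -> _](_ : _ = (fun t => kern x b r t s))//.
  by apply/funext => y; rewrite /kern invfM [y^-1 * r^-1]mulrC.
have dv := is_derive_vkern x b s r0 t0.
apply: (is_derive_eq dk).
have [_ dvE] := dv; rewrite -derive1E in dvE; rewrite dvE.
move: (derive1 hump w) (hump w) => B' B0; field; by rewrite tn0.
Qed.

Lemma derive1_hump_eq0 (w : R) : 1 < `|w| -> derive1 hump w = 0 :> R.
Proof.
move=> w1; have h : is_derive w 1 (@hump R) 0.
  apply: (@near_eq_is_derive _ _ _ (cst 0)).
    near=> y; rewrite hump_eq0// ltW//; near: y.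
    have : {for w, continuous (fun y : R => `|y|)} by exact: norm_continuous.
    by move=> /cvgr_gt; apply.
by rewrite derive1E; have [_ ->] := h.
Unshelve. all: by end_near. Qed.

Lemma derive1_hump_bounded : exists B : R, forall w, `|derive1 hump w| <= B.
Proof.
apply: (@smooth1_bounded_support _ _ 1); last exact: derive1_hump_eq0.
by apply: smooth1_continuous; apply: smooth1_derive; exact: smooth1_hump.
Qed.

Lemma derive1_vkernE x b r t s : 0 < r -> 0 < t ->
  derive1 (vkern x b r t) s =
  (r^-1 * t^-1) * (derive1 hump (r^-1 * (t^-1 * (s - x) - b)) * (r^-1 * (s - x) * t ^- 2)) +
  hump (r^-1 * (t^-1 * (s - x) - b)) * (r^-1 * t ^- 2).
Proof.
move=> r0 t0; have [_ dvE] := is_derive_vkern x b s r0 t0.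
rewrite -derive1E in dvE; rewrite dvE; move: (derive1 hump _) (hump _) => B' B0.
by field; rewrite !gt_eqF.
Qed.

Lemma vkern_dist x b r t s : 0 < r -> 0 < t -> `|b| <= r ->
  `|r^-1 * (t^-1 * (s - x) - b)| <= 1 -> `|s - x| <= 2 * t * r.
Proof.
move=> r0 t0 br; rewrite normrM gtr0_norm ?invr_gt0// ler_pdivrMl// mulr1 => h.
rewrite (_ : s - x = t * ((t^-1 * (s - x) - b) + b)); last by field; rewrite gt_eqF.
rewrite normrM gtr0_norm// [2 * t]mulrC -mulrA ler_pM2l//.
by rewrite (le_trans (ler_normD _ _))// mulr_natl mulr2n lerD.
Qed.

Lemma derive1_vkern_supp x b r t s : 0 < r -> 0 < t -> `|b| <= r ->
  2 * t * r < `|s - x| -> derive1 (vkern x b r t) s = 0.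
Proof.
move=> r0 t0 br sx; rewrite derive1_vkernE//.
have w1 : 1 < `|r^-1 * (t^-1 * (s - x) - b)|.
  by rewrite ltNge; apply/negP => /(vkern_dist r0 t0 br); rewrite leNgt sx.
by rewrite derive1_hump_eq0// hump_eq0 ?ltW// !mul0r mulr0 addr0.
Qed.

Lemma derive1_vkern_le : exists K : R, forall x b r t s, 0 < r -> 0 < t -> `|b| <= r ->
  `|derive1 (vkern x b r t) s| <= K * (r^-1 * t ^- 2).
Proof.
have [B hB] := derive1_hump_bounded; exists (2 * B + 1) => x b r t s r0 t0 br.
have B0 : 0 <= B by exact: le_trans (hB 0).
have rt0 : 0 <= r^-1 * t ^- 2 by rewrite mulr_ge0 ?invr_ge0 ?exprn_ge0 ?ltW.
have [h|h] := leP `|s - x| (2 * t * r); last first.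
  by rewrite derive1_vkern_supp// normr0 mulr_ge0// addr_ge0// mulr_ge0.
rewrite derive1_vkernE// mulrDl mul1r (le_trans (ler_normD _ _))//; apply: lerD; last first.
  by rewrite normrM (ger0_norm rt0) ler_piMl// ger0_norm ?hump_le1 ?hump_ge0.
rewrite (_ : _ * (_ * _) = derive1 hump (r^-1 * (t^-1 * (s - x) - b)) *
   (((s - x) * (r^-1 * t^-1)) * (r^-1 * t ^- 2))); last by ring.
rewrite normrM mulrA [2 * B]mulrC -!mulrA; apply: ler_pM => //.
rewrite [_ * (_ * (_ * _))](_ : _ = ((s - x) * (r^-1 * t^-1)) * (r^-1 * t ^- 2)); last by ring.
rewrite normrM (ger0_norm rt0); apply: ler_wpM2r => //.
rewrite !normrM (gtr0_norm (x := r^-1)) ?invr_gt0// (gtr0_norm (x := t^-1)) ?invr_gt0// mulrA.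
by rewrite ler_pdivrMr// ler_pdivrMr// mulrAC.
Qed.

End kernel.

Lemma Rintegral_bigsum d (T : measurableType d) (R : realType)
    (mu : {measure set T -> \bar R}) (I : Type) (s : seq I) (f : I -> T -> R) :
  (forall i, mu.-integrable setT (EFin \o f i)) ->
  mu.-integrable setT (EFin \o (fun x => \sum_(i <- s) f i x)) /\
  \int[mu]_x (\sum_(i <- s) f i x) = \sum_(i <- s) \int[mu]_x f i x.
Proof.
move=> fi; elim: s => [|i s [IH1 IH2]].
  under eq_Rintegral do rewrite big_nil.
  rewrite big_nil; split; last by rewrite /Rintegral integral0.
  rewrite (_ : _ \o _ = cst 0%E); first exact: integrable0.
  by apply/funext => x /=; rewrite big_nil.
under eq_Rintegral do rewrite big_cons.
rewrite big_cons -IH2 RintegralD//; split => //.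
rewrite (_ : _ \o _ = (EFin \o f i) \+ (EFin \o (fun x => (\sum_(j <- s) f j x)%R)))%E.
  exact: integrableD.
by apply/funext => x /=; rewrite big_cons.
Qed.

Section tensor_bounds.
Context {R : realType} {n : nat}.
Implicit Types (f : 'I_n -> R -> R) (z : 'rV[R]_n).

Lemma tensor_le f (M : 'I_n -> R) z : (forall i, `|f i (z ord0 i)| <= M i) ->
  `|tensor f z| <= \prod_(i < n) M i.
Proof.
move=> fM; rewrite /tensor normr_prod; apply: ler_prod => i _.
by rewrite normr_ge0 fM.
Qed.

Lemma tensor_upd_le f i g (m M : R) z : (forall i, `|f i (z ord0 i)| <= M) ->
  `|g (z ord0 i)| <= m * M -> `|tensor (upd f i g) z| <= m * M ^+ n.
Proof.
move=> fM gm.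
apply: (le_trans (tensor_le (M := fun j => if j == i then m * M else M) _)).
  by move=> j; rewrite /upd; case: eqP => [->|].
rewrite (bigD1 i)//= eqxx -mulrA (_ : M * _ = M ^+ n)//.
under eq_bigr => j /negbTE -> do [].
have -> : M ^+ n = \prod_(j < n) M by rewrite prodr_const card_ord.
by rewrite [RHS](bigD1 i).
Qed.

End tensor_bounds.

Section dilated_kernel.
Context {R : realType} {n : nat} (x b : 'rV[R]_n) (r : R).
Hypotheses (r0 : 0 < r) (br : `|b| <= r).

Let kf t (j : 'I_n) := kern (x ord0 j) (b ord0 j) r t.
Let vf t (i : 'I_n) := vkern (x ord0 i) (b ord0 i) r t.

Definition phi t : 'rV[R]_n -> R := tensor (kf t).
(** Component i of the flux, that is [phi t] times (z_i - x_i) / t; [dphi i t] is its partial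
    derivative in direction i. *)
Definition vphi i t : 'rV[R]_n -> R := tensor (upd (kf t) i (vf t i)).
Definition dphi i t : 'rV[R]_n -> R := tensor (upd (kf t) i (derive1 (vf t i))).

Lemma offset_coord_le i : `|b ord0 i| <= r.
Proof. exact: le_trans (rV_coord_le _ _) br. Qed.

Lemma phi_supp t z : 0 < t -> ~ cube (x + t *: b) (t * r) z -> phi t z = 0.
Proof.
move=> t0; apply: tensor_supp => i s; rewrite !mxE; exact: kern_supp.
Qed.

Lemma vphi_supp i t z : 0 < t -> ~ cube (x + t *: b) (t * r) z -> vphi i t z = 0.
Proof.
move=> t0; apply: tensor_supp => j s; rewrite !mxE /upd; case: eqP => [->|_].
  exact: vkern_supp.
exact: kern_supp.
Qed.

Lemma smooth_factors t i g : smooth1 g -> forall j, smooth1 (upd (kf t) i g j).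
Proof. by move=> sg j; rewrite /upd; case: eqP => // _; exact: smooth1_kern. Qed.

Lemma test_function_vphi i t : 0 < t -> test_function (vphi i t).
Proof.
move=> t0; apply: (@test_function_tensor _ _ _ (x + t *: b) (t * r)).
  by apply: smooth_factors; exact: smooth1_vkern.
move=> j s; rewrite !mxE /upd; case: eqP => [->|_]; first exact: vkern_supp.
exact: kern_supp.
Qed.

Lemma partial_vphi i t : partial i (vphi i t) = dphi i t.
Proof.
rewrite /vphi partial_tensor; last by apply: smooth_factors; exact: smooth1_vkern.
apply/funext => z; rewrite /dphi !tensor_upd /upd eqxx; congr (_ * _).
by apply: eq_bigr => j /negbTE ->.
Qed.

Lemma continuous_phi t : continuous (phi t).
Proof.
by apply: continuous_tensor => i; apply: smooth1_continuous; exact: smooth1_kern.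
Qed.

Lemma continuous_vphi i t : continuous (vphi i t).
Proof.
apply: continuous_tensor => j; apply: smooth1_continuous.
by apply: smooth_factors; exact: smooth1_vkern.
Qed.

Lemma continuous_dphi i t : continuous (dphi i t).
Proof.
apply: continuous_tensor => j; apply: smooth1_continuous.
by apply: smooth_factors; apply: smooth1_derive; exact: smooth1_vkern.
Qed.

Lemma phi_ge0 t z : 0 < t -> 0 <= phi t z.
Proof. by move=> t0; apply: prodr_ge0 => i _; apply: kern_ge0; exact: ltW. Qed.

Lemma kf_le t i s : 0 < t -> `|kf t i s| <= (t * r)^-1.
Proof.
move=> t0; rewrite ger0_norm; first exact: kern_le (ltW r0) (ltW t0).
exact: kern_ge0 (ltW r0) (ltW t0).
Qed.

Lemma phi_le t z : 0 < t -> `|phi t z| <= (t * r)^-1 ^+ n.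
Proof.
move=> t0; apply: le_trans (tensor_le (fun i => kf_le i _ t0)) _.
by rewrite prodr_const card_ord lexx.
Qed.

Lemma vphi_le i t z : 0 < t -> `|vphi i t z| <= 2 * r * (t * r)^-1 ^+ n.
Proof.
move=> t0; apply: tensor_upd_le => [j|]; first exact: kf_le.
by apply: vkern_le => //; exact: offset_coord_le.
Qed.

Lemma dphi_supp i t z : 0 < t -> ~ cube x (2 * t * r) z -> dphi i t z = 0.
Proof.
move=> t0 /existsNP[j /negP]; rewrite -ler_distl -ltNge => h.
apply: (tensor_eq0 (i := j)); rewrite /upd; case: eqP => [ji|_].
  by rewrite ji in h *; apply: derive1_vkern_supp => //; exact: offset_coord_le.
apply: kern_supp => //; apply/negP; rewrite -ler_distl => h2.
move: h; apply/negP; rewrite -leNgt.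
rewrite (_ : _ - _ = (z ord0 j - (x ord0 j + t * b ord0 j)) + t * b ord0 j); last ring.
rewrite (le_trans (ler_normD _ _))// normrM (gtr0_norm t0).
have : t * `|b ord0 j| <= t * r by rewrite ler_pM2l// offset_coord_le.
by lra.
Qed.

(** The bound is uniform for t in [u, v]: it gives the dominating function for the differentiation
    of [kavg] under the integral sign. *)
Lemma dphi_bounded (u v : R) : 0 < u -> exists M : R, forall i t z, u <= t -> t <= v ->
  `|dphi i t z| <= M.
Proof.
move=> u0; have [K hK] := @derive1_vkern_le R.
have [m hm] : exists m : R, forall (i : 'I_n) (t : R) (z : 'rV[R]_n), u <= t -> t <= v ->
    `|derive1 (vf t i) (z ord0 i)| <= m * (u * r)^-1.
  exists (K * u^-1) => i t z ut tv; have t0 : 0 < t by exact: lt_le_trans ut.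
  apply: le_trans (hK _ _ _ _ _ r0 t0 (offset_coord_le i)) _.
  have K0 : 0 <= K.
    have := le_trans (normr_ge0 _) (hK 0 0 1 1 0 ltr01 ltr01 _).
    by rewrite normr0 invr1 expr1n invr1 !mulr1; apply.
  rewrite -mulrA; apply: ler_wpM2l => //.
  rewrite (_ : u^-1 / (u * r) = r^-1 / u ^+ 2); last first.
    by field; rewrite !gt_eqF.
  rewrite ler_pM2l ?invr_gt0// lef_pV2 ?posrE ?exprn_gt0//.
  by rewrite !expr2; apply: ler_pM => //; exact: ltW.
exists (m * (u * r)^-1 ^+ n) => i t z ut tv; have t0 : 0 < t by exact: lt_le_trans ut.
apply: tensor_upd_le => [j|]; last exact: hm.
apply: le_trans (kf_le _ _ t0) _.
by rewrite lef_pV2 ?posrE ?mulr_gt0// ler_pM2r.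
Qed.

Lemma is_derive_phi (t : R) z : 0 < t ->
  is_derive t 1 (fun t => phi t z) (- \sum_(i < n) dphi i t z).
Proof.
move=> t0.
have h := @is_derive_prod R 'I_n (fun i t => kf t i (z ord0 i))
  (fun i => - derive1 (vf t i) (z ord0 i)) (index_enum 'I_n) t (index_enum_uniq _)
  (fun i => is_derive_kern_t _ _ _ r0 t0).
apply: (is_derive_eq h); rewrite -sumrN; apply: eq_bigr => i _.
rewrite /dphi tensor_upd (bigD1 i)//= eqxx mulNr; congr (- (_ * _)).
by apply: eq_bigr => j /negbTE ->.
Qed.

End dilated_kernel.

Section dilated_average.
Context {R : realType} {n : nat} (x b : 'rV[R]_n) (r p : R).
Hypotheses (r0 : 0 < r) (br : `|b| <= r) (p1 : 1 <= p).
Context (F : 'rV[R]_n -> R) (G : 'rV[R]_n -> 'rV[R]_n).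
Local Notation mu := (@lebesgue R n).
Hypotheses (LF : F \in Lfun mu p%:E)
  (LG : forall i, (fun x => G x ord0 i) \in Lfun mu p%:E) (wG : weak_gradient F G).

Let p0 : 0 < p. Proof. exact: lt_le_trans p1. Qed.

Lemma Lfun_int_cube (u : lebesgue_rV n -> R) c s : 0 <= s -> u \in Lfun mu p%:E ->
  (\int[mu]_(z in cube c s) `|u z|%:E < +oo)%E.
Proof.
move=> s0 /(Lfun_intp _ _ p0)[mu_ uoo].
apply: (int_lt_pinfty _ _ mu_ p1 uoo); first exact: measurable_cube.
by rewrite lebesgue_cube// ltry.
Qed.

Lemma Lfun_mul_supp (u : lebesgue_rV n -> R) (v : 'rV[R]_n -> R) c s M :
  0 <= s -> u \in Lfun mu p%:E -> continuous v -> (forall z, `|v z| <= M) ->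
  (forall z, ~ cube c s z -> v z = 0) ->
  mu.-integrable setT (EFin \o (fun z => u z * v z)) /\
  (`|\int[mu]_z (u z * v z)|%:E <= M%:E * \int[mu]_(z in cube c s) `|u z|%:E)%E.
Proof.
move=> s0 Lu cv vM v0; have [mu_ _] := (Lfun_intp mu u p0).1 Lu.
apply: integrable_supp => //; first exact: measurable_cube.
  exact: measurable_continuous.
exact: Lfun_int_cube.
Qed.

(* [phi t] has a mass independent of t and lives on the cube of center x + t b and
   radius t r, so that [kavg] joins a multiple of F x (as t -> 0) to an average of
   F that depends on x + b only (t = 1). As d/dt (phi t) = - div (vphi t), its
   derivative is an integral against the weak gradient. *)
Definition kavg t : R := \int[mu]_z (F z * phi x b r t z).
Definition kavg_slope t : R := \sum_(i < n) \int[mu]_z (G z ord0 i * vphi x b r i t z).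

Lemma integrable_F_dphi i (t : R) : 0 < t ->
  mu.-integrable setT (EFin \o (fun z => F z * dphi x b r i t z)).
Proof.
move=> t0; have [M hM] := dphi_bounded x r0 br t t0.
have tr0 : 0 <= 2 * t * r by rewrite !mulr_ge0// ltW.
apply: (proj1 (@Lfun_mul_supp F (dphi x b r i t) x (2 * t * r) M tr0 LF _ _ _)).
- exact: continuous_dphi.
- by move=> z; apply: hM.
- by move=> z; exact: dphi_supp.
Qed.

Lemma is_derive_kavg (t : R) : 0 < t -> is_derive t 1 kavg (kavg_slope t).
Proof.
move=> t0.
(* On ]t / 2, 2 t[ every [dphi] is bounded by one [M] and vanishes off the cube of radius 2 v r
   about x, so n M |F| restricted to that cube dominates. *)
pose u := t / 2; pose v := 2 * t.
have u0 : 0 < u by rewrite divr_gt0.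
have It : (`]u, v[%classic : set R) t by rewrite /= in_itv/=; apply/andP; split; rewrite /u /v; lra.
have [M hM] := dphi_bounded x r0 br v u0.
pose f s z := F z * phi x b r s z.
have fE (s : R) z : 0 < s -> is_derive s 1 (f ^~ z) (F z * - \sum_(i < n) dphi x b r i s z).
  move=> s0; have := is_derive_scale (F z) 0 (is_derive_phi x b r0 z s0).
  rewrite [X in is_derive _ _ X _ -> _](_ : _ = f ^~ z)//.
  by apply/funext => y; rewrite addr0.
have Ipos (s : R) : (`]u, v[%classic : set R) s -> 0 < s /\ u <= s /\ s <= v.
  by rewrite /= in_itv/= => /andP[us sv]; rewrite (lt_trans u0 us) !ltW.
have vr0 : 0 <= 2 * v * r by rewrite !mulr_ge0 ?(ltW r0)// ltW// /v mulr_gt0.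
pose Gd z := (n%:R * M) * (`|F z| * \1_(cube x (2 * v * r)) z).
have M0 (i : 'I_n) : 0 <= M by apply: le_trans (hM i t 0 _ _); rewrite // /u /v; lra.
have nM0 : 0 <= n%:R * M.
  case: (n) M0 => [_|m M0]; first by rewrite mul0r.
  by rewrite mulr_ge0// (M0 ord0).
have [mF _] := (Lfun_intp mu F p0).1 LF.
have h1 (s : R) : (`]u, v[%classic : set R) s -> mu.-integrable setT (EFin \o f s).
  move=> /Ipos[s0 _]; have sr0 : 0 <= s * r by rewrite mulr_ge0// ltW.
  apply: (proj1 (@Lfun_mul_supp F (phi x b r s) (x + s *: b) (s * r) ((s * r)^-1 ^+ n)
      sr0 LF _ _ _)).
  - exact: continuous_phi.
  - by move=> z; exact: phi_le.
  - by move=> z; exact: phi_supp.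
have h2 (s : R) z : (`]u, v[%classic : set R) s -> [set: lebesgue_rV n] z -> derivable (f ^~ z) s 1.
  by move=> /Ipos[s0 _] _; have [] := fE s z s0.
have h3 z : 0 <= Gd z by rewrite mulr_ge0// mulr_ge0// indicE.
have h4 : mu.-integrable setT (EFin \o Gd).
  have h : mu.-integrable setT (EFin \o (fun z => F z * \1_(cube x (2 * v * r)) z)).
    apply: (proj1 (@integrable_supp _ _ _ mu F _ (cube x (2 * v * r)) 1 _ mF _ _ _ _)).
    - exact: measurable_cube.
    - by apply: measurable_indic; exact: measurable_cube.
    - by move=> z; rewrite indicE; case: (_ \in _); rewrite ?normr1 ?normr0.
    - by move=> z nz; rewrite indicE memNset.
    - exact: Lfun_int_cube.
  have := integrable_norm h; rewrite /comp => h'.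
  have := integrableZl measurableT (n%:R * M) h'.
  apply: eq_integrable => // z _ /=.
  by rewrite /Gd EFinM normrM; congr (_ * (_ * _)%:E)%E; rewrite ger0_norm// indicE.
have h5 (s : R) z : (`]u, v[%classic : set R) s -> [set: lebesgue_rV n] z ->
    `|partial1of2 f s z| <= Gd z.
  move=> /Ipos[s0 [us sv]] _; rewrite partial1of2E.
  have [_ ->] := fE s z s0.
  rewrite /Gd normrM normrN mulrCA; apply: ler_wpM2l => //.
  rewrite indicE; have [zc|zc] := boolP (z \in _).
    rewrite mulr1 (le_trans (ler_norm_sum _ _ _))//.
    apply: (@le_trans _ _ (\sum_(i < n) M)); last by rewrite sumr_const card_ord mulr_natl.
    by apply: ler_sum => i _; exact: hM.
  rewrite mulr0 big1 ?normr0// => i _; apply: dphi_supp => // zs.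
  move/negP: zc; rewrite inE; apply.
  apply: cube_sub zs; first by rewrite !mulr_ge0// ltW.
  by rewrite subrr normr0 add0r ler_pM2r// ler_pM2l.
have dE : \int[mu]_z partial1of2 f t z = kavg_slope t.
  transitivity (\int[mu]_z (- \sum_(i < n) F z * dphi x b r i t z)).
    apply: eq_Rintegral => z _; rewrite partial1of2E.
    by have [_ ->] := fE t z t0; rewrite mulrN mulr_sumr.
  have [i1 i2] := @Rintegral_bigsum _ _ _ mu _ (index_enum 'I_n)
    (fun i z => F z * dphi x b r i t z) (fun i => integrable_F_dphi i t0).
  transitivity (- \int[mu]_z (\sum_(i < n) F z * dphi x b r i t z)).
    under eq_Rintegral do rewrite -mulN1r.
    by rewrite RintegralZl// mulN1r.
  rewrite i2 /kavg_slope -sumrN; apply: eq_bigr => i _.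
  (* The minus sign of the continuity equation cancels that of the weak gradient. *)
  have := wG (@test_function_vphi _ _ x b r r0 i t t0) i.
  by rewrite partial_vphi => ->; rewrite opprK.
have cvg := @derivable_under_integral R _ _ mu f setT measurableT t u v It h1 h2 Gd h3 h4 h5.
have der := @differentiation_under_integral R _ _ mu f setT measurableT t u v It h1 h2 Gd h3 h4 h5.
rewrite -dE -der; exact: is_derive_derive1.
Qed.

End dilated_average.

(** The mean value theorem is applied to h + (B / a) t^a and to - h + (B / a) t^a, whose derivatives
    are nonnegative on ]0, 1]. A derivative that blows up at 0 is thus integrated without any
    integral. *)
Lemma powR_derivative_bound (R : realType) (h dh : R -> R) (B a : R) : 0 <= B -> 0 < a ->
  (forall t : R, 0 < t -> is_derive t 1 h (dh t)) ->
  (forall t : R, 0 < t -> t <= 1 -> `|dh t| <= B * t `^ (a - 1)) ->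
  forall t : R, 0 < t -> t <= 1 -> `|h 1 - h t| <= B / a.
Proof.
move=> B0 a0 hd dhB t t0 t1.
suff key (s : R) : `|s| = 1 -> s * (h t - h 1) <= B / a.
  rewrite ler_norml; have := key 1 (normr1 _); have := key (-1).
  by rewrite normrN1 => /(_ erefl); lra.
move=> s1; pose g (y : R) := (s * h y + 0) + (B / a * y `^ a + 0).
pose dg (y : R) := s * dh y + B / a * (a * y `^ (a - 1)).
have gd (y : R) : 0 < y -> is_derive y 1 g (dg y).
  move=> y0; apply: is_deriveD; apply: is_derive_scale; first exact: hd.
  exact: is_derive1_powR.
have [c] : exists2 c, c \in `[t, 1]%R & g 1 - g t = dg c * (1 - t).
  apply: MVT_segment => //.
    by move=> y; rewrite in_itv/= => /andP[ty _]; apply: gd; exact: lt_trans ty.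
  apply: derivable_within_continuous => y; rewrite in_itv/= => /andP[ty _].
  by have [] := gd y (lt_le_trans t0 ty).
rewrite in_itv/= => /andP[tc c1].
have c0 : 0 < c by exact: lt_le_trans tc.
have dg0 : 0 <= dg c.
  rewrite /dg mulrA divfK ?gt_eqF//.
  have := dhB c c0 c1; rewrite -(mul1r `|_|) -s1 -normrM ler_norml; lra.
have : 0 <= dg c * (1 - t) by rewrite mulr_ge0// subr_ge0.
rewrite /g powR1 => h1 h2.
have : 0 <= B / a * t `^ a by rewrite mulr_ge0 ?powR_ge0// divr_ge0// ltW.
lra.
Qed.

Section kernel_mass.
Context {R : realType} {n : nat}.
Local Notation mu := (@lebesgue R n).

Definition hump_mass : R := \int[mu]_z tensor (fun=> @hump R) z.

Lemma tensor_hump_le1 (z : 'rV[R]_n) : 0 <= tensor (fun=> @hump R) z <= 1.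
Proof.
apply/andP; split; first by apply: prodr_ge0 => i _; exact: hump_ge0.
apply: le_trans (ler_norm _) _; apply: le_trans (tensor_le (M := fun=> 1) _) _.
  by move=> i; rewrite ger0_norm ?hump_le1 ?hump_ge0.
by rewrite big1.
Qed.

Lemma continuous_tensor_hump : continuous (tensor (fun=> @hump R) : 'rV[R]_n -> R).
Proof. by apply: continuous_tensor => i; apply: smooth1_continuous; exact: smooth1_hump. Qed.

Lemma integrable_continuous_supp (v : 'rV[R]_n -> R) c s M : continuous v -> 0 <= s ->
  (forall z, `|v z| <= M) -> (forall z, ~ cube c s z -> v z = 0) ->
  mu.-integrable setT (EFin \o v).
Proof.
move=> cv s0 vM v0; rewrite (_ : v = (fun z => 1 * v z)); last by apply/funext => z; rewrite mul1r.
apply: (proj1 (@integrable_supp _ _ _ mu (fun=> 1) v (cube c s) M _ _ _ _ _ _)) => //.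
- exact: measurable_cube.
- exact: measurable_continuous.
- rewrite (eq_integral (cst 1%E)); last by move=> z _; rewrite normr1.
  rewrite integral_cst; last exact: measurable_cube.
  by rewrite mul1e lebesgue_cube// ltry.
Qed.

Lemma integrable_tensor_hump : mu.-integrable setT (EFin \o tensor (fun=> @hump R)).
Proof.
apply: (@integrable_continuous_supp _ 0 1 1) => //.
- exact: continuous_tensor_hump.
- by move=> z; have /andP[h0 h1] := tensor_hump_le1 z; rewrite ger0_norm.
- move=> z; apply: tensor_supp => i s; rewrite mxE => h; apply: hump_eq0.
  by move: h; rewrite sub0r add0r -ler_norml -ltNge => /ltW.
Qed.

Lemma hump_mass_gt0 : 0 < hump_mass.
Proof.
have c0 : {for (0 : 'rV[R]_n),
    continuous (tensor (fun=> @hump R))} by exact: continuous_tensor_hump.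
pose h0 : R := tensor (fun=> @hump R) (0 : 'rV[R]_n).
have h0_gt0 : 0 < h0 by apply: prodr_gt0 => i _; rewrite mxE; apply: hump_gt0; rewrite normr0 ltr01.
have [d /= d0 hd] : exists2 d : R, 0 < d & forall z : 'rV[R]_n, `|0 - z| < d ->
    h0 / 2 < tensor (fun=> @hump R) z.
  have /nbhs_ballP[d /= d0 hd] : \forall z \near (0 : 'rV[R]_n), h0 / 2 < tensor (fun=> @hump R) z.
    by move: c0 => /cvgr_gt; apply; rewrite -/h0; lra.
  exists d => // z zd; apply: hd.
  by rewrite -ball_normE.
pose Q : set (lebesgue_rV n) := cube 0 (d / 2).
have mQ : measurable Q by exact: measurable_cube.
have mt : measurable_fun setT (tensor (fun=> @hump R) : lebesgue_rV n -> R).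
  by apply: measurable_continuous; exact: continuous_tensor_hump.
have d20 : 0 <= d / 2 by rewrite divr_ge0// ltW.
rewrite -lte_fin /hump_mass fineK; last exact: integrable_fin_num integrable_tensor_hump.
apply: (@lt_le_trans _ _ (\int[mu]_(z in Q) (h0 / 2)%:E)%E).
  rewrite integral_cst// lebesgue_cube// -EFinM lte_fin mulr_gt0 ?divr_gt0//.
  by rewrite exprn_gt0// mulr_gt0// divr_gt0.
apply: le_trans (@le_int_set _ _ _ mu Q (fun=> h0 / 2) _ mQ _ mt _ _) _.
- exact: measurable_cst.
- by move=> _; rewrite divr_ge0// ltW.
- move=> z Qz; apply/ltW/hd; rewrite -normrN opprB subr0.
  apply: (@le_lt_trans _ _ (d / 2)); last by rewrite ltr_pdivrMr// ltr_pMr// ltr1n.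
  by move: Qz; rewrite /Q cubeE//= subr0.
- apply: subset_int => // z; by have /andP[] := tensor_hump_le1 z.
Qed.

Lemma phi_affine (x b : 'rV[R]_n) (r t : R) : 0 < r -> 0 < t ->
  phi x b r t = (fun z => (t * r)^-1 ^+ n *
    tensor (fun=> @hump R) ((t * r)^-1 *: z + (- ((t * r)^-1 *: x) - r^-1 *: b))).
Proof.
move=> r0 t0; apply/funext => z.
rewrite /phi /tensor; under eq_bigr do rewrite /kern.
rewrite big_split/= prodr_const card_ord; congr (_ * _); apply: eq_bigr => i _.
by congr hump; rewrite !mxE; field; rewrite !gt_eqF.
Qed.

Lemma Rintegral_phi (x b : 'rV[R]_n) (r t : R) : 0 < r -> 0 < t ->
  \int[mu]_z phi x b r t z = hump_mass.
Proof.
move=> r0 t0; have tr0 : 0 < t * r by rewrite mulr_gt0.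
have k0 : 0 < (t * r)^-1 by rewrite invr_gt0.
have mh : measurable_fun setT (tensor (fun=> @hump R) : 'rV[R]_n -> R).
  by apply: measurable_rV_continuous; exact: continuous_tensor_hump.
have e := @Rintegral_affine R n _ (- ((t * r)^-1 *: x) - r^-1 *: b) _ k0 mh integrable_tensor_hump.
have i1 := @integrable_affine R n _ (- ((t * r)^-1 *: x) - r^-1 *: b)
    _ k0 ((measurable_EFinP _ _).2 mh) integrable_tensor_hump.
rewrite phi_affine// RintegralZl// e mulrA divff ?mul1r//.
by rewrite expf_neq0// gt_eqF.
Qed.

End kernel_mass.

Arguments hump_mass : clear implicits.
Arguments hump_mass_gt0 : clear implicits.

Section morrey.
Context {R : realType} {n : nat} (p q : R).
Hypotheses (p1 : 1 <= p) (q1 : 1 <= q) (nq : n%:R < q).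
Local Notation mu := (@lebesgue R n).
Context (F : 'rV[R]_n -> R) (G : 'rV[R]_n -> 'rV[R]_n).
Hypotheses (LF : F \in Lfun mu p%:E)
  (LG : forall i, (fun x => G x ord0 i) \in Lfun mu p%:E) (wG : weak_gradient F G)
  (cF : continuous F).

Let p0 : 0 < p. Proof. exact: lt_le_trans p1. Qed.
Let q0 : 0 < q. Proof. exact: lt_le_trans q1. Qed.

(** The flux is at most 2 r (t r)^-n and lives on a cube of volume (2 t r)^n inside the cube of
    center x + b and radius r, where the q-th powers of G are bounded. The exponent of t is - n / q,
    which exceeds -1 because q > n. *)
Lemma kavg_slope_le (x b : 'rV[R]_n) (r A t : R) : 0 < r -> `|b| <= r -> 0 < A ->
  (forall i, (\int[mu]_(z in cube (x + b) r) (`|G z ord0 i| `^ q)%:E <= (A `^ q * r ^+ n)%:E)%E) ->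
  0 < t -> t <= 1 ->
  `|kavg_slope x b r G t| <= n%:R * (2 * (1 + 2 ^+ n)) * r * A * t `^ (1 - n%:R / q - 1).
Proof.
move=> r0 br A0 hA t0 t1.
(* This level balances [young_int]: since k^q t^n = A^q, both of its terms are multiples of k (t
   r)^n. *)
set k := A * t `^ (- (n%:R / q)).
have k0 : 0 < k by rewrite mulr_gt0// powR_gt0.
have tr0 : 0 < t * r by rewrite mulr_gt0.
rewrite (_ : 1 - _ - 1 = - (n%:R / q)); last by ring.
suff key i : `|\int[mu]_z (G z ord0 i * vphi x b r i t z)| <= 2 * (1 + 2 ^+ n) * r * k.
  rewrite /kavg_slope (le_trans (ler_norm_sum _ _ _))//.
  apply: (@le_trans _ _ (\sum_(i < n) 2 * (1 + 2 ^+ n) * r * k)); first exact: ler_sum.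
  by rewrite sumr_const card_ord -[leLHS]mulr_natl /k !mulrA lexx.
have [mG _] := (Lfun_intp mu (fun z => G z ord0 i) p0).1 (LG i).
have [_ h] := @Lfun_mul_supp R n p p1 _ (vphi x b r i t) (x + t *: b) (t * r)
   (2 * r * (t * r)^-1 ^+ n) (ltW tr0) (LG i) (@continuous_vphi _ _ x b r i t)
   (fun z => @vphi_le _ _ x b r r0 br i t z t0) (fun z => @vphi_supp _ _ x b r r0 i t z t0).
rewrite -lee_fin; apply: (le_trans h).
pose Q : set (lebesgue_rV n) := cube (x + t *: b) (t * r).
pose Q' : set (lebesgue_rV n) := cube (x + b) r.
have mQ : measurable Q by exact: measurable_cube.
have mQ' : measurable Q' by exact: measurable_cube.
have QQ : Q `<=` Q'.
  apply: cube_sub; first exact: ltW.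
  rewrite (_ : _ - _ = (t - 1) *: b); last by rewrite scalerBl scale1r opprD addrACA subrr add0r.
  rewrite normrZ distrC ger0_norm ?subr_ge0//.
  have : (1 - t) * `|b| <= (1 - t) * r by rewrite ler_wpM2l// subr_ge0.
  lra.
have mGq : measurable_fun [set: lebesgue_rV n] (fun z : lebesgue_rV n => `|G z ord0 i| `^ q : R).
  by apply: measurable_powR_fun; exact: measurable_normr_fun.
have c0 : 0 <= 2 * r * (t * r)^-1 ^+ n by rewrite !mulr_ge0 ?exprn_ge0 ?invr_ge0 ?ltW.
apply: (@le_trans _ _ ((2 * r * (t * r)^-1 ^+ n)%:E *
   ((k `^ (1 - q))%:E * (A `^ q * r ^+ n)%:E + k%:E * ((2 * (t * r)) ^+ n)%:E)))%E.
  apply: lee_wpmul2l; first by rewrite lee_fin.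
  have yi := young_int mu mQ mG k0 q1.
  apply: (le_trans yi).
  rewrite (lebesgue_cube _ (ltW tr0)) leeD2r//; apply: lee_wpmul2l.
    by rewrite lee_fin powR_ge0.
  apply: le_trans (hA i); apply: (subset_int mu mQ mQ' mGq); last exact: QQ.
  by move=> z; exact: powR_ge0.
rewrite -[leLHS]/((2 * r * (t * r)^-1 ^+ n *
  (k `^ (1 - q) * (A `^ q * r ^+ n) + k * (2 * (t * r)) ^+ n))%:E) lee_fin.
have -> : k `^ (1 - q) * (A `^ q * r ^+ n) = k * (t ^+ n * r ^+ n).
  rewrite powRD_gt0// powRN powRr1 ?(ltW k0)//.
  have -> : k `^ q = A `^ q * (t ^+ n)^-1.
    rewrite /k powRM ?powR_ge0 ?(ltW A0)// -powRrM.
    by rewrite mulNr divfK ?gt_eqF// powRN powR_mulrn// ltW.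
  have Aq0 : A `^ q != 0 by rewrite gt_eqF// powR_gt0.
  have tn0 : t ^+ n != 0 by rewrite expf_neq0// gt_eqF.
  by move: (A `^ q) (t ^+ n) (r ^+ n) Aq0 tn0 => a b' c a0 b0; field; rewrite a0 b0.
rewrite !exprMn exprVn exprMn.
have tn0 : t ^+ n != 0 by rewrite expf_neq0// gt_eqF.
have rn0 : r ^+ n != 0 by rewrite expf_neq0// gt_eqF.
by move: (t ^+ n) (r ^+ n) (2 ^+ n) tn0 rn0 => a b' c a0 b0;
  rewrite le_eqVlt; apply/orP; left; apply/eqP; field; rewrite a0 b0.
Qed.

Lemma kavg_close (x b : 'rV[R]_n) (r e : R) : 0 < r -> `|b| <= r -> 0 < e ->
  exists2 t : R, 0 < t <= 1 & `|kavg x b r F t - hump_mass R n * F x| <= e * hump_mass R n.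
Proof.
move=> r0 br e0.
have [d /= d0 hd] : exists2 d : R, 0 < d & forall z : 'rV[R]_n, `|x - z| < d ->
    `|F x - F z| < e.
  have /nbhs_ballP[d /= d0 hd] : \forall z \near x, `|F x - F z| < e.
    by move/cvgrPdist_lt: (@cF x); apply.
  by exists d => // z zd; apply: hd; rewrite -ball_normE.
(* The kernel lives within 2 t r <= d / 2 of x, where F differs from F x by less than e. *)
pose t : R := Num.min 1 (d / (4 * r)).
have t0 : 0 < t by rewrite lt_min ltr01/= divr_gt0// mulr_gt0.
have trd : 4 * (t * r) <= d.
  have : t <= d / (4 * r) by rewrite ge_min lexx orbT.
  by rewrite ler_pdivlMr ?mulr_gt0//; lra.
have tr0 : 0 < t * r by rewrite mulr_gt0.
exists t; first by rewrite t0 ge_min lexx.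
have Fe z : `|(F z - F x) * phi x b r t z| <= e * phi x b r t z.
  have [zc|zc] := pselect (cube (x + t *: b) (t * r) z); last first.
    by rewrite (phi_supp r0 t0 zc)// !mulr0 normr0.
  rewrite normrM (ger0_norm (phi_ge0 _ _ r0 _ t0)); apply: ler_wpM2r; first exact: phi_ge0.
  rewrite distrC; apply/ltW/hd.
  move: zc; rewrite (cubeE _ (ltW tr0))/= => zc.
  rewrite distrC (_ : z - x = (z - (x + t *: b)) + t *: b); last by rewrite opprD addrA subrK.
  apply: le_lt_trans (ler_normD _ _) _; rewrite normrZ gtr0_norm//.
  have : t * `|b| <= t * r by rewrite ler_pM2l.
  by lra.
have phM z : `|phi x b r t z| <= (t * r)^-1 ^+ n by exact: phi_le.
have phS z : ~ cube (x + t *: b) (t * r) z -> phi x b r t z = 0 by exact: phi_supp.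
have cph : continuous (phi x b r t) by exact: continuous_phi.
have [i1 _] := Lfun_mul_supp p1 (ltW tr0) LF cph phM phS.
have i2 := integrable_continuous_supp cph (ltW tr0) phM phS.
have i3 := integrableZl measurableT (F x) i2.
have i4 := integrableZl measurableT e i2.
have -> : e * hump_mass R n = \int[mu]_z (e * phi x b r t z).
  by rewrite RintegralZl// Rintegral_phi.
have -> : hump_mass R n * F x = \int[mu]_z (F x * phi x b r t z).
  by rewrite RintegralZl// Rintegral_phi// mulrC.
rewrite /kavg -RintegralB//.
have i5 : mu.-integrable setT (EFin \o (fun z => F z * phi x b r t z - F x * phi x b r t z)).
  exact: (integrableB measurableT i1 i3).
apply: le_trans (le_normr_Rintegral measurableT i5) _.
apply: le_Rintegral => //; first exact: (integrable_norm i5).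
by move=> z _; rewrite -mulrBl.
Qed.

End morrey.

Lemma two_sided_le (R : realType) (m a b v B : R) : 0 < m ->
  `|v - m * a| <= B -> `|v - m * b| <= B -> `|a - b| <= 2 * B / m.
Proof.
move=> m0 va vb; rewrite ler_pdivlMr// mulrC -{1}(gtr0_norm m0) -normrM mulrBr.
apply: le_trans (ler_distD v _ _) _.
by rewrite [leRHS]mulr_natl mulr2n lerD// distrC.
Qed.

Theorem morrey (R : realType) (n : nat) (q : R) : 1 <= q -> n%:R < q ->
  exists2 C : R, 0 < C & forall (p : R) (F : 'rV[R]_n -> R) (G : 'rV[R]_n -> 'rV[R]_n)
    (c : 'rV[R]_n) (r A : R), 1 <= p -> F \in Lfun (lebesgue n) p%:E ->
  (forall i, (fun x => G x ord0 i) \in Lfun (lebesgue n) p%:E) -> weak_gradient F G ->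
  continuous F -> 0 < r -> 0 <= A ->
  (forall i, (\int[lebesgue n]_(z in cube c r) (`|G z ord0 i| `^ q)%:E <= (A `^ q * r ^+ n)%:E)%E)
      ->
  forall x y, cube c r x -> cube c r y -> `|F x - F y| <= C * r * A.
Proof.
move=> q1 nq; pose K : R := n%:R * (2 * (1 + 2 ^+ n)).
have q0 : 0 < q by exact: lt_le_trans q1.
pose a := 1 - n%:R / q.
have a0 : 0 < a by rewrite subr_gt0 ltr_pdivrMr// mul1r.
have m0 := hump_mass_gt0 R n.
have K0 : 0 <= K by rewrite !mulr_ge0// addr_ge0.
(* Adding 1 keeps the constant positive when n = 0. *)
exists (2 * (K + 1) / a / hump_mass R n); first by rewrite !divr_gt0// mulr_gt0// ltr_wpDl.
move=> p F G c r A p1 LF LG wG cF r0 A0 hA x y xc yc.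
(* [kavg_slope_le] requires a positive bound while [A] may vanish; the strict majorant is then
   brought down to [A]. *)
suff key A' : A < A' -> `|F x - F y| <= 2 * (K + 1) / a / hump_mass R n * r * A'.
  have c0 : 0 < 2 * (K + 1) / a / hump_mass R n * r.
    by rewrite !mulr_gt0// ?invr_gt0// ltr_wpDl.
  rewrite -ler_pdivrMl//; apply/ler_addgt0Pr => e e0.
  by rewrite ler_pdivrMl//; apply: key; rewrite ltrDl.
move=> AA; have A'0 : 0 < A' by exact: le_lt_trans AA.
have hA' i : (\int[lebesgue n]_(z in cube c r) (`|G z ord0 i| `^ q)%:E <= (A' `^ q * r ^+ n)%:E)%E.
  apply: le_trans (hA i) _; rewrite lee_fin ler_wpM2r ?exprn_ge0 ?(ltW r0)//.
  by apply: ge0_ler_powR; rewrite ?nnegrE ?(ltW A'0) ?(ltW q0)// ltW.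
have fin : 2 * (K * r * A' / a) / hump_mass R n <= 2 * (K + 1) / a / hump_mass R n * r * A'.
  rewrite (_ : 2 * _ / _ = 2 * K / a / hump_mass R n * r * A'); last by field; rewrite !gt_eqF.
  by rewrite !ler_pM2r ?invr_gt0// ler_pM2l// lerDl.
have half x' : cube c r x' ->
    `|kavg x' (c - x') r F 1 - hump_mass R n * F x'| <= K * r * A' / a.
  move=> x'c.
  have br : `|c - x'| <= r by move: x'c; rewrite (cubeE _ (ltW r0))/= distrC.
  apply/ler_addgt0Pr => e e0.
  have em0 : 0 < e / hump_mass R n by rewrite divr_gt0.
  have [t /andP[t0 t1]] := kavg_close p1 LF cF x' r0 br em0.
  rewrite divfK ?gt_eqF// => ht.
  have := @powR_derivative_bound R (kavg x' (c - x') r F) (kavg_slope x' (c - x') r G)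
      (K * r * A') a.
  move=> /(_ _ a0 _ _ t t0 t1) ht1.
  rewrite -(subrK (kavg x' (c - x') r F t) (kavg x' (c - x') r F 1)) -addrA.
  apply: le_trans (ler_normD _ _) _; apply: lerD => //; apply: ht1.
  - by rewrite !mulr_ge0// ltW.
  - move=> s s0; have hd := @is_derive_kavg R n x' (c - x') r p r0 br p1 F G LF wG s s0; exact: hd.
  - move=> s s0 s1; have := kavg_slope_le p1 q1 LG r0 br A'0 _ s0 s1; apply.
    by rewrite addrC subrK.
(* At t = 1 the kernel for the offset c - x is centered at c, whatever x is: the paths towards x and
   towards y start from the same average. *)
have e1 : kavg x (c - x) r F 1 = kavg y (c - y) r F 1.
  apply: eq_Rintegral => z _; congr (_ * _); apply: eq_bigr => i _.
  by rewrite /kern invr1 !mul1r !mxE; congr (_ * hump (_ * _)); ring.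
have h1 := half _ xc; have h2 := half _ yc; rewrite e1 in h1.
exact: le_trans (two_sided_le m0 h1 h2) fin.
Qed.

(** * Uniqueness of weak gradients *)

Section vanishing_integrals.
Context d (T : measurableType d) {R : realType} (mu : {measure set T -> \bar R}).
Implicit Types (f g h : T -> R) (A B : set T).

Lemma dominated_integral_eq0 (f_ : nat -> T -> R) f g :
  (forall k, measurable_fun setT (f_ k)) -> measurable_fun setT f ->
  (forall x, f_ ^~ x @ \oo --> f x) -> mu.-integrable setT (EFin \o g) ->
  (forall x k, `|f_ k x| <= g x) -> (forall k, \int[mu]_x (f_ k x)%:E = 0)%E ->
  (\int[mu]_x (f x)%:E = 0)%E.
Proof.
move=> mf_ mf ff ig fg f0.
have ff' : {ae mu, forall x, setT x -> (EFin \o f_ k) x @[k --> \oo] --> (EFin \o f) x}.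
  by apply: aeW => x _; apply/fine_cvgP; split; [exact: nearW|exact: ff].
have fg' : {ae mu, forall x k, setT x -> (`|(EFin \o f_ k) x| <= (EFin \o g) x)%E}.
  by apply: aeW => x k _; rewrite /= lee_fin.
have [_ _] := @dominated_convergence _ _ _ mu setT measurableT (fun k => EFin \o f_ k)
  (EFin \o f) (EFin \o g) (fun k => (measurable_EFinP _ _).2 (mf_ k))
  ((measurable_EFinP _ _).2 mf) ff' ig fg'.
move=> h; have := cvg_unique _ h; apply => //.
rewrite (_ : [sequence _]_k = cst 0%E); last by apply/funext => k; exact: f0.
exact: cvg_cst.
Qed.

(** The sets over whose preimage h has integral 0 form a Dynkin system. The map [phi] is there for
    the case of the identity from the Lebesgue to the Borel sigma-algebra, since only the latter is
    generated by [boxes]. *)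
Lemma integral_preimage_eq0 d' (T' : measurableType d') (phi : T -> T') (G : set (set T')) h :
  measurable_fun setT phi -> mu.-integrable setT (EFin \o h) ->
  @measurable _ T' = <<s G >> -> setI_closed G ->
  (\int[mu]_x (h x)%:E = 0)%E ->
  (forall A : set T', G A -> \int[mu]_(x in phi @^-1` A) (h x)%:E = 0)%E ->
  forall A : set T', measurable A -> (\int[mu]_(x in phi @^-1` A) (h x)%:E = 0)%E.
Proof.
move=> mphi ih TG GI hT hG A mA.
have mp (B : set T') : measurable B -> measurable (phi @^-1` B).
  by move=> mB; rewrite -[X in measurable X]setTI; exact: mphi.
rewrite TG in mA; move: A mA.
apply: (dynkin_induction TG GI) => //.
- move=> B mB hB; rewrite -hT -(setUv (phi @^-1` B)) integral_setU//.
  + by rewrite hB add0e preimage_setC.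
  + exact: mp.
  + by apply: measurableC; exact: mp.
  + by rewrite setUv; case/integrableP: ih.
  + by rewrite disj_set2E setICr.
- move=> F mF tF F0; rewrite preimage_bigcup integral_bigcup//.
  + by rewrite eseries0// => i _ _; exact: F0.
  + by move/trivIsetP: tF => tF; apply/trivIsetP => i j _ _ ij;
      rewrite -preimage_setI tF// preimage_set0.
  + by move=> k; exact: mp.
  + apply: integrableS ih => //; apply: bigcupT_measurable => k; exact: mp.
Qed.

Lemma integral_hull_eq0 h A B : measurable A -> measurable B -> measurable_fun setT h ->
  A `<=` B -> mu (B `\` A) = 0%E -> (\int[mu]_(x in B) (h x)%:E = 0)%E ->
  (\int[mu]_(x in A) (h x)%:E = 0)%E.
Proof.
move=> mA mB mh AB BA0.
have mBA : measurable (B `\` A) by exact: measurableD.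
rewrite -{1}(setDUK AB) integral_setU//.
- rewrite [X in (_ + X)%E]null_set_integral// ?adde0//.
  by apply: measurable_funTS; exact/measurable_EFinP.
- by apply: measurable_funTS; exact/measurable_EFinP.
- by rewrite disj_set2E setDIK.
Qed.

Lemma ae_eq0_of_parts h : mu.-integrable setT (EFin \o h) ->
  (\int[mu]_(x in [set x | 0 < h x]%R) (h x)%:E = 0)%E ->
  (\int[mu]_(x in [set x | h x < 0]%R) (h x)%:E = 0)%E ->
  {ae mu, forall x, h x = 0}.
Proof.
move=> ih hp hn; have /measurable_EFinP mh : measurable_fun setT (EFin \o h)
    by case/integrableP: ih.
have mp : measurable [set x | 0 < h x].
  rewrite (_ : mkset _ = [set: T] `&` h @^-1` `]0, +oo[%classic).
    by apply: mh => //; exact: measurable_itv.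
  by rewrite setTI; apply/seteqP; split => x /=; rewrite in_itv/= andbT.
have mn : measurable [set x | h x < 0].
  rewrite (_ : mkset _ = [set: T] `&` h @^-1` `]-oo, 0[%classic).
    by apply: mh => //; exact: measurable_itv.
  by rewrite setTI; apply/seteqP; split => x /=; rewrite in_itv.
have mhp : measurable_fun [set x | 0 < h x] (EFin \o h).
  by apply: measurable_funTS; apply/measurable_EFinP.
have mhn : measurable_fun [set x | h x < 0] (EFin \o h).
  by apply: measurable_funTS; apply/measurable_EFinP.
have [+ _] := ae_eq_integral_abs mu mp mhp; rewrite [X in X = _](_ : _ = 0%E); last first.
  by rewrite -hp; apply: eq_integral => x; rewrite inE/= => hx; rewrite gtr0_norm.
move=> /(_ erefl) h1.
have [+ _] := ae_eq_integral_abs mu mn mhn; rewrite [X in X = _](_ : _ = 0%E); last first.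
  transitivity (- \int[mu]_(x in [set x | (h x < 0)%R]) (h x)%:E)%E; last by rewrite hn oppe0.
  rewrite -integralN; last first.
    by apply: integrable_add_def => //; exact: (integrableS measurableT mn (@subsetT _ _) ih).
  by apply: eq_integral => x; rewrite inE/= => hx; rewrite ltr0_norm.
move=> /(_ erefl) h2.
apply: filterS2 h1 h2 => x /= h1 h2.
case: (ltrgtP (h x) 0) => // hx.
  by have /eqP := h2 hx; rewrite eqe => /eqP.
by have /eqP := h1 hx; rewrite eqe => /eqP.
Qed.

End vanishing_integrals.

Section borel_hull.
Context {R : realType} {n : nat}.
Local Notation mu := (@lebesgue R n).

(** By definition of the outer measure, A has Borel covers of excess at most 1 / (k + 1); their
    intersection has excess 0. The Dynkin argument only reaches Borel sets, while the sets where a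
    function is positive or negative are merely Lebesgue measurable. *)
Lemma lebesgue_borel_hull (A : set (lebesgue_rV n)) : measurable A -> (mu A < +oo)%E ->
  exists B : set 'rV[R]_n, [/\ measurable B, A `<=` B & mu (B `\` A) = 0%E].
Proof.
move=> mA Aoo.
have cover (k : nat) : exists B : set 'rV[R]_n,
    [/\ measurable B, A `<=` B & (mu B <= mu A + (k.+1%:R^-1)%:E)%E].
  have Afin : mu A \is a fin_num by rewrite ge0_fin_numE.
  have k0 : 0 < k.+1%:R^-1 :> R by rewrite invr_gt0.
  have [x [F [mF AF] <-] xA] := @lb_ereal_inf_adherent R _ _ k0 Afin.
  exists (\bigcup_i F i); split => //; first by apply: bigcupT_measurable.
  apply: le_trans (ltW xA).
  apply: (@le_trans _ _ (\sum_(i <oo) mu (F i))%E).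
    apply: measure_sigma_subadditive => //.
      by move=> i; apply: measurable_lebesgue; exact: mF.
    by apply: measurable_lebesgue; apply: bigcupT_measurable.
  by apply: lee_nneseries => // i _; rewrite lebesgue_borel//; exact: mF.
have [B hB] := choice cover.
have mB : measurable (\bigcap_k B k) by apply: bigcapT_measurable => k; have [] := hB k.
have AB : A `<=` \bigcap_k B k by move=> x Ax k _; have [_ + _] := hB k; apply.
have mB' := measurable_lebesgue mB.
exists (\bigcap_k B k); split => //.
have hle : (mu (\bigcap_k B k) <= mu A)%E.
  apply/lee_addgt0Pr => e e0.
  pose k := Num.truncn e^-1.
  have [mBk _ Bk] := hB k.
  apply: (@le_trans _ _ (mu (B k))).
    apply: le_measure; rewrite ?inE//; first exact: measurable_lebesgue.
    by move=> x; apply.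
  apply: (le_trans Bk); rewrite leeD2l// lee_fin.
  by rewrite invf_ple ?posrE// ltW// truncnS_gt.
rewrite measureD//; last first.
  by apply: le_lt_trans hle _.
have e : mu (\bigcap_k B k) = mu A.
  apply/eqP; rewrite eq_le hle/=; apply: le_measure; rewrite ?inE//.
transitivity (mu A - mu A)%E; last by rewrite subee// ge0_fin_numE.
by congr (_ - _)%E; [exact: e|congr (mu _); exact: setIidr].
Qed.

End borel_hull.

Section box_approximation.
Context {R : realType} {n : nat}.
Local Notation mu := (@lebesgue R n).

(** Smooth functions with values in [0, 1] that tend pointwise to the indicator of [a, b]. With K =
    k + 1, the first argument is K^2 (s - a) + K: it is at least K, hence tends to infinity, for s
    >= a, endpoint included, and it is negative for s < a - 1 / K. *)
Definition plateau (a b : R) (k : nat) (s : R) : R :=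
  flat 0 (k.+1%:R ^+ 2 * s + (k.+1%:R - k.+1%:R ^+ 2 * a)) *
  flat 0 (- k.+1%:R ^+ 2 * s + (k.+1%:R + k.+1%:R ^+ 2 * b)).

Lemma smooth1_plateau a b k : smooth1 (plateau a b k).
Proof. by apply: smooth1M; apply: smooth1_affine; exact: smooth1_flat. Qed.

Lemma plateau_ge0 a b k s : 0 <= plateau a b k s.
Proof. by rewrite mulr_ge0// flat_ge0. Qed.

Lemma plateau_le1 a b k s : plateau a b k s <= 1.
Proof. by rewrite mulr_ile1// ?flat_ge0// flat0_le1. Qed.

Lemma plateau_eq0 a b k s : k.+1%:R * (s - a) <= -1 \/ k.+1%:R * (b - s) <= -1 ->
  plateau a b k s = 0.
Proof.
have k0 : 0 < k.+1%:R :> R by [].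
rewrite /plateau => -[h|h].
  rewrite flat_le0 ?mul0r// (_ : _ + _ = k.+1%:R * (k.+1%:R * (s - a) + 1)); last by ring.
  by rewrite pmulr_rle0//; lra.
rewrite [X in _ * X]flat_le0 ?mulr0// (_ : _ + _ = k.+1%:R * (k.+1%:R * (b - s) + 1)); last by ring.
by rewrite pmulr_rle0//; lra.
Qed.

Lemma flat0_ge (y : R) : 0 < y -> 1 - y^-1 <= flat 0 y.
Proof. by move=> y0; rewrite /flat y0 expr0 invr1 mul1r; exact: expR_ge1Dx. Qed.

Lemma cvg_plateau a b s : plateau a b ^~ s @ \oo --> ((a <= s <= b)%R%:R : R).
Proof.
have [/andP[as_ sb]|] := boolP (a <= s <= b).
  apply: (@squeeze_cvgr _ _ _ _ (fun k => (1 - k.+1%:R^-1) * (1 - k.+1%:R^-1)) (cst 1)).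
  - apply: nearW => k; rewrite plateau_le1 andbT.
    have k0 : 0 < k.+1%:R :> R by [].
    have k1 : k.+1%:R^-1 <= 1 :> R by rewrite invf_le1// ler1n.
    have aux (u : R) : k.+1%:R <= u -> 1 - k.+1%:R^-1 <= flat 0 u.
      move=> ku; have u0 : 0 < u by exact: lt_le_trans ku.
      by apply: le_trans (flat0_ge u0); rewrite lerD2l lerN2 lef_pV2.
    have k20 : 0 <= k.+1%:R ^+ 2 :> R by rewrite exprn_ge0.
    apply: ler_pM; rewrite ?subr_ge0//; apply: aux.
    + have := mulr_ge0 k20 (_ : 0 <= s - a); rewrite subr_ge0 => /(_ as_); lra.
    + have := mulr_ge0 k20 (_ : 0 <= b - s); rewrite subr_ge0 => /(_ sb); lra.
  - have h : (1 - k.+1%:R^-1 : R) @[k --> \oo] --> (1 - 0 : R).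
      by apply: cvgB; [exact: cvg_cst|exact: cvg_harmonic].
    rewrite (_ : true%:R = (1 - 0) * (1 - 0) :> R); last by rewrite subr0 mulr1.
    exact: cvgM.
  - exact: cvg_cst.
move=> sab; apply: cvg_near_cst.
have [d d0 hd] : exists2 d, 0 < d & s - a <= - d \/ b - s <= - d.
  move: sab; rewrite negb_and -!ltNge => /orP[h|h].
    by exists (a - s); [rewrite subr_gt0|left; lra].
  by exists (s - b); [rewrite subr_gt0|right; lra].
near=> k; apply: plateau_eq0.
have k0 : 0 < k.+1%:R :> R by [].
have kd : 1 <= k.+1%:R * d.
  rewrite -ler_pdivrMr// div1r.
  apply: (@le_trans _ _ k%:R); last by rewrite ler_nat.
  by near: k; exact: nbhs_infty_ger.
case: hd => h; [left|right].
  by apply: (@le_trans _ _ (k.+1%:R * - d)); [rewrite ler_pM2l|lra].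
by apply: (@le_trans _ _ (k.+1%:R * - d)); [rewrite ler_pM2l|lra].
Unshelve. all: by end_near. Qed.

Lemma cvg_prodr (I : Type) (r : seq I) (f : nat -> I -> R) (l : I -> R) :
  (forall i, f ^~ i @ \oo --> l i) ->
  \prod_(i <- r) f k i @[k --> \oo] --> \prod_(i <- r) l i.
Proof.
move=> fl; elim: r => [|i r IH].
  by rewrite big_nil; under eq_fun do rewrite big_nil; exact: cvg_cst.
by rewrite big_cons; under eq_fun do rewrite big_cons; exact: cvgM.
Qed.

(** The hypothesis is passed to the limit along tensor products of plateaus. The radius r is large
    enough for one cube to contain all their supports, so |H| on that cube dominates. *)
Lemma integral_box_eq0 (p : R) (H : lebesgue_rV n -> R) (a b : 'rV[R]_n) : 1 <= p ->
  H \in Lfun mu p%:E ->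
  (forall phi : 'rV[R]_n -> R, test_function phi -> \int[mu]_z (H z * phi z) = 0) ->
  (\int[mu]_z (H z * \1_(box a b) z)%:E = 0)%E.
Proof.
move=> p1 LH H0; have p0 : 0 < p by exact: lt_le_trans p1.
have [mH _] := (Lfun_intp mu H p0).1 LH.
pose r := `|a| + `|b| + 1; have r0 : 0 <= r by rewrite !addr_ge0.
pose f k (i : 'I_n) := plateau (a ord0 i) (b ord0 i) k.
have fs k i s : ~~ ((0 : 'rV[R]_n) ord0 i - r <= s <= (0 : 'rV[R]_n) ord0 i + r) -> f k i s = 0.
  rewrite mxE sub0r add0r negb_and -!ltNge => h; apply: plateau_eq0.
  have k1 : 1 <= k.+1%:R :> R by rewrite ler1n.
  have ha := rV_coord_le a i; have hb := rV_coord_le b i.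
  move: ha hb; rewrite !ler_norml => /andP[ha1 ha2] /andP[hb1 hb2].
  have na := normr_ge0 a; have nb := normr_ge0 b.
  case/orP: h; rewrite /r => h; [left|right].
    have : k.+1%:R * (s - a ord0 i) <= k.+1%:R * -1 by rewrite ler_pM2l//; lra.
    lra.
  have : k.+1%:R * (b ord0 i - s) <= k.+1%:R * -1 by rewrite ler_pM2l//; lra.
  lra.
have sf k i : smooth1 (f k i) by exact: smooth1_plateau.
have tf k : test_function (tensor (f k)) by exact: (test_function_tensor (sf k) (fs k)).
have t1 k z : `|tensor (f k) z| <= 1.
  apply: le_trans (tensor_le (M := fun=> 1) _) _; last by rewrite big1.
  by move=> i; rewrite ger0_norm ?plateau_le1 ?plateau_ge0.
have ct k : continuous (tensor (f k)).
  by apply: continuous_tensor => i; exact: smooth1_continuous.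
have hi k := Lfun_mul_supp p1 r0 LH (ct k) (t1 k) (tensor_supp (fs k)).
pose Q : set (lebesgue_rV n) := cube 0 r.
have mQ : measurable Q by exact: measurable_cube.
have iQ : mu.-integrable setT (EFin \o (fun z => H z * \1_Q z)).
  apply: (proj1 (@integrable_supp _ _ _ mu H _ Q 1 mQ mH _ _ _ _)).
  - by apply: measurable_indic.
  - by move=> z; rewrite indicE; case: (_ \in _); rewrite ?normr1 ?normr0.
  - by move=> z nz; rewrite indicE memNset.
  - exact: (Lfun_int_cube p1 _ r0 LH).
have iQn : mu.-integrable setT (EFin \o (fun z => `|H z * \1_Q z|)).
  exact: integrable_norm iQ.
apply: (@dominated_integral_eq0 _ _ _ mu (fun k z => H z * tensor (f k) z) _ _ _ _ _ iQn).
- by move=> k; apply: measurable_funM => //; exact: measurable_continuous.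
- apply: measurable_funM => //; apply: measurable_indic.
  by apply: measurable_lebesgue; exact: measurable_box.
- move=> z; apply: cvgM; first exact: cvg_cst.
  rewrite (_ : \1_(box a b) z = \prod_(i < n) (a ord0 i <= z ord0 i <= b ord0 i)%R%:R).
    by apply: cvg_prodr => i; exact: cvg_plateau.
  rewrite indicE; have [zb|zb] := pselect (box a b z).
    by rewrite mem_set// big1// => i _; rewrite zb.
  rewrite memNset//; move: zb => /existsNP[i /negP/negbTE zi].
  by rewrite (bigD1 i)//= zi mul0r.
- move=> z k; have [zQ|zQ] := pselect (Q z).
    rewrite [in leRHS]indicE mem_set// mulr1 normrM ler_piMr//.
  by rewrite (tensor_supp (fs k) zQ) mulr0 normr0.
- move=> k; have := H0 _ (tf k); rewrite /Rintegral => e.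
  rewrite -[LHS]fineK ?e//; have [+ _] := hi k; exact: integrable_fin_num.
Qed.

(** Vanishing of the integrals spreads from boxes to Borel sets by Dynkin induction, then to
    Lebesgue sets by Borel hulls, and is finally used on the sets where the function is positive or
    negative. *)
Theorem Lfun_eq0_of_test (p : R) (H : lebesgue_rV n -> R) : 1 <= p ->
  H \in Lfun mu p%:E ->
  (forall phi : 'rV[R]_n -> R, test_function phi -> \int[mu]_z (H z * phi z) = 0) ->
  {ae mu, forall z, H z = 0}.
Proof.
move=> p1 LH H0; have p0 : 0 < p by exact: lt_le_trans p1.
have [mH _] := (Lfun_intp mu H p0).1 LH.
(* H is integrable on bounded sets only, so the argument is run in one cube at a time. *)
suff key (N : nat) : {ae mu, forall z, H z * \1_(cube (0 : 'rV[R]_n) N%:R) z = 0}.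
  have := ae_foralln key; apply: filterS => z hz.
  have [N _ zN] : (\bigcup_k cube (0 : 'rV[R]_n) k%:R) z by rewrite bigcup_cube.
  by have := hz N; rewrite indicE mem_set// mulr1.
pose Q : set (lebesgue_rV n) := cube (0 : 'rV[R]_n) N%:R.
have mQ : measurable Q by exact: measurable_cube.
have N0 : 0 <= N%:R :> R by [].
pose h z := H z * \1_Q z.
have ih : mu.-integrable setT (EFin \o h).
  apply: (proj1 (@integrable_supp _ _ _ mu H _ Q 1 mQ mH _ _ _ _)).
  - by apply: measurable_indic.
  - by move=> z; rewrite indicE; case: (_ \in _); rewrite ?normr1 ?normr0.
  - by move=> z nz; rewrite indicE memNset.
  - exact: (Lfun_int_cube p1 _ N0 LH).
have mh : measurable_fun setT h by apply: measurable_funM => //; apply: measurable_indic.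
have hbox (A : set 'rV[R]_n) : boxes A -> (\int[mu]_(z in A) (h z)%:E = 0)%E.
  move=> bA; have [a [b ABE]] := setI_closed_boxes bA (cube_boxes 0 N%:R).
  rewrite integral_mkcond -(integral_box_eq0 a b p1 LH H0); apply: eq_integral => z _.
  rewrite patchE -ABE /h indicI /= [\1_A z]indicE.
  by case: ifP => _; rewrite /= ?mul1r ?mul0r ?mulr0.
have hT : (\int[mu]_z (h z)%:E = 0)%E.
  rewrite -[RHS](hbox _ (cube_boxes 0 N%:R)) [RHS]integral_mkcond; apply: eq_integral => z _.
  by rewrite patchE; case: ifP => // zQ; rewrite /h indicE zQ mulr0.
have hB : forall B : set 'rV[R]_n, measurable B -> (\int[mu]_(z in B) (h z)%:E = 0)%E.
  move=> B mB; have h0 := @integral_preimage_eq0 _ (lebesgue_rV n) R mu _ 'rV[R]_n id (@boxes R n) h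
    (@measurable_lebesgue_id R n) ih (@measurable_boxes R n) (@setI_closed_boxes R n) hT hbox B mB.
  by rewrite -[RHS]h0.
have hA (A : set (lebesgue_rV n)) : measurable A -> A `<=` Q -> (\int[mu]_(z in A) (h z)%:E = 0)%E.
  move=> mA AQ.
  have Aoo : (mu A < +oo)%E.
    apply: le_lt_trans (_ : mu Q < +oo)%E; first by apply: le_measure; rewrite ?inE.
    by rewrite lebesgue_cube// ltry.
  have [B [mB AB BA0]] := lebesgue_borel_hull mA Aoo.
  exact: (integral_hull_eq0 mA (measurable_lebesgue mB) mh AB BA0 (hB B mB)).
apply: ae_eq0_of_parts ih _ _; apply: hA.
- rewrite (_ : mkset _ = [set: lebesgue_rV n] `&` h @^-1` `]0, +oo[%classic).
    by apply: mh => //; exact: measurable_itv.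
  by rewrite setTI; apply/seteqP; split => x /=; rewrite in_itv/= andbT.
- by move=> z /=; rewrite /h indicE; case: (boolP (z \in Q)) => [/set_mem//|_]; rewrite mulr0 ltxx.
- rewrite (_ : mkset _ = [set: lebesgue_rV n] `&` h @^-1` `]-oo, 0[%classic).
    by apply: mh => //; exact: measurable_itv.
  by rewrite setTI; apply/seteqP; split => x /=; rewrite in_itv.
- by move=> z /=; rewrite /h indicE; case: (boolP (z \in Q)) => [/set_mem//|_]; rewrite mulr0 ltxx.
Qed.

End box_approximation.

(** * Necessity *)

Section real_powers.
Context {R : realType}.
Implicit Types a b p : R.

Lemma powRD_le a b p : 0 <= a -> 0 <= b -> 0 <= p ->
  (a + b) `^ p <= 2 `^ p * (a `^ p + b `^ p).
Proof.
move=> a0 b0 p0; wlog ab : a b a0 b0 / a <= b.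
  move=> h; have [ab|/ltW ab] := leP a b; first exact: h.
  by rewrite addrC [leRHS]mulrC [a `^ p + _]addrC mulrC; exact: h.
apply: (@le_trans _ _ ((2 * b) `^ p)).
  by apply: ge0_ler_powR; rewrite ?nnegrE ?addr_ge0 ?mulr_ge0//; lra.
by rewrite powRM// ler_wpM2l ?powR_ge0// lerDr powR_ge0.
Qed.

Lemma powRVD_le a b p : 0 <= a -> 0 <= b -> 1 <= p ->
  (a + b) `^ p^-1 <= 2 * (a `^ p^-1 + b `^ p^-1).
Proof.
move=> a0 b0 p1; have p0 : 0 <= p^-1 by rewrite invr_ge0; lra.
apply: le_trans (powRD_le a0 b0 p0) _.
rewrite ler_wpM2r ?addr_ge0 ?powR_ge0// -[leRHS]powRr1//.
by rewrite ler_powR ?ler1n// invf_le1 ?(lt_le_trans _ p1).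
Qed.

Lemma powR_invK a p : 0 <= a -> p != 0 -> (a `^ p^-1) `^ p = a.
Proof. by move=> a0 p0; rewrite -powRrM mulVf// powRr1. Qed.

Lemma powRK_inv a p : 0 <= a -> p != 0 -> (a `^ p) `^ p^-1 = a.
Proof. by move=> a0 p0; rewrite -powRrM mulfV// powRr1. Qed.

End real_powers.

Lemma ge0_fin_ex (R : realType) (x : \bar R) : (0 <= x)%E -> (x < +oo)%E ->
  exists2 a : R, 0 <= a & x = a%:E.
Proof. by case: x => // a a0 _; exists a. Qed.

Section averages.
Context d (T : measurableType d) {R : realType}.

Lemma fubini_average (mu : {sigma_finite_measure set T -> \bar R})
    (A : set (T * T)) (v : T -> R) (K : R) :
  measurable A -> measurable_fun setT v -> (forall x, 0 <= v x) -> 0 <= K ->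
  (forall y, (mu [set x | A (x, y)] <= K%:E)%E) ->
  measurable_fun setT (fun x => \int[mu]_y (v y * \1_A (x, y))%:E)%E /\
  (\int[mu]_x \int[mu]_y (v y * \1_A (x, y))%:E <= K%:E * \int[mu]_y (v y)%:E)%E.
Proof.
move=> mA mv v0 K0 muK.
pose f (z : T * T) : \bar R := (v z.2 * \1_A z)%:E.
have mf : measurable_fun setT f.
  apply/measurable_EFinP; apply: measurable_funM; last exact: measurable_indic.
  exact: (measurableT_comp mv measurable_snd).
have f0 z : (0 <= f z)%E by rewrite lee_fin mulr_ge0// indicE.
have mF := @measurable_fun_fubini_tonelli_F _ _ T T R mu f mf f0.
split; first exact: mF.
have := @fubini_tonelli1 _ _ T T R mu mu f mf f0; have := @fubini_tonelli2 _ _ T T R mu mu f mf f0.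
rewrite /fubini_F /fubini_G => -> <-.
rewrite -ge0_intZ//; apply: ge0_le_integral => //.
- by move=> y _; apply: integral_ge0 => x _; exact: f0.
- exact: (@measurable_fun_fubini_tonelli_G _ _ T T R mu f mf f0).
- by apply/measurable_EFinP; exact: measurable_funM.
move=> y _; rewrite /f /=.
have mAy : measurable [set x | A (x, y)].
  by have := measurable_ysection y mA; rewrite ysectionE.
have -> : (fun x => (v y * \1_A (x, y))%:E) = (fun x => (v y * \1_[set x | A (x, y)] x)%:E).
  by apply/funext => x; rewrite !indicE; congr (_ * _%:R)%:E; apply/idP/idP; rewrite !inE.
rewrite ge0_intZ//.
rewrite integral_indic// setIT mulrC EFinM; apply: lee_wpmul2l; first by rewrite lee_fin.
exact: muK.
Qed.

Lemma cst_le_int_set (mu : {measure set T -> \bar R}) (Q : set T) (u : T -> R) (a k B V : R) :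
  measurable Q -> mu Q = V%:E -> measurable_fun setT u -> (forall z, 0 <= u z) ->
  0 <= a -> 0 <= k -> 0 <= B -> (forall z, Q z -> a <= k * (u z + B)) ->
  ((V * a)%:E <= k%:E * \int[mu]_(z in Q) (u z)%:E + (k * (B * V))%:E)%E.
Proof.
move=> mQ QV mu_ u0 a0 k0 B0 h.
have V0 : 0 <= V by rewrite -lee_fin -QV.
have muB : measurable_fun setT (fun z => u z + B) by exact: measurable_funD.
have := @le_int_set _ _ _ mu Q (fun=> a) (fun z => k * (u z + B)) mQ (measurable_cst _).
move=> /(_ (measurable_funM (measurable_cst _) muB) (fun=> a0) h).
rewrite integral_cst// QV -EFinM mulrC => /le_trans; apply.
rewrite ge0_int_setZ//; last by move=> z; rewrite addr_ge0.
rewrite ge0_int_setD// integral_cst// QV ge0_muleDr//.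
- by apply: integral_ge0 => z _; rewrite lee_fin.
- by rewrite -EFinM lee_fin mulr_ge0.
Qed.

Lemma average_bound (mu : {measure set T -> \bar R}) (w : T -> R) (f g : T -> \bar R)
    (c k1 k2 : R) :
  measurable_fun setT w -> measurable_fun setT f -> measurable_fun setT g ->
  (forall x, 0 <= w x) -> (forall x, 0 <= f x)%E -> (forall x, 0 <= g x)%E ->
  0 <= c -> 0 <= k1 -> 0 <= k2 ->
  (forall x, (c * w x)%:E <= k1%:E * f x + k2%:E * g x)%E ->
  (c%:E * \int[mu]_x (w x)%:E <= k1%:E * \int[mu]_x f x + k2%:E * \int[mu]_x g x)%E.
Proof.
move=> mw mf mg w0 f0 g0 c0 k10 k20 h.
rewrite -ge0_intZ// -(ge0_integralZl_EFin _ _ _ mf k10)// -(ge0_integralZl_EFin _ _ _ mg k20)//.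
rewrite -ge0_integralD//.
- apply: ge0_le_integral => //.
  + by move=> x _; rewrite lee_fin mulr_ge0.
  + by apply/measurable_EFinP; exact: measurable_funM.
  + by apply: emeasurable_funD; exact: measurable_funeM.
- by move=> x _; rewrite mule_ge0.
- exact: measurable_funeM.
- by move=> x _; rewrite mule_ge0.
- exact: measurable_funeM.
Qed.

Lemma intp_powR (mu : {measure set T -> \bar R}) (u : T -> R) (p q : R) : q != 0 ->
  intp mu (p / q) (fun z => `|u z| `^ q) = intp mu p u.
Proof.
move=> q0; apply: eq_integral => z _.
by rewrite ger0_norm ?powR_ge0// -powRrM mulrC divfK.
Qed.

Lemma intp_le_sum (mu : {measure set T -> \bar R}) (I : Type) (s : seq I) (u : I -> T -> R)
    (v : T -> R) p : measurable_fun setT v -> (forall i, measurable_fun setT (u i)) ->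
  (forall x, `|v x| `^ p <= \sum_(i <- s) `|u i x| `^ p) ->
  (intp mu p v <= \sum_(i <- s) intp mu p (u i))%E.
Proof.
move=> mv mu_ vu.
have mup i : measurable_fun setT (fun x => `|u i x| `^ p).
  by apply: measurable_powR_fun; exact: measurable_normr_fun.
rewrite /intp -ge0_integral_sum//.
- apply: ge0_le_integral => //.
  + by apply/measurable_EFinP/measurable_powR_fun; exact: measurable_normr_fun.
  + by apply: emeasurable_sum => i; exact/measurable_EFinP.
  + by move=> x _; rewrite sumEFin lee_fin.
- by move=> i; exact/measurable_EFinP.
Qed.

End averages.

Section cube_average.
Context {R : realType} {n : nat}.
Local Notation mu := (@lebesgue R n).

Lemma measurable_rV_norm (G : @lebesgue_rV R n -> 'rV[R]_n) :
  (forall i, measurable_fun setT (fun z : @lebesgue_rV R n => G z ord0 i : R)) ->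
  measurable_fun setT (fun z : @lebesgue_rV R n => `|G z| : R).
Proof.
move=> mG; have mn : measurable_fun setT (fun x : 'rV[R]_n => `|x| : R).
  by apply: measurable_rV_continuous; exact: norm_continuous.
by apply: (measurableT_comp mn); exact: measurable_fun_rVP.
Qed.

Lemma measurable_near_pairs (r : R) : 0 <= r ->
  measurable [set z : lebesgue_rV n * lebesgue_rV n | cube z.1 r z.2].
Proof.
move=> r0; have -> : [set z : lebesgue_rV n * lebesgue_rV n | cube z.1 r z.2] =
    [set: lebesgue_rV n * lebesgue_rV n] `&`
      (fun z => `|(z.2 : 'rV[R]_n) - z.1| : R) @^-1` `]-oo, r]%classic.
  by rewrite setTI; apply/seteqP; split => z /=; rewrite (cubeE _ r0) in_itv.
have mn : measurable_fun setT (fun x : 'rV[R]_n => `|x| : R).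
  by apply: measurable_rV_continuous; exact: norm_continuous.
have md : measurable_fun setT (fun z : lebesgue_rV n * lebesgue_rV n => (z.2 : 'rV[R]_n)
    - z.1 : 'rV[R]_n).
  apply: measurable_fun_rVP => i.
  have mi : measurable_fun setT (fun z : lebesgue_rV n => (z : 'rV[R]_n) ord0 i).
    by apply: (measurable_fun_lebesgue (F := rV_coord i)); exact: measurable_rV_coord.
  rewrite (_ : _ \o _ = (fun z : lebesgue_rV n * lebesgue_rV n =>
     (z.2 : 'rV[R]_n) ord0 i - (z.1 : 'rV[R]_n) ord0 i)).
    apply: measurable_funB.
      exact: (measurableT_comp mi measurable_snd).
    exact: (measurableT_comp mi measurable_fst).
  by apply/funext => z; rewrite /= /rV_coord !mxE.
apply: (measurableT_comp mn md) => //; exact: measurable_itv.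
Qed.

(** Tonelli: since |x - y| <= r is symmetric, each y is counted by a set of x of measure (2 r)^n. *)
Lemma cube_average (r : R) (v : lebesgue_rV n -> R) : 0 <= r ->
  measurable_fun setT v -> (forall x, 0 <= v x) ->
  measurable_fun setT (fun x : lebesgue_rV n => \int[mu]_(y in cube x r) (v y)%:E)%E /\
  (\int[mu]_x \int[mu]_(y in cube x r) (v y)%:E <= ((2 * r) ^+ n)%:E * \int[mu]_y (v y)%:E)%E.
Proof.
move=> r0 mv v0.
have rn0 : 0 <= (2 * r) ^+ n by rewrite exprn_ge0// mulr_ge0.
have mA := measurable_near_pairs r0.
have hA y : (lebesgue_sf R n [set x | [set z : lebesgue_rV n * lebesgue_rV n | cube z.1 r z.2] (x,
    y)] <= ((2 * r) ^+ n)%:E)%E.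
  rewrite (_ : [set x | _] = cube y r); first by rewrite [leLHS]lebesgue_cube.
  by apply/seteqP; split => x /=; rewrite !(cubeE _ r0)/= distrC.
have := @fubini_average _ _ R (lebesgue_sf R n) _ v _ mA mv v0 rn0 hA.
rewrite (_ : (fun x => _) = (fun x : lebesgue_rV n => \int[mu]_(y in cube x r) (v y)%:E)%E)//.
apply/funext => x; rewrite [in RHS]integral_setI_ge0; last exact: measurable_cube.
apply: eq_integral => y _; rewrite !indicE; congr (_ * _%:R)%:E.
Qed.

End cube_average.

Section necessity.
Context {R : realType} {n : nat} (p : R).
Hypotheses (n0 : (0 < n)%N) (np : n%:R < p).
Local Notation mu := (@lebesgue R n).

Let p1 : 1 < p. Proof. by apply: le_lt_trans np; rewrite ler1n. Qed.
Let p0 : 0 < p. Proof. exact: lt_trans p1. Qed.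

(** The diameter is reached at two opposite corners; reading their distance off a coordinate takes n
    > 0. *)
Lemma diam_cube (c : 'rV[R]_n) r : 0 < r -> diam (cube c r) = 2 * r.
Proof.
move=> r0; have hr := ltW r0.
have sup_ub z : ([set `|z.1 - z.2| | z in cube c r `*` cube c r] : set R) z -> z <= 2 * r.
  move=> [[x y] [/= ]]; rewrite !(cubeE _ hr)/= => xc yc <-.
  by rewrite (le_trans (ler_distD c _ _))// mulr_natl mulr2n lerD// distrC.
apply/eqP; rewrite eq_le; apply/andP; split.
  apply: ge_sup => //.
  by exists `|c - c|, (c, c) => //; split; rewrite (cubeE _ hr)/= subrr normr0.
have pt : [set `|z.1 - z.2| | z in cube c r `*` cube c r]
    `|(c + const_mx r) - (c - const_mx r)|.
  exists (c + const_mx r, c - const_mx r) => //.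
  by split; rewrite (cubeE _ hr)/= addrAC subrr add0r ?normrN;
    apply/(rV_norm_le _ hr) => i; rewrite mxE gtr0_norm.
apply: le_trans (sup_ubound _ pt); last by exists (2 * r) => z; exact: sup_ub.
apply: le_trans (rV_coord_le _ (Ordinal n0)); rewrite !mxE.
by apply: le_trans (ler_norm _); lra.
Qed.

Lemma intp_norm_le_sum (G : 'rV[R]_n -> 'rV[R]_n) :
  (forall i, (fun x => G x ord0 i) \in Lfun mu p%:E) ->
  (intp mu p (fun z => `|G z|%R) <= \sum_(i < n) intp mu p (fun z => G z ord0 i))%E.
Proof.
move=> LG.
have mG i : measurable_fun setT (fun z : @lebesgue_rV R n => G z ord0 i : R).
  by have [] := (Lfun_intp mu _ p0).1 (LG i).
have mGn := measurable_rV_norm mG.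
apply: (intp_le_sum (s := index_enum 'I_n) mu mGn mG) => z; rewrite normr_id.
have s0 : 0 <= \sum_(i < n) `|G z ord0 i| `^ p by rewrite sumr_ge0// => i _; exact: powR_ge0.
have : `|G z| <= (\sum_(i < n) `|G z ord0 i| `^ p) `^ p^-1.
  apply/rV_norm_le => [|i]; first exact: powR_ge0.
  rewrite -[leLHS](@powRK_inv _ _ p) ?gt_eqF//.
  apply: ge0_ler_powR; rewrite ?nnegrE ?powR_ge0 ?invr_ge0 ?(ltW p0)//.
  by rewrite (bigD1 i)//= lerDl sumr_ge0// => j _; exact: powR_ge0.
move=> h; rewrite -[leRHS](@powR_invK _ _ p) ?gt_eqF//.
by apply: ge0_ler_powR; rewrite ?nnegrE ?powR_ge0 ?(ltW p0).
Qed.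

Lemma intp_norm_lt_pinfty (G : 'rV[R]_n -> 'rV[R]_n) :
  (forall i, (fun x => G x ord0 i) \in Lfun mu p%:E) ->
  measurable_fun setT (fun z : @lebesgue_rV R n => `|G z| : R) /\
  (intp mu p (fun z => `|G z|%R) < +oo)%E.
Proof.
move=> LG.
have mG i : measurable_fun setT (fun z : @lebesgue_rV R n => G z ord0 i : R).
  by have [] := (Lfun_intp mu _ p0).1 (LG i).
split; first exact: measurable_rV_norm.
apply: le_lt_trans (intp_norm_le_sum LG) _.
by rewrite lte_sum_pinfty// => i _; have [] := (Lfun_intp mu _ p0).1 (LG i).
Qed.

Lemma int_powR_cube_fin (u : @lebesgue_rV R n -> R) (q : R) c r : 0 <= r -> 0 < q -> q <= p ->
  measurable_fun setT u -> (intp mu p u < +oo)%E ->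
  (\int[mu]_(z in cube c r) (`|u z| `^ q)%:E < +oo)%E.
Proof.
move=> r0 q0 qp mu_ uoo.
have mQ : measurable (cube c r : set (lebesgue_rV n)) by exact: measurable_cube.
have muq : measurable_fun setT (fun z => `|u z| `^ q).
  by apply: measurable_powR_fun; exact: measurable_normr_fun.
have := @int_lt_pinfty _ _ _ mu _ (fun z => `|u z| `^ q) (p / q) mQ _ muq _ _.
rewrite (eq_integral (fun z => (`|u z| `^ q)%:E)); last first.
  by move=> z _; rewrite ger0_norm// powR_ge0.
apply.
- by rewrite lebesgue_cube// ltry.
- by rewrite ler_pdivlMr// mul1r.
by rewrite intp_powR// gt_eqF.
Qed.

(** Let a be r^-n times the integral of |G|^q over the dilated cube. Morrey's inequality bounds the
    increment by C eta r a^(1/q); its p-th power divided by (2 r)^(p - n) is at most a multiple of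
    r^n a^(p/q), and [maximal_sum] bounds the sum of these. *)
Theorem cube_sums_le (eta : R) : 1 <= eta -> exists2 K : R, 0 < K &
  forall (F : 'rV[R]_n -> R) (G : 'rV[R]_n -> 'rV[R]_n),
  F \in Lfun mu p%:E -> (forall i, (fun x => G x ord0 i) \in Lfun mu p%:E) ->
  weak_gradient F G -> continuous F ->
  forall (m : nat) (c : 'I_m -> 'rV[R]_n) (r : 'I_m -> R) (x y : 'I_m -> 'rV[R]_n),
  (forall i, 0 < r i) -> trivIset setT (fun i => cube (c i) (r i)) ->
  (forall i, cube (c i) (eta * r i) (x i)) -> (forall i, cube (c i) (eta * r i) (y i)) ->
  \sum_(i < m) `|F (x i) - F (y i)| `^ p / diam (cube (c i) (r i)) `^ (p - n%:R) <=
  K * fine (intp mu p (fun z => `|G z|%R)).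
Proof.
move=> eta1; have eta0 : 0 < eta by exact: lt_le_trans eta1.
(* The midpoint satisfies q > n, for Morrey's inequality, and q < p, so that s > 1 in the maximal
   inequality. *)
pose q := (n%:R + p) / 2; pose s := p / q.
have n1 : 1 <= n%:R :> R by rewrite ler1n.
have [nq qp q1] : [/\ n%:R < q, q < p & 1 <= q].
  by move: np n1; rewrite /q; move: (n%:R : R) => N; split; lra.
have q0 : 0 < q by lra.
have s1 : 1 < s by rewrite ltr_pdivlMr// mul1r.
have [C C0 hC] := morrey (R := R) q1 nq.
have [C' C'0 hC'] := @maximal_sum R n eta s eta1 s1.
exists ((C * eta) `^ p * C'); first by rewrite mulr_gt0 ?powR_gt0// mulr_gt0.
move=> F G LF LG wG cF m c r x y r0 tr xc yc.
have [mGn Goo] := intp_norm_lt_pinfty LG.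
pose u z := `|G z| `^ q.
have mu_ : measurable_fun setT (u : lebesgue_rV n -> R).
  by apply: measurable_powR_fun.
have u0 z : 0 <= u z by exact: powR_ge0.
have er0 i : 0 < eta * r i by rewrite mulr_gt0.
have fin_i i : exists I, 0 <= I /\ (\int[mu]_(z in cube (c i) (eta * r i)) (u z)%:E)%E = I%:E.
  have [||I I0 IE] := @ge0_fin_ex R (\int[mu]_(z in cube (c i) (eta * r i)) (u z)%:E).
  - by apply: integral_ge0 => z _; rewrite lee_fin.
  - have := @int_powR_cube_fin _ q (c i) _ (ltW (er0 i)) q0 (ltW qp) mGn Goo.
    by under eq_integral do rewrite normr_id.
  - by exists I.
have [I /all_and2[I0 Ifin]] := choice fin_i.
pose a i := I i / r i ^+ n.
have rn0 i : 0 < r i ^+ n by rewrite exprn_gt0.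
have a0 i : 0 <= a i by rewrite divr_ge0// ltW.
have := hC' u m c r a mu_ u0 r0 tr a0.
have -> : (\int[mu]_z (u z `^ s)%:E = intp mu p (fun z => `|G z|%R))%E.
  by apply: eq_integral => z _; rewrite normr_id -powRrM mulrC divfK// gt_eqF.
have -> : intp mu p (fun z => `|G z|%R) = (fine (intp mu p (fun z => `|G z|%R)))%:E.
  by rewrite fineK// ge0_fin_numE// intp_ge0.
move=> /(_ _)/wrap[]; first by move=> i; rewrite Ifin lee_fin divfK// gt_eqF.
rewrite -EFinM lee_fin /= => hs.
rewrite -mulrA; apply: le_trans (ler_wpM2l (powR_ge0 _ _) hs).
rewrite mulr_sumr; apply: ler_sum => i _.
have osc : `|F (x i) - F (y i)| <= C * (eta * r i) * a i `^ q^-1.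
  apply: (hC p F G (c i)) => //; first exact: ltW.
    by exact: powR_ge0.
  move=> j; rewrite powR_invK ?gt_eqF//.
  apply: (@le_trans _ _ (I i)%:E).
    rewrite -Ifin; apply: (le_int_set mu).
    - exact: measurable_cube.
    - have [mGj _] := (Lfun_intp mu _ p0).1 (LG j).
      by apply: measurable_powR_fun; exact: measurable_normr_fun.
    - exact: mu_.
    - by move=> z; exact: powR_ge0.
    - move=> z _; apply: ge0_ler_powR; rewrite ?nnegrE// ?(ltW q0)//.
      exact: rV_coord_le.
  rewrite lee_fin (_ : a i * _ = eta ^+ n * I i); last first.
    by rewrite /a exprMn; field; rewrite gt_eqF.
  by rewrite ler_peMl// exprn_ege1.
have d0 : 0 < diam (cube (c i) (r i)) `^ (p - n%:R).
  rewrite diam_cube// powR_gt0// mulr_gt0//.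
rewrite ler_pdivrMr//.
apply: (@le_trans _ _ ((C * (eta * r i) * a i `^ q^-1) `^ p)).
  by apply: ge0_ler_powR; rewrite ?nnegrE ?(ltW p0)// !mulr_ge0 ?powR_ge0// ltW.
rewrite mulrA powRM ?powR_ge0 ?mulr_ge0 ?(ltW (r0 i)) ?(ltW C0) ?(ltW eta0)//.
rewrite powRM ?mulr_ge0 ?(ltW (r0 i)) ?(ltW C0) ?(ltW eta0)//.
rewrite -powRrM [q^-1 * _]mulrC -/s -!mulrA ler_wpM2l ?powR_ge0//.
rewrite [leLHS]mulrC [leRHS]mulrCA ler_wpM2l ?powR_ge0// diam_cube//.
rewrite (_ : r i `^ p = r i ^+ n * r i `^ (p - n%:R)); last first.
  by rewrite -powR_mulrn ?(ltW (r0 i))// -powRD_gt0// addrC subrK.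
rewrite ler_wpM2l ?(ltW (rn0 i))//.
apply: ge0_ler_powR; rewrite ?nnegrE ?subr_ge0 ?(ltW np)// ?mulr_ge0// ltW//.
by rewrite ltr_pMl// ltr1n.
Qed.

(** T may collapse sets of positive measure, so no change of variables is available. Only the bound
    on |T x - x| enters: F (T x) is compared with F z for every z in [cube x rho], and the mean over
    z is integrated in x with [cube_average]. *)
Theorem intp_retraction_le (rho : R) : 0 < rho -> exists2 K : R, 0 < K &
  forall (F : 'rV[R]_n -> R) (G : 'rV[R]_n -> 'rV[R]_n) (D : set (@lebesgue_rV R n))
    (T : @lebesgue_rV R n -> 'rV[R]_n),
  F \in Lfun mu p%:E -> (forall i, (fun x => G x ord0 i) \in Lfun mu p%:E) ->
  weak_gradient F G -> continuous F ->
  measurable D -> measurable_fun D T -> (forall x, D x -> `|T x - x| <= rho) ->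
  measurable_fun setT ((F \o T) \_ D) /\
  (intp mu p ((F \o T) \_ D) <= K%:E * (intp mu p F + intp mu p (fun z => `|G z|%R)))%E.
Proof.
move=> rho0; have hrho := ltW rho0.
have [C C0 hC] := morrey (R := R) (ltW p1) np.
pose V := (2 * rho) ^+ n; have V0 : 0 < V by rewrite exprn_gt0// mulr_gt0.
pose k2 := 2 `^ p * ((C * rho) `^ p * 2 ^+ n).
have k20 : 0 < k2 by rewrite !mulr_gt0 ?powR_gt0 ?exprn_gt0// mulr_gt0.
have k10 : 0 < 2 `^ p :> R by rewrite powR_gt0.
exists (2 `^ p + k2); first by rewrite addr_gt0.
move=> F G D T LF LG wG cF mD mT hT.
have [mF Foo] := (Lfun_intp mu _ p0).1 LF.
have [mGn Goo] := intp_norm_lt_pinfty LG.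
have mFT : measurable_fun setT ((F \o T) \_ D).
  apply/(measurable_restrictT _ mD); apply: (measurable_comp measurableT) mT => //.
  exact: measurable_rV_continuous.
split => //.
have mFp : measurable_fun setT (fun z : lebesgue_rV n => `|F z| `^ p).
  by apply: measurable_powR_fun; exact: measurable_normr_fun.
have mGp : measurable_fun setT (fun z : lebesgue_rV n => `|G z| `^ p).
  exact: measurable_powR_fun.
have [mavF avF] := cube_average hrho mFp (fun z => powR_ge0 _ _).
have [mavG avG] := cube_average hrho mGp (fun z => powR_ge0 _ _).
pose w (x : lebesgue_rV n) := `|((F \o T) \_ D) x| `^ p.
have mw : measurable_fun setT w by apply: measurable_powR_fun; exact: measurable_normr_fun.
have av0 (h : lebesgue_rV n -> R) x : (forall z, 0 <= h z) -> (0 <= \int[mu]_(z in cube x rho)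
    (h z)%:E)%E.
  by move=> h0; apply: integral_ge0 => z _; rewrite lee_fin.
have hw x : ((V * w x)%:E <= (2 `^ p)%:E * \int[mu]_(z in cube x rho) (`|F z| `^ p)%:E +
    k2%:E * \int[mu]_(z in cube x rho) (`|G z| `^ p)%:E)%E.
  have avF0 := av0 _ x (fun z => powR_ge0 `|F z| p).
  have avG0 := av0 _ x (fun z => powR_ge0 `|G z| p).
  have [Dx|Dx] := pselect (D x); last first.
    rewrite /w patchE memNset// normr0 powR0 ?gt_eqF// mulr0.
    have k1' : (0 <= (2 `^ p)%:E :> \bar R)%E by rewrite lee_fin ltW.
    have k2' : (0 <= k2%:E)%E by rewrite lee_fin ltW.
    exact: (adde_ge0 (mule_ge0 k1' avF0) (mule_ge0 k2' avG0)).
  rewrite /w patchE mem_set//=.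
  have avGoo : (\int[mu]_(z in cube x rho) (`|G z| `^ p)%:E < +oo)%E.
    have := @int_powR_cube_fin _ p x _ hrho p0 (lexx p) mGn Goo.
    by under eq_integral do rewrite normr_id.
  have [I I0 IE] := ge0_fin_ex avG0 avGoo.
  pose A := (I / rho ^+ n) `^ p^-1.
  have rn0 : 0 < rho ^+ n by rewrite exprn_gt0.
  have pt z : cube x rho z -> `|F (T x)| `^ p <= 2 `^ p * (`|F z| `^ p + (C * rho * A) `^ p).
    move=> zx; apply: le_trans (powRD_le (normr_ge0 _) _ (ltW p0)); last first.
      by rewrite !mulr_ge0 ?powR_ge0// ltW.
    apply: ge0_ler_powR; rewrite ?nnegrE ?addr_ge0 ?(ltW p0)//.
      by rewrite !mulr_ge0 ?powR_ge0// ltW.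
    rewrite -[X in `|X|](subrK (F z)) addrC (le_trans (ler_normD _ _))// lerD2l.
    apply: (hC p F G x) => //; [exact: ltW|exact: powR_ge0| |by rewrite (cubeE _ hrho)/=;
        exact: hT].
    move=> j; rewrite powR_invK ?gt_eqF ?divr_ge0 ?(ltW rn0)// divfK ?gt_eqF// -IE.
    apply: (le_int_set mu).
    - exact: measurable_cube.
    - have [mGj _] := (Lfun_intp mu _ p0).1 (LG j).
      by apply: measurable_powR_fun; exact: measurable_normr_fun.
    - exact: mGp.
    - by move=> z'; exact: powR_ge0.
    - move=> z' _; apply: ge0_ler_powR; rewrite ?nnegrE// ?(ltW p0)//.
      exact: rV_coord_le.
  have B0 : 0 <= (C * rho * A) `^ p by exact: powR_ge0.
  have mQ : measurable (cube x rho : set (lebesgue_rV n)) by exact: measurable_cube.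
  have := cst_le_int_set mQ (lebesgue_cube x hrho) mFp (fun z => powR_ge0 _ _)
    (powR_ge0 _ _) (ltW k10) B0 pt.
  move=> /le_trans; apply; rewrite IE leeD2l// -EFinM lee_fin /k2 -[leRHS]mulrA.
  apply: ler_wpM2l; first exact: ltW.
  rewrite /A powRM ?powR_ge0 ?mulr_ge0 ?(ltW C0)// powR_invK ?gt_eqF ?divr_ge0 ?(ltW rn0)//.
  rewrite exprMn -[leLHS]mulrA -[leRHS]mulrA; apply: ler_wpM2l; first exact: powR_ge0.
  by rewrite (_ : I / _ * _ = 2 ^+ n * I)//; field; rewrite gt_eqF.
have := average_bound mu mw mavF mavG (fun x => powR_ge0 _ _)
    (fun x => av0 _ x (fun z => powR_ge0 _ _))
  (fun x => av0 _ x (fun z => powR_ge0 _ _)) (ltW V0) (ltW k10) (ltW k20) hw.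
have -> : intp mu p (fun z => `|G z|) = (\int[mu]_z (`|G z| `^ p)%:E)%E.
  by apply: eq_integral => z _; rewrite normr_id.
rewrite -/(intp mu p F).
move=> h; rewrite -(@lee_pmul2l _ V%:E)// ?lte_fin//; apply: (le_trans h).
have [a a0 IF] := ge0_fin_ex (intp_ge0 mu p F) Foo.
have [b b0 IG] : exists2 b, 0 <= b & (\int[mu]_z (`|G z| `^ p)%:E)%E = b%:E.
  apply: ge0_fin_ex; first by apply: integral_ge0 => z _; rewrite lee_fin powR_ge0.
  by move: Goo; rewrite /intp; under eq_integral do rewrite normr_id.
move: avF avG; rewrite -/(intp mu p F) IF IG => avF avG.
apply: (@le_trans _ _ ((2 `^ p)%:E * (V * a)%:E + k2%:E * (V * b)%:E)%E).
  by apply: leeD; apply: lee_wpmul2l => //; rewrite lee_fin ltW.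
rewrite -[leLHS]/((2 `^ p * (V * a) + k2 * (V * b))%:E).
rewrite -[leRHS]/((V * ((2 `^ p + k2) * (a + b)))%:E) lee_fin.
have := mulr_ge0 (ltW V0) (mulr_ge0 (ltW k10) b0).
have := mulr_ge0 (ltW V0) (mulr_ge0 (ltW k20) a0).
by move: (2 `^ p) => P; lra.
Qed.

End necessity.

(** * Weak limits *)

(** One ultrafilter makes all bounded real sequences converge, so the limits for all multipliers
    exist at once, without diagonal extraction. *)
Lemma ultra_cvg_bounded (R : realType) (U : set_system nat) (a : nat -> R) (C : R) :
  UltraFilter U -> (forall k, `|a k| <= C) -> exists l : R, a @ U --> l.
Proof.
move=> UU aC.
have [|l [_ cl]] := @segment_compact R (- C) C (a @ U) _.
  by apply: (@filterS _ U _ setT) => [k _|]; [rewrite /= in_itv/= -ler_norml|exact: filterT].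
exists l => A Al.
have [//|UA] := in_ultra_setVsetC (a @^-1` A) UU.
have UA' : (a @ U) (~` A) by exact: UA.
by have [y [/= nAy Ay]] := cl _ _ UA' Al.
Qed.

Section bounded_multipliers.
Context d (T : measurableType d) {R : realType} (mu : {measure set T -> \bar R}).
Implicit Types (g v h : T -> R) (A : set T) (C : R).

Local Notation Int f := (\int[mu]_x f x).

Definition bounded_mfun v (C : R) := measurable_fun setT v /\ forall x, `|v x| <= C.

Lemma bounded_mfun_indic A : measurable A -> bounded_mfun (\1_A) 1.
Proof.
move=> mA; split; first exact: measurable_indic.
by move=> x; rewrite indicE; case: (_ \in _); rewrite ?normr1 ?normr0.
Qed.

Lemma int_mul_bounded g v C : mu.-integrable setT (EFin \o g) -> bounded_mfun v C ->
  mu.-integrable setT (EFin \o (fun x => g x * v x)) /\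
  `|Int (fun x => g x * v x)| <= C * Int (fun x => `|g x|).
Proof.
move=> ig [mv vC]; have ign := integrable_norm ig.
have /measurable_EFinP mg : measurable_fun setT (EFin \o g) by case/integrableP: ig.
have E : (\int[mu]_x `|g x|%:E = (Int (fun x => `|g x|))%:E)%E.
  by rewrite fineK//; exact: integrable_fin_num ign.
have [||h1 h2] := @integrable_supp _ _ _ mu g v setT C measurableT mg mv vC.
- by move=> x [].
- by rewrite E ltry.
by split => //; rewrite -lee_fin EFinM -E.
Qed.

Lemma int_mulD g v1 v2 C1 C2 : mu.-integrable setT (EFin \o g) ->
  bounded_mfun v1 C1 -> bounded_mfun v2 C2 ->
  Int (fun x => g x * (v1 x + v2 x)) = Int (fun x => g x * v1 x) + Int (fun x => g x * v2 x).
Proof.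
move=> ig b1 b2; have [i1 _] := int_mul_bounded ig b1; have [i2 _] := int_mul_bounded ig b2.
by rewrite -RintegralD//; apply: eq_Rintegral => x _; rewrite mulrDr.
Qed.

Lemma int_mulZ g v c C : mu.-integrable setT (EFin \o g) -> bounded_mfun v C ->
  Int (fun x => g x * (c * v x)) = c * Int (fun x => g x * v x).
Proof.
move=> ig b; have [i _] := int_mul_bounded ig b.
by rewrite -RintegralZl//; apply: eq_Rintegral => x _; rewrite mulrCA.
Qed.

Lemma int_mul_indic g A : measurable A -> mu.-integrable setT (EFin \o g) ->
  (\int[mu]_(x in A) (g x)%:E)%E = (Int (fun x => g x * \1_A x))%:E.
Proof.
move=> mA ig; have [i _] := int_mul_bounded ig (bounded_mfun_indic mA).
rewrite fineK; last exact: integrable_fin_num i.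
exact: integral_setI_ge0.
Qed.

Lemma bounded_mfunD v1 v2 C1 C2 : bounded_mfun v1 C1 -> bounded_mfun v2 C2 ->
  bounded_mfun (fun x => v1 x + v2 x) (C1 + C2).
Proof.
move=> [m1 h1] [m2 h2]; split; first exact: measurable_funD.
by move=> x; rewrite (le_trans (ler_normD _ _))// lerD.
Qed.

Lemma bounded_mfunZ v c C : bounded_mfun v C -> bounded_mfun (fun x => c * v x) (`|c| * C).
Proof.
move=> [m h]; split; first by apply: measurable_funM => //; exact: measurable_cst.
by move=> x; rewrite normrM ler_wpM2l.
Qed.

(* Layer-cake approximation from below: k^-1 * floor (k v). *)
Definition staircase v k N x : R :=
  \sum_(j < N) k.+1%:R^-1 * \1_[set x | j.+1%:R <= k.+1%:R * v x] x.

Lemma measurable_level v (c e : R) : measurable_fun setT v -> measurable [set x | c <= e * v x].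
Proof.
move=> mv; have mev : measurable_fun setT (fun x => e * v x).
  by apply: measurable_funM => //; exact: measurable_cst.
rewrite (_ : mkset _ = [set: T] `&` (fun x => e * v x) @^-1` `[c, +oo[%classic).
  by apply: mev => //; exact: measurable_itv.
by rewrite setTI; apply/seteqP; split => x /=; rewrite in_itv/= andbT.
Qed.

Lemma staircase_close v k N x : 0 <= v x -> v x <= N%:R / k.+1%:R ->
  `|v x - staircase v k N x| <= k.+1%:R^-1.
Proof.
move=> v0 vN; have k0 : 0 < k.+1%:R :> R by [].
set y := k.+1%:R * v x.
have y0 : 0 <= y by rewrite mulr_ge0.
have yN : y <= N%:R by rewrite /y mulrC -ler_pdivlMr.
have -> : staircase v k N x = k.+1%:R^-1 * (Num.truncn y)%:R.
  rewrite /staircase -mulr_sumr; congr (_ * _).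
  transitivity (\sum_(j < N) (if (j < Num.truncn y)%N then 1 else 0) : R).
    apply: eq_bigr => j _; rewrite indicE -/y.
    have e : (j.+1%:R <= y) = (j < Num.truncn y)%N by rewrite truncn_ge_nat.
    case: ifP => jy; first by rewrite mem_set//= -/y e.
    by rewrite memNset//= -/y e jy.
  rewrite -big_mkcond/= -(big_mkord (fun j => (j < Num.truncn y)%N) (fun=> 1)).
  have tN : (Num.truncn y <= N)%N by rewrite -(ler_nat R) (le_trans _ yN)// truncn_le.
  transitivity (\sum_(0 <= i < Num.truncn y) 1 : R).
    by rewrite [RHS](big_nat_widen _ _ _ _ _ tN).
  by rewrite big_const_nat iter_addr_0 subn0.
have -> : v x = k.+1%:R^-1 * y by rewrite /y mulrA mulVf ?mul1r ?gt_eqF.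
rewrite -mulrBr normrM gtr0_norm ?invr_gt0// ler_piMr ?invr_ge0//.
have /andP[h1 h2] := truncn_itv y0.
by rewrite ger0_norm ?subr_ge0// lerBlDr -natr1 in h2 *; rewrite addrC ltW.
Qed.

Lemma staircase_bounded v k N : measurable_fun setT v ->
  exists C, bounded_mfun (staircase v k N) C.
Proof.
move=> mv; elim: N => [|N [C hC]].
  exists 0; rewrite /staircase; split.
    rewrite (_ : (fun x => _) = cst 0); first exact: measurable_cst.
    by apply/funext => x; rewrite big_ord0.
  by move=> x; rewrite big_ord0 normr0.
exists (C + `|k.+1%:R^-1| * 1).
rewrite (_ : staircase v k N.+1 = fun x => staircase v k N x +
    k.+1%:R^-1 * \1_[set x | N.+1%:R <= k.+1%:R * v x] x).
  by apply: bounded_mfunD hC _; apply/bounded_mfunZ/bounded_mfun_indic/measurable_level.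
by apply/funext => x; rewrite /staircase big_ord_recr.
Qed.

End bounded_multipliers.

(** * Weak compactness in L_1 along an ultrafilter *)

Section dunford_pettis.
Context d (T : measurableType d) {R : realType} (mu : {sigma_finite_measure set T -> \bar R}).
Context (G : nat -> T -> R) (iG : forall k, mu.-integrable setT (EFin \o G k)).
Local Notation Int f := (\int[mu]_x f x).
(** Uniform integrability in the form that sigma-additivity uses: up to [e], the integrals of all |G
    k| over any set are bounded by that of one integrable [Phi]. *)
Context (UI : forall e : R, 0 < e -> exists2 Phi : T -> R,
  mu.-integrable setT (EFin \o Phi) /\ (forall x, 0 <= Phi x) &
  forall k A, measurable A ->
    Int (fun x => `|G k x| * \1_A x) <= e + Int (fun x => Phi x * \1_A x)).
Context (U : set_system nat) (UU : UltraFilter U).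

Implicit Types (v : T -> R) (A : set T) (C M : R).

Lemma UI_bound : exists2 B : R, 0 <= B & forall k, Int (fun x => `|G k x|) <= B.
Proof.
have [Phi [iPhi Phi0] h] := UI ltr01.
exists (1 + Int (fun x => Phi x * \1_setT x)).
  rewrite addr_ge0//; apply: Rintegral_ge0 => x _; rewrite mulr_ge0// indicE//.
move=> k; apply: le_trans (h k setT measurableT); rewrite le_eqVlt; apply/orP; left.
by apply/eqP/eq_Rintegral => x _; rewrite indicE in_setT mulr1.
Qed.

Definition limit_int v : R := lim ((fun k => Int (fun x => G k x * v x)) @ U).

Lemma cvg_limit_int v C : bounded_mfun v C ->
  (fun k => Int (fun x => G k x * v x)) @ U --> limit_int v.
Proof.
move=> bv; have [B B0 hB] := UI_bound.
have C0 : 0 <= C \/ forall k, Int (fun x => G k x * v x) = 0.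
  have [C0|C0] := leP 0 C; [by left|right => k].
  rewrite (_ : (fun x => _) = cst 0) ?Rintegral_cst ?mul0r//.
  apply/funext => x; have := bv.2 x; have := normr_ge0 (v x); lra.
have [|l hl] := @ultra_cvg_bounded R U (fun k => Int (fun x => G k x * v x)) (Num.max C 0 * B) UU.
  move=> k; have [_ h] := int_mul_bounded (iG k) bv.
  case: C0 => [C0|->]; last by rewrite normr0 mulr_ge0// le_max lexx orbT.
  by rewrite max_l//; apply: le_trans h _; exact: ler_wpM2l.
by rewrite /limit_int (cvg_lim _ hl).
Qed.

Lemma limit_intD v1 v2 C1 C2 : bounded_mfun v1 C1 -> bounded_mfun v2 C2 ->
  limit_int (fun x => v1 x + v2 x) = limit_int v1 + limit_int v2.
Proof.
move=> b1 b2; apply/cvg_lim => //.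
under eq_fun do rewrite (int_mulD (iG _) b1 b2).
by apply: cvgD; [exact: cvg_limit_int b1|exact: cvg_limit_int b2].
Qed.

Lemma limit_intZ v c C : bounded_mfun v C ->
  limit_int (fun x => c * v x) = c * limit_int v.
Proof.
move=> b; apply/cvg_lim => //.
under eq_fun do rewrite (int_mulZ c (iG _) b).
by apply: cvgM; [exact: cvg_cst|exact: cvg_limit_int b].
Qed.

Lemma limit_int_le v C M : bounded_mfun v C ->
  (forall k, `|Int (fun x => G k x * v x)| <= M) -> `|limit_int v| <= M.
Proof.
move=> b hM; have FU : ProperFilter U by exact: ultra_proper.
have h : (fun k => `|Int (fun x => G k x * v x)|) @ U --> `|limit_int v|.
  by apply: cvg_norm; exact: cvg_limit_int b.
have nM : \forall k \near U, `|Int (fun x => G k x * v x)| <= M by exact: nearW.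
exact: (@closed_cvg _ _ U FU _ (fun y => y <= M) (@closed_le R M) nM _ h).
Qed.

Lemma limit_int_bounded : exists2 B : R, 0 <= B & forall w D, bounded_mfun w D -> 0 <= D ->
    `|limit_int w| <= D * B.
Proof.
have [B B0 hB] := UI_bound; exists B => // w D bw D0.
apply: (limit_int_le bw) => k; have [_ h] := int_mul_bounded (iG k) bw.
by apply: le_trans h _; exact: ler_wpM2l.
Qed.

Definition limit_charge A : \bar R := (limit_int \1_A)%:E.

Lemma limit_charge_le A (e : R) Phi : measurable A ->
  (forall k A, measurable A ->
    Int (fun x => `|G k x| * \1_A x) <= e + Int (fun x => Phi x * \1_A x)) ->
  `|limit_int \1_A| <= e + Int (fun x => Phi x * \1_A x).
Proof.
move=> mA h; apply: (limit_int_le (bounded_mfun_indic mA)) => k.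
apply: le_trans (h k A mA).
have [i _] := int_mul_bounded (iG k) (bounded_mfun_indic mA).
apply: le_trans (le_normr_Rintegral measurableT i) _.
by rewrite le_eqVlt; apply/orP; left; apply/eqP/eq_Rintegral => x _;
    rewrite normrM [ `|\1_A x|]ger0_norm// indicE.
Qed.

Lemma limit_int_setU A B : measurable A -> measurable B -> A `&` B = set0 ->
  limit_int \1_(A `|` B) = limit_int \1_A + limit_int \1_B.
Proof.
move=> mA mB AB; rewrite -(limit_intD (bounded_mfun_indic mA) (bounded_mfun_indic mB)).
congr limit_int; apply/funext => x; rewrite !indicE in_setU.
have : ~~ ((x \in A) && (x \in B)) by rewrite -in_setI AB in_set0.
by case: (x \in A); case: (x \in B) => //=; rewrite ?addr0 ?add0r.
Qed.

Lemma limit_int_set0 : limit_int \1_set0 = 0.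
Proof.
have := limit_int_setU measurable0 measurable0 (setIid set0).
by rewrite setUid => /eqP; rewrite -subr_eq subrr eq_sym => /eqP.
Qed.

Lemma limit_int_bigsetU (A : nat -> set T) N : (forall i, measurable (A i)) ->
  trivIset setT A ->
  limit_int \1_(\big[setU/set0]_(i < N) A i) = \sum_(i < N) limit_int \1_(A i).
Proof.
move=> mA tA; elim: N => [|N IH]; first by rewrite !big_ord0 limit_int_set0.
rewrite !big_ord_recr/= limit_int_setU ?IH//.
  by apply: bigsetU_measurable => i _.
rewrite big_distrl/= big1// => i _; apply/seteqP; split => // x [xi xN].
have /trivIsetP/(_ i N Logic.I Logic.I) := tA; rewrite neq_ltn ltn_ord => /(_ isT) h.
by rewrite -h.
Qed.

Lemma integrable_tail_cvg (Phi : T -> R) (A : nat -> set T) : mu.-integrable setT (EFin \o Phi) ->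
  (forall x, 0 <= Phi x) -> (forall i, measurable (A i)) -> trivIset setT A ->
  Int (fun x => Phi x * \1_(\bigcup_i A i `\` \big[setU/set0]_(i < N) A i) x) @[N --> \oo] -->
      (0 : R).
Proof.
move=> iPhi Phi0 mA tA.
have /measurable_EFinP mPhi : measurable_fun setT (EFin \o Phi) by case/integrableP: iPhi.
have mt N : measurable (\bigcup_i A i `\` \big[setU/set0]_(i < N) A i).
  by apply: measurableD; [exact: bigcupT_measurable|exact: bigsetU_measurable].
have fN N x : 0 <= Phi x * \1_(\bigcup_i A i `\` \big[setU/set0]_(i < N) A i) x <= Phi x.
  by rewrite indicE; case: (_ \in _); rewrite ?mulr1 ?mulr0 ?Phi0 ?lexx.
have mf N : measurable_fun setT (fun x => Phi x * \1_(\bigcup_i A i `\` \big[setU/set0]_(i < N)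
    A i) x).
  by apply: measurable_funM => //; exact: measurable_indic.
have c1 : {ae mu, forall x, setT x ->
    (EFin \o (fun x => Phi x * \1_(\bigcup_i A i `\` \big[setU/set0]_(i < N) A i) x)) x
     @[N --> \oo] --> (cst 0%E : T -> \bar R) x}.
  apply: aeW => x _; apply: cvg_near_cst.
  have [[i _ xi]|nx] := pselect ((\bigcup_i A i) x).
    exists i.+1 => // N /= iN; rewrite indicE memNset ?mulr0// => -[_]; apply.
    by rewrite -bigcup_mkord; exists i.
  by apply: nearW => N /=; rewrite indicE memNset ?mulr0// => -[].
have c2 : {ae mu, forall x N, setT x ->
   (`|(EFin \o (fun x => Phi x * \1_(\bigcup_i A i `\` \big[setU/set0]_(i < N) A i) x)%R)
       x| <= (EFin \o Phi) x)%E}.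
  apply: aeW => x N _; have /andP[h1 h2] := fN N x; by rewrite /= lee_fin ger0_norm.
have [_ _] := @dominated_convergence _ _ _ mu setT measurableT _ _ _
  (fun N => (measurable_EFinP _ _).2 (mf N)) (measurable_cst _) c1 iPhi c2.
rewrite integral0 => h; exact: (fine_cvg h).
Qed.

(** The charge of a tail is at most e / 2 plus the integral of [Phi] over the tail, which tends to
    0. Uniform integrability is what prevents mass from being lost in the limit. *)
Lemma limit_charge_sigma_additive : semi_sigma_additive limit_charge.
Proof.
move=> A mA tA mUA; rewrite /limit_charge.
under eq_fun do rewrite big_mkord sumEFin -limit_int_bigsetU//.
apply/fine_cvgP; split; first exact: nearW.
rewrite /comp/=.
have mN N : measurable (\big[setU/set0]_(i < N) A i) by exact: bigsetU_measurable.
apply/cvgrPdist_le => e e0.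
have e20 : 0 < e / 2 by rewrite divr_gt0.
have [Phi [iPhi Phi0] hPhi] := UI e20.
have := integrable_tail_cvg iPhi Phi0 mA tA; move=> /cvgrPdist_le/(_ _ e20) hN.
near=> N.
have mt : measurable (\bigcup_i A i `\` \big[setU/set0]_(i < N) A i) by exact: measurableD.
have -> : limit_int \1_(\bigcup_i A i) = limit_int \1_(\big[setU/set0]_(i < N) A i) +
    limit_int \1_(\bigcup_i A i `\` \big[setU/set0]_(i < N) A i).
  rewrite -limit_int_setU ?setDIK// setDUK//.
  by rewrite -bigcup_mkord => x [i _ xi]; exists i.
rewrite addrAC subrr add0r; apply: le_trans (limit_charge_le mt hPhi) _.
have : `|0 - Int (fun x => Phi x * \1_(\bigcup_i A i `\` \big[setU/set0]_(i < N) A i) x)| <= e / 2.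
  by near: N.
rewrite sub0r normrN ger0_norm; last first.
  by apply: Rintegral_ge0 => x _; rewrite mulr_ge0// indicE.
lra.
Unshelve. all: by end_near. Qed.

HB.instance Definition _ := isCharge.Build _ _ _ limit_charge
  (congr1 EFin limit_int_set0) (fun A _ => isT) limit_charge_sigma_additive.

Lemma limit_charge_dominates : limit_charge `<< mu.
Proof.
apply/null_content_dominatesP => A mA A0.
congr EFin; apply/cvg_lim => //.
rewrite (_ : (fun k => _) = cst 0); first exact: cvg_cst.
apply/funext => k; apply: EFin_inj; rewrite -int_mul_indic//.
rewrite null_set_integral//; apply: measurable_funTS; by case/integrableP: (iG k).
Qed.

(** Radon-Nikodym gives a density that is correct on indicators. The defect [D] is linear and
    bounded by a multiple of the uniform norm, so it vanishes on staircases, then on nonnegative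
    bounded functions, and after adding the constant C on all bounded functions. *)
Theorem dunford_pettis_ultra : exists h : T -> R, mu.-integrable setT (EFin \o h) /\
  forall v C, bounded_mfun v C ->
    (fun k => Int (fun x => G k x * v x)) @ U --> Int (fun x => h x * v x).
Proof.
pose f := Radon_Nikodym limit_charge mu.
have ffin x : f x \is a fin_num by exact: (Radon_Nikodym_fin_num _ limit_charge_dominates).
have intf : mu.-integrable setT f by exact: (Radon_Nikodym_integrable limit_charge_dominates).
pose h := fine \o f.
have fh : f = EFin \o h by apply/funext => x; rewrite /h /= fineK.
have ih : mu.-integrable setT (EFin \o h) by rewrite -fh.
exists h; split => // v C bv.
have [B B0 hB] := limit_int_bounded.
pose D v := Int (fun x => h x * v x) - limit_int v.
suff Dv : D v = 0.
  have -> : Int (fun x => h x * v x) = limit_int v by apply/eqP; rewrite -subr_eq0; apply/eqP.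
  exact: cvg_limit_int bv.
have D1 A : measurable A -> D \1_A = 0.
  move=> mA; apply/eqP; rewrite subr_eq0; apply/eqP/EFin_inj.
  rewrite -int_mul_indic// -[RHS]/(limit_charge A).
  rewrite (Radon_Nikodym_integral limit_charge_dominates mA).
  by apply: eq_integral => x _; rewrite -/f fh.
have DD v1 v2 C1 C2 : bounded_mfun v1 C1 -> bounded_mfun v2 C2 ->
    D (fun x => v1 x + v2 x) = D v1 + D v2.
  by move=> b1 b2; rewrite /D (limit_intD b1 b2) (int_mulD ih b1 b2); ring.
have DZ v1 c C1 : bounded_mfun v1 C1 -> D (fun x => c * v1 x) = c * D v1.
  by move=> b1; rewrite /D (limit_intZ c b1) (int_mulZ c ih b1); ring.
have Dle v1 C1 : bounded_mfun v1 C1 -> 0 <= C1 -> `|D v1| <= C1 * (Int (fun x => `|h x|) + B).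
  move=> b1 C10; rewrite (le_trans (ler_normB _ _))// mulrDr lerD// ?hB//.
  by have [] := int_mul_bounded ih b1.
have Dst v1 k N : measurable_fun setT v1 -> D (staircase v1 k N) = 0.
  move=> mv1; elim: N => [|N IH].
    rewrite (_ : staircase v1 k 0 = \1_set0) ?D1//.
    by apply/funext => x; rewrite /staircase big_ord0 indic0.
  have [C1 b1] := staircase_bounded k N mv1.
  have ml := measurable_level N.+1%:R k.+1%:R mv1.
  have b2 := bounded_mfun_indic (R := R) ml.
  rewrite (_ : staircase v1 k N.+1 = fun x => staircase v1 k N x +
      k.+1%:R^-1 * \1_[set x | N.+1%:R <= k.+1%:R * v1 x] x).
    by rewrite (DD _ _ _ _ b1 (bounded_mfunZ _ b2)) IH (DZ _ _ _ b2) D1// mulr0 addr0.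
  by apply/funext => x; rewrite /staircase big_ord_recr.
have Dpos v1 C1 : bounded_mfun v1 C1 -> (forall x, 0 <= v1 x) -> D v1 = 0.
  move=> b1 v10; pose K := Int (fun x => `|h x|) + B.
  have K0 : 0 <= K by rewrite addr_ge0//; apply: Rintegral_ge0.
  have DK k : `|D v1| <= k.+1%:R^-1 * K.
    have k0 : 0 < k.+1%:R :> R by [].
    pose N := (Num.truncn (C1 * k.+1%:R)).+1.
    have vN x : v1 x <= N%:R / k.+1%:R.
      rewrite ler_pdivlMr//; apply: le_trans (ltW (truncnS_gt _)).
      by rewrite ler_pM2r// (le_trans (ler_norm _))// b1.2.
    have [C2 b2] := staircase_bounded k N b1.1.
    have b3 : bounded_mfun (fun x => v1 x + -1 * staircase v1 k N x) k.+1%:R^-1.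
      split; first by have [] := bounded_mfunD b1 (bounded_mfunZ (-1) b2).
      by move=> x; rewrite mulN1r; exact: staircase_close.
    have := Dle _ _ b3; rewrite invr_ge0 ler0n => /(_ isT).
    by rewrite (DD _ _ _ _ b1 (bounded_mfunZ _ b2)) (DZ _ _ _ b2) (Dst _ _ _ b1.1) mulr0 addr0.
  apply/eqP; rewrite -normr_le0; apply/ler_addgt0Pr => e e0; rewrite add0r.
  have := DK (Num.truncn (K / e)); move=> /le_trans; apply.
  by rewrite mulrC ler_pdivrMr// mulrC -ler_pdivrMr// ltW// truncnS_gt.
have b1 := bounded_mfun_indic (R := R) (@measurableT _ T).
have bc := bounded_mfunZ C b1.
have vC x : 0 <= v x + C * \1_setT x.
  by rewrite indicE in_setT mulr1; have := bv.2 x; rewrite ler_norml; lra.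
have := Dpos _ _ (bounded_mfunD bv bc) vC.
by rewrite (DD _ _ _ _ bv bc) (DZ _ _ _ b1) D1// mulr0 addr0.
Qed.

End dunford_pettis.

Section weight.
Context d (T : measurableType d) {R : realType} (mu : {measure set T -> \bar R}).
Context (Q : nat -> set T) (mQ : forall j, measurable (Q j))
  (Qoo : forall j, (mu (Q j) < +oo)%E).

(** w is the sum of the indicators of the [Q j] with coefficients 2^-(j+1) / (1 + mu (Q j)), which
    make both w and its integral at most 1. *)
Lemma positive_weight : \bigcup_j Q j = setT -> exists w : T -> R,
  [/\ measurable_fun setT w, mu.-integrable setT (EFin \o w),
      forall x, 0 < w x <= 1 & forall j, exists2 a, 0 < a & forall x, Q j x -> a <= w x].
Proof.
move=> QT.
pose a j : R := 1 / (2 ^ j.+1)%:R / (1 + fine (mu (Q j))).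
have muQ j : (mu (Q j) = (fine (mu (Q j)))%:E)%E by rewrite fineK// ge0_fin_numE.
have fQ j : 0 <= fine (mu (Q j)) by rewrite fine_ge0.
have e0 j : 0 < 1 / (2 ^ j.+1)%:R :> R by rewrite divr_gt0// ltr0n expn_gt0.
have a0 j : 0 < a j by rewrite divr_gt0// ltr_wpDr.
have a1 j : a j <= 1 / (2 ^ j.+1)%:R.
  by rewrite ler_pdivrMr ?ltr_wpDr// ler_peMr ?(ltW (e0 j))// lerDl.
pose W j x := (a j * \1_(Q j) x)%:E.
have W0 j x : (0 <= W j x)%E by rewrite lee_fin mulr_ge0 ?(ltW (a0 j))// indicE.
have mW j : measurable_fun setT (W j).
  apply/measurable_EFinP; apply: measurable_funM; first exact: measurable_cst.
  exact: measurable_indic.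
pose S x := (\sum_(j <oo) W j x)%E.
have S0 x : (0 <= S x)%E by apply: nneseries_ge0 => j _ _.
have S1 x : (S x <= 1)%E.
  apply: le_trans (epsilon_trick0 xpredT ler01); apply: lee_nneseries => // j _.
  rewrite lee_fin indicE; case: (_ \in _); rewrite ?mulr1 ?mulr0; first exact: a1.
  exact: (ltW (e0 j)).
have SE x : S x = (fine (S x))%:E.
  by rewrite fineK// ge0_fin_numE// (le_lt_trans (S1 x))// ltry.
have Sa j x : Q j x -> ((a j)%:E <= S x)%E.
  move=> Qx; apply: le_trans (nneseries_lim_ge j.+1 (fun k _ _ => W0 k x)).
  rewrite big_nat_recr//= -[leLHS]add0e leeD ?sume_ge0//.
  by rewrite /W indicE mem_set// mulr1.
have mS : measurable_fun setT S.
  by have := @ge0_emeasurable_sum _ _ _ setT W xpredT (fun k x _ _ => W0 k x) (fun k _ => mW k).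
have Sw : EFin \o (fine \o S) = S by apply/funext => x; rewrite /= -SE.
exists (fine \o S); split.
- by apply/measurable_EFinP; rewrite Sw.
- rewrite Sw; apply/integrableP; split => //.
  under eq_integral do rewrite gee0_abs//.
  rewrite integral_nneseries//.
  apply: (@le_lt_trans _ _ 1%E); last by rewrite ltry.
  apply: le_trans (epsilon_trick0 xpredT ler01); apply: lee_nneseries.
    by move=> j _ _; apply: integral_ge0 => x _.
  move=> j _; rewrite /W ge0_intZ//; last first.
  - by apply: ltW.
  rewrite integral_indic// setIT muQ -EFinM lee_fin /a -[leLHS]mulrA ler_piMr ?(ltW (e0 j))//.
  by rewrite ler_pdivrMl ?ltr_wpDr// mulr1 lerDr.
- move=> x; rewrite /= -!lee_fin -SE S1 andbT.
  have [j _ /Sa] : (\bigcup_j Q j) x by rewrite QT.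
  by rewrite -lte_fin -SE; apply: lt_le_trans; rewrite lte_fin.
- by move=> j; exists (a j) => // x /Sa; rewrite SE lee_fin.
Qed.

End weight.

(** * Weak limits of bounded sequences in L_p *)

Section weak_limit.
Context d (T : measurableType d) {R : realType} (mu : {sigma_finite_measure set T -> \bar R}).
Context (Q : nat -> set T) (mQ : forall j, measurable (Q j))
  (Qoo : forall j, (mu (Q j) < +oo)%E) (ndQ : nondecreasing_seq Q)
  (QT : \bigcup_j Q j = setT).
Local Notation Int f := (\int[mu]_x f x).

Lemma young_conj (p a b : R) : 1 < p -> 0 <= a -> 0 <= b ->
  a * b <= a `^ p / p + b `^ (p / (p - 1)) * (1 - p^-1).
Proof.
move=> p1 a0 b0; have p0 : 0 < p by exact: lt_trans p1.
have q0 : 0 < p / (p - 1) by rewrite divr_gt0// subr_gt0.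
have := @conjugate_powR R a b p (p / (p - 1)) a0 b0 p0 q0.
rewrite invf_div (_ : (p - 1) / p = 1 - p^-1); last by field; rewrite gt_eqF.
by apply; ring.
Qed.

(** The products of [g k] with the integrable weight w are uniformly integrable by Young's
    inequality. If h is their weak limit in L_1, then G = h / w; as w is bounded below on each
    [Q j], a bounded multiplier supported there remains bounded after division by w. *)
Theorem weak_limit (p M : R) (g : nat -> T -> R) : 1 < p -> 0 <= M ->
  (forall k, measurable_fun setT (g k)) -> (forall k, intp mu p (g k) <= (M `^ p)%:E)%E ->
  exists2 G : T -> R, measurable_fun setT G /\ (intp mu p G <= (M `^ p)%:E)%E &
  forall u C j, bounded_mfun u C -> (forall x, ~ Q j x -> u x = 0) ->
  forall l, Int (fun x => g k x * u x) @[k --> \oo] --> l -> Int (fun x => G x * u x) = l.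
Proof.
move=> p1 M0 mg gM; have p0 : 0 < p by exact: lt_trans p1.
pose q := p / (p - 1).
have q1 : 1 < q by rewrite /q ltr_pdivlMr ?subr_gt0//; lra.
have q0 : 0 < q by exact: lt_trans q1.
have ip : 0 <= p^-1 <= 1 by rewrite invr_ge0 invf_le1 ?ltW.
have [w [mw iw w01 wQ]] := positive_weight mQ Qoo QT.
have w0 x : 0 < w x by have /andP[] := w01 x.
have w1 x : w x <= 1 by have /andP[] := w01 x.
have wq x : w x `^ q <= w x.
  rewrite -[leRHS]powRr1; last exact: ltW.
  by apply: ger_powR; rewrite ?w0 ?w1//; exact: ltW.
have gp k : mu.-integrable setT (EFin \o (fun x => `|g k x| `^ p)).
  apply/integrableP; split.
    by apply/measurable_EFinP/measurable_powR_fun; exact: measurable_normr_fun.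
  under eq_integral do rewrite /= ger0_norm ?powR_ge0//.
  by apply: le_lt_trans (gM k) _; rewrite ltry.
have Igp k : Int (fun x => `|g k x| `^ p) <= M `^ p.
  by rewrite -lee_fin fineK ?gM//; exact: integrable_fin_num (gp k).
(* Young's inequality with a free parameter: c1 is taken small below, at the price of a large c2.
   Since w <= 1, w^q may be replaced by w. *)
have yg (c1 : R) : 0 < c1 -> exists2 c2, 0 < c2 & forall k x,
    `|g k x| * w x <= c1 * `|g k x| `^ p + c2 * w x.
  move=> c10; pose dl := c1 `^ p^-1; have dl0 : 0 < dl by exact: powR_gt0.
  exists (dl^-1 `^ q); first by rewrite powR_gt0 ?invr_gt0.
  move=> k x; have := @young_conj p (dl * `|g k x|) (dl^-1 * w x) p1.
  rewrite !mulr_ge0 ?invr_ge0 ?(ltW dl0) ?(ltW (w0 x))// => /(_ isT isT).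
  rewrite mulrACA mulfV ?gt_eqF// mul1r -/q => /le_trans; apply.
  rewrite !powRM ?invr_ge0 ?(ltW dl0) ?(ltW (w0 x))//.
  rewrite powR_invK ?gt_eqF ?(ltW c10)//; apply: lerD.
    rewrite ler_piMr ?mulr_ge0 ?powR_ge0 ?(ltW c10)//; by case/andP: ip.
  rewrite -mulrA ler_wpM2l ?powR_ge0//.
  apply: le_trans (wq x); rewrite ler_piMr ?powR_ge0//; case/andP: ip; lra.
have mgw k : measurable_fun setT (fun x => g k x * w x) by exact: measurable_funM.
have iZ (f : T -> R) c : mu.-integrable setT (EFin \o f) ->
    mu.-integrable setT (EFin \o (fun x => c * f x)).
  by move=> i; have := integrableZl measurableT c i.
have iD (f1 f2 : T -> R) : mu.-integrable setT (EFin \o f1) -> mu.-integrable setT (EFin \o f2) ->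
    mu.-integrable setT (EFin \o (fun x => f1 x + f2 x)).
  by move=> i1 i2; have := integrableD measurableT i1 i2.
have iG k : mu.-integrable setT (EFin \o (fun x => g k x * w x)).
  have [c2 c20 h] := yg 1 ltr01.
  apply: (le_integrable measurableT _ _ (iD _ _ (iZ _ 1 (gp k)) (iZ _ c2 iw))).
    exact/measurable_EFinP.
  move=> x _ /=; rewrite lee_fin normrM (gtr0_norm (w0 x)) (le_trans (h k x))//.
  exact: ler_norm.
have UI (e : R) : 0 < e -> exists2 Phi : T -> R,
    mu.-integrable setT (EFin \o Phi) /\ (forall x, 0 <= Phi x) &
    forall k A, measurable A ->
    Int (fun x => `|g k x * w x| * \1_A x) <= e + Int (fun x => Phi x * \1_A x).
  move=> e0; pose c1 := e / (M `^ p + 1).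
  have Mp0 : 0 < M `^ p + 1 by rewrite ltr_wpDl// powR_ge0.
  have c10 : 0 < c1 by rewrite divr_gt0.
  have [c2 c20 h] := yg c1 c10.
  exists (fun x => c2 * w x).
    by split; [exact: iZ|move=> x; rewrite mulr_ge0// ltW].
  move=> k A mA.
  have [i1 _] := int_mul_bounded (integrable_norm (iG k)) (bounded_mfun_indic mA).
  have [i2 _] := int_mul_bounded (iZ _ c2 iw) (bounded_mfun_indic mA).
  have i3 := iZ _ c1 (gp k).
  apply: (@le_trans _ _ (Int (fun x => c1 * `|g k x| `^ p + c2 * w x * \1_A x))).
    apply: le_Rintegral => //; first exact: (iD _ _ i3 i2).
    move=> x _; rewrite normrM (gtr0_norm (w0 x)) indicE.
    case: (_ \in _); rewrite ?mulr1 ?mulr0 ?h// addr0.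
    by rewrite mulr_ge0 ?powR_ge0// ltW.
  rewrite RintegralD// lerD2r RintegralZl//.
  apply: (@le_trans _ _ (c1 * M `^ p)); first by rewrite ler_pM2l.
  by rewrite /c1 mulrAC ler_pdivrMr// ler_pM2l// lerDl.
have [U [UU leU]] := @ultraFilterLemma nat \oo _.
have [h [ih hU]] := dunford_pettis_ultra iG UI UU.
have FU : ProperFilter U by exact: ultra_proper.
have /measurable_EFinP mh : measurable_fun setT (EFin \o h) by case/integrableP: ih.
pose G x := h x / w x.
have mwV : measurable_fun setT (fun x => (w x)^-1).
  rewrite (_ : (fun x => _) = fun x => w x `^ (-1)); first exact: measurable_powR_fun.
  by apply/funext => x; rewrite powR_inv1// ltW.
have mG : measurable_fun setT G.
  exact: measurable_funM.
have Gw x : G x * w x = h x by rewrite divfK// gt_eqF.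
have GU u C j : bounded_mfun u C -> (forall x, ~ Q j x -> u x = 0) ->
    Int (fun x => g k x * u x) @[k --> U] --> Int (fun x => G x * u x).
  move=> bu u0; have [a a0 ha] := wQ j.
  have bv : bounded_mfun (fun x => u x / w x) (C / a).
    split; first by apply: measurable_funM => //; case: bu.
    move=> x; have C0 : 0 <= C by exact: le_trans (normr_ge0 _) (bu.2 x).
    have [Qx|nQx] := pselect (Q j x); last by rewrite u0// mul0r normr0 divr_ge0// ltW.
    rewrite normrM normfV (gtr0_norm (w0 x)) ler_pM ?invr_ge0 ?(ltW (w0 x))//.
      exact: bu.2.
    by rewrite lef_pV2 ?posrE// ha.
  have := hU _ _ bv.
  rewrite (_ : (fun k => _) = (fun k => Int (fun x => g k x * u x))); last first.
    apply/funext => k; apply: eq_Rintegral => x _.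
    by rewrite -mulrA [w x * _]mulrC divfK// gt_eqF.
  rewrite (_ : Int (fun x => h x * _) = Int (fun x => G x * u x))//.
  by apply: eq_Rintegral => x _; rewrite /G -mulrA [u x / _]mulrC.
clearbody G.
exists G; last first.
  move=> u C j bu u0 l hl; have hU' := GU u C j bu u0.
  apply/esym/(cvg_unique _ _ hU') => //.
  by apply: cvg_trans hl; move=> A; exact: leU.
split => //.
(* On [E j] the limit is bounded and the measure finite, so the integral X of |G|^p over it is
   finite and can be absorbed; the sets [E j] exhaust the space. *)
pose E j := Q j `&` [set x | `|G x| <= j%:R].
have mE j : measurable (E j).
  apply: measurableI => //.
  have mGn := measurable_normr_fun mG.
  rewrite (_ : mkset _ = [set: T] `&` (fun x => `|G x|) @^-1` `]-oo, j%:R]%classic).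
    by apply: mGn => //; exact: measurable_itv.
  by rewrite setTI; apply/seteqP; split => x /=; rewrite in_itv.
have mGp : measurable_fun setT (fun x => `|G x| `^ p).
  by apply: measurable_powR_fun; exact: measurable_normr_fun.
have key j : (\int[mu]_(x in E j) (`|G x| `^ p)%:E <= (M `^ p)%:E)%E.
  (* The multiplier dual to G on [E j]: there both G u and |u|^q are equal to |G|^p. *)
  pose u x := G x * `|G x| `^ (p - 2) * \1_(E j) x.
  have uE x : `|u x| = `|G x| `^ (p - 1) * \1_(E j) x.
    rewrite /u !normrM [ `|\1_(E j) x|]ger0_norm ?indicE// (ger0_norm (powR_ge0 _ _)).
    congr (_ * _); have [->|Gx] := eqVneq (G x) 0.
      by rewrite normr0 mul0r powR0// subr_eq0 gt_eqF.
    rewrite -{1}[ `|G x|]powRr1// -powRD_gt0 ?normr_gt0//.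
    by congr (_ `^ _); ring.
  have bu : bounded_mfun u (j%:R `^ (p - 1)).
    split.
      apply: measurable_funM; last exact: measurable_indic.
      by apply: measurable_funM => //; apply: measurable_powR_fun; exact: measurable_normr_fun.
    move=> x; rewrite uE indicE; case: (boolP (x \in E j)) => [/set_mem[_ /= Gj]|_].
      by rewrite mulr1; apply: ge0_ler_powR; rewrite ?nnegrE//; lra.
    by rewrite mulr0 powR_ge0.
  have u0 x : ~ Q j x -> u x = 0 by move=> nQ; rewrite /u indicE memNset ?mulr0// => -[].
  have uq x : `|u x| `^ q = `|G x| `^ p * \1_(E j) x.
    rewrite uE indicE; case: (_ \in _); last by rewrite !mulr0 powR0// gt_eqF.
    by rewrite !mulr1 -powRrM /q mulrC divfK// gt_eqF// subr_gt0.
  have Gu x : G x * u x = `|G x| `^ p * \1_(E j) x.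
    rewrite /u mulrA mulrA -expr2 -real_normK ?num_real// -powR_mulrn//.
    congr (_ * _); have [->|Gx] := eqVneq (G x) 0.
      by rewrite normr0 [0 `^ 2]powR0 ?pnatr_eq0// mul0r powR0// gt_eqF.
    by rewrite -powRD_gt0 ?normr_gt0//; congr (_ `^ _); ring.
  have iGE : mu.-integrable setT (EFin \o (fun x => `|G x| `^ p * \1_(E j) x)).
    apply/integrableP; split.
      by apply/measurable_EFinP/measurable_funM => //; exact: measurable_indic.
    apply: (@le_lt_trans _ _ (\int[mu]_x (j%:R `^ p * \1_(Q j) x)%:E)%E).
      apply: ge0_le_int.
      - apply: measurable_normr_fun; apply: measurable_funM => //; exact: measurable_indic.
      - by apply: measurable_funM; [exact: measurable_cst|exact: measurable_indic].
      - by move=> x.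
      - move=> x; rewrite ger0_norm; last by rewrite mulr_ge0 ?powR_ge0// indicE.
        rewrite [\1_(E j) x]indicE; case: (boolP (x \in E j)) => [/set_mem[Qx /= Gj]|_].
          rewrite mulr1 indicE mem_set// mulr1.
          by apply: ge0_ler_powR; rewrite ?nnegrE//; lra.
        by rewrite mulr0 mulr_ge0 ?powR_ge0// indicE.
    rewrite ge0_intZ ?powR_ge0//.
    rewrite integral_indic// setIT; apply: lte_mul_pinfty.
    - by rewrite lee_fin powR_ge0.
    - by [].
    - exact: Qoo.
  rewrite integral_setI_ge0//.
  set X := Int (fun x => `|G x| `^ p * \1_(E j) x).
  have -> : (\int[mu]_x (`|G x| `^ p * \1_(E j) x)%:E = X%:E)%E.
    by rewrite fineK//; exact: integrable_fin_num iGE.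
  rewrite lee_fin.
  (* Young's inequality for the product of [g k] and u survives in the limit; absorbing X (1 - 1/p)
     on the left leaves X <= M^p. *)
  have hX : X <= M `^ p / p + X * (1 - p^-1).
    pose ph k x := p^-1 * `|g k x| `^ p + (1 - p^-1) * (`|G x| `^ p * \1_(E j) x).
    have iph k : mu.-integrable setT (EFin \o ph k) by apply: iD; exact: iZ.
    have guph k x : `|g k x * u x| <= ph k x.
      rewrite normrM; apply: le_trans (young_conj p1 (normr_ge0 _) (normr_ge0 _)) _.
      by rewrite -/q uq /ph mulrC [_ * (1 - _)]mulrC.
    have igu k : mu.-integrable setT (EFin \o (fun x => g k x * u x)).
      apply: (le_integrable measurableT _ _ (iph k)).
        by apply/measurable_EFinP/measurable_funM => //; case: bu.
      by move=> x _ /=; rewrite lee_fin (le_trans (guph k x))// ler_norm.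
    have hk k : `|Int (fun x => g k x * u x)| <= M `^ p / p + X * (1 - p^-1).
      apply: le_trans (le_normr_Rintegral measurableT (igu k)) _.
      apply: (@le_trans _ _ (Int (ph k))).
        by apply: le_Rintegral => //; exact: (integrable_norm (igu k)).
      rewrite RintegralD//; [|exact: iZ|exact: iZ].
      rewrite !RintegralZl// mulrC [_ * X]mulrC lerD2r ler_pM2r ?invr_gt0//.
    have hc : (fun k => `|Int (fun x => g k x * u x)|) @ U --> `|Int (fun x => G x * u x)|.
      by apply: cvg_norm; exact: (GU u _ j bu u0).
    have nM : \forall k \near U, `|Int (fun x => g k x * u x)| <= M `^ p / p + X * (1 - p^-1).
      exact: nearW.
    have := @closed_cvg _ _ U FU _ (fun y => y <= _) (@closed_le R _) nM _ hc.
    apply: le_trans; apply: le_trans (ler_norm _).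
    by rewrite le_eqVlt; apply/orP; left; apply/eqP/eq_Rintegral => x _; rewrite Gu.
  have : X / p <= M `^ p / p by lra.
  by rewrite ler_pM2r ?invr_gt0.
have ndE : nondecreasing_seq E.
  move=> i j ij; apply/subsetPset => x [Qx Gx]; split.
    by move: (ndQ ij) => /subsetPset; apply.
  by apply: le_trans Gx _; rewrite ler_nat.
have ET : \bigcup_j E j = setT.
  apply/seteqP; split => // x _; have [j _ Qx] : (\bigcup_j Q j) x by rewrite QT.
  exists (maxn j (Num.truncn `|G x|).+1) => //; split.
    by move: (ndQ (leq_maxl j (Num.truncn `|G x|).+1)) => /subsetPset; apply.
  by apply: le_trans (ltW (truncnS_gt _)) _; rewrite ler_nat leq_maxr.
have mf i : measurable_fun (E i) (fun x => (`|G x| `^ p)%:E).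
  by apply: measurable_funTS; exact/measurable_EFinP.
have f0 i x : E i x -> (0 <= (`|G x| `^ p)%:E)%E by rewrite lee_fin powR_ge0.
have := @ge0_nondecreasing_set_cvg_integral _ _ _ E _ mu ndE mE mf f0.
rewrite ET => hc; rewrite /intp -(cvg_lim _ hc)//; apply: lime_le; last exact: nearW.
by apply/cvg_ex; eexists; exact: hc.
Qed.

End weak_limit.

(** * Weak derivatives from difference quotients *)

Lemma dominated_Rintegral d (T : measurableType d) (R : realType)
    (mu : {measure set T -> \bar R}) (f_ : nat -> T -> R) (f g : T -> R) :
  (forall k, measurable_fun setT (f_ k)) -> measurable_fun setT f ->
  (forall x, f_ ^~ x @ \oo --> f x) -> mu.-integrable setT (EFin \o g) ->
  (forall x k, `|f_ k x| <= g x) -> \int[mu]_x f_ k x @[k --> \oo] --> \int[mu]_x f x.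
Proof.
move=> mf_ mf ff ig fg.
have ff' : {ae mu, forall x, setT x -> (EFin \o f_ k) x @[k --> \oo] --> (EFin \o f) x}.
  by apply: aeW => x _; apply/fine_cvgP; split; [exact: nearW|exact: ff].
have fg' : {ae mu, forall x k, setT x -> (`|(EFin \o f_ k) x| <= (EFin \o g) x)%E}.
  by apply: aeW => x k _; rewrite /= lee_fin.
have [i1 _ h] := @dominated_convergence _ _ _ mu setT measurableT (fun k => EFin \o f_ k)
  (EFin \o f) (EFin \o g) (fun k => (measurable_EFinP _ _).2 (mf_ k))
  ((measurable_EFinP _ _).2 mf) ff' ig fg'.
apply: fine_cvg; rewrite fineK//; exact: integrable_fin_num i1.
Qed.

Lemma integrable_Lfun_cube (R : realType) (n : nat) (p : R) (u : @lebesgue_rV R n -> R) c r :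
  1 <= p -> 0 <= r -> u \in Lfun (lebesgue n) p%:E ->
  (lebesgue n).-integrable setT (EFin \o (fun z => u z * \1_(cube c r) z)).
Proof.
move=> p1 r0 Lu; have [mu_ _] := (Lfun_intp (lebesgue n) u (lt_le_trans ltr01 p1)).1 Lu.
have mQ : measurable (cube c r : set (lebesgue_rV n)) by exact: measurable_cube.
apply: (proj1 (@integrable_supp _ _ _ (lebesgue n) u _ (cube c r) 1 mQ mu_ _ _ _ _)).
- exact: measurable_indic.
- by move=> z; rewrite indicE; case: (_ \in _); rewrite ?normr1 ?normr0.
- by move=> z nz; rewrite indicE memNset.
- exact: (Lfun_int_cube p1 _ r0 Lu).
Qed.

Section test_functions.
Context {R : realType} {n : nat}.
Implicit Types (phi : 'rV[R]_n -> R).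

Lemma is_derive_line phi (x e : 'rV[R]_n) (s : R) :
  derivable phi (x + s *: e) e ->
  is_derive s 1 (fun t : R => phi (x + t *: e)) ('D_e phi (x + s *: e)).
Proof.
have E : (fun h : R => h^-1 *: (((fun t : R => phi (x + t *: e)) \o shift s) (h *: (1 : R))
    - phi (x + s *: e))) =
    (fun h : R => h^-1 *: ((phi \o shift (x + s *: e)) (h *: e) - phi (x + s *: e))).
  apply/funext => h /=; congr (_ *: (phi _ - _)).
  by rewrite [h *: (1 : R)]mulr1 scalerDl addrCA.
by move=> d; split; rewrite /derivable /derive E.
Qed.

Lemma test_function_supp phi : test_function phi ->
  exists2 N : nat, (forall x, ~ cube 0 N%:R x -> phi x = 0) & exists M, forall x, `|phi x| <= M.
Proof.
move=> [sphi cphi]; have cf : continuous phi by have [] := sphi [::].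
have [N hN] : exists N : nat, forall x, closure [set x | phi x != 0] x -> `|x| <= N%:R.
  have [M [Mr hM]] := compact_bounded cphi.
  exists (Num.truncn (`|M| + 1)).+1 => x xc.
  apply: (hM (Num.truncn (`|M| + 1)).+1%:R) => //.
  apply: le_lt_trans (ler_norm M) _; apply: lt_trans (truncnS_gt _).
  by rewrite ltrDl.
have supp x : ~ cube 0 N%:R x -> phi x = 0.
  move=> nx; apply/eqP; apply: contrapT => /negP px; apply: nx.
  rewrite cubeE//= subr0; apply: hN; exact: subset_closure.
exists N => //.
have [M [Mr hM]] := compact_bounded (continuous_compact (continuous_subspaceT cf)
    (@compact_cube R n 0 N%:R)).
exists (`|M| + 1) => x; have [xc|/supp ->] := pselect (cube 0 N%:R x).
  by apply: hM; [rewrite (le_lt_trans (ler_norm M))// ltrDl|exists x].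
by rewrite normr0 addr_ge0.
Qed.

(** Mean value theorem. For t <= 1 the shift moves the support by at most 1, hence the cube of
    radius N + 1 for the quotient and that of radius N + 2 on which the derivative has to be
    bounded. *)
Lemma test_function_quotient phi (i : 'I_n) : test_function phi ->
  exists2 N : nat, exists M : R, forall (t : R) x, 0 < t -> t <= 1 ->
    `|(phi (x - t *: delta_mx ord0 i) - phi x) / t| <= M &
  forall (t : R) x, 0 < t -> t <= 1 -> ~ cube 0 N%:R x -> (phi (x - t *: delta_mx ord0 i) - phi x)
      / t = 0.
Proof.
move=> tphi; have [N supp _] := test_function_supp tphi.
have [sphi _] := tphi; have [_ dphi] := sphi [::]; have [cd _] := sphi [:: i].
set e := delta_mx ord0 i : 'rV[R]_n.
have e1 : `|e| <= 1.
  apply/rV_norm_le => // j; rewrite mxE/=; case: (_ == _); rewrite ?normr1 ?normr0//.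
have far t x : 0 < t -> t <= 1 -> ~ cube 0 N.+1%:R x -> (phi (x - t *: e) - phi x) / t = 0.
  move=> t0 t1; rewrite cubeE//= subr0 => /negP; rewrite -ltNge => nx.
  rewrite !supp ?subrr ?mul0r// cubeE//= subr0; apply/negP; rewrite -ltNge.
    by apply: lt_trans nx; rewrite ltr_nat.
  have te : `|t *: e| <= 1 by rewrite normrZ gtr0_norm// mulr_ile1// ltW.
  have := ler_normD (x - t *: e) (t *: e); rewrite subrK.
  move: nx; rewrite -natr1; lra.
exists N.+1; last exact: far.
have [M [Mr hM]] := compact_bounded (continuous_compact (continuous_subspaceT cd)
    (@compact_cube R n 0 N.+2%:R)).
have M1 y : cube 0 N.+2%:R y -> `|'D_e phi y| <= `|M| + 1.
  by move=> yc; apply: hM; [rewrite (le_lt_trans (ler_norm M))// ltrDl|exists y].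
exists (`|M| + 1) => t x t0 t1.
have [xc|/far ->//] := pselect (cube 0 N.+1%:R x); last by rewrite normr0 addr_ge0.
have [s] : exists2 s, s \in `[(- t), 0]%R &
    phi (x + (0 : R) *: e) - phi (x + (- t) *: e) = 'D_e phi (x + s *: e) * (0 - - t).
  apply: (@MVT_segment R (fun s => phi (x + s *: e)) (fun s => 'D_e phi (x + s *: e))).
  - by rewrite oppr_le0 ltW.
  - by move=> s _; apply: is_derive_line; exact: dphi.
  - apply: derivable_within_continuous => s _.
    by have [] := @is_derive_line phi x e s (dphi _ _).
rewrite in_itv/= => /andP[ts s0]; rewrite scale0r addr0 sub0r opprK scaleNr => es.
rewrite -normrN -mulNr opprB es mulfK ?gt_eqF//; apply: M1.
move: xc; rewrite !cubeE//= !subr0 => xc.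
apply: le_trans (ler_normD _ _) _; rewrite -natr1 lerD// normrZ mulr_ile1//.
by rewrite ler_norml; lra.
Qed.

Lemma cvg_test_function_quotient phi (i : 'I_n) (t : nat -> R) x : test_function phi ->
  (forall k, 0 < t k) -> t @ \oo --> (0 : R) ->
  (phi (x - t k *: delta_mx ord0 i) - phi x) / t k @[k --> \oo] --> - partial i phi x.
Proof.
move=> [sphi _] t0 tc; have [_ dphi] := sphi [::].
have /= d := dphi i x; rewrite /partial /derive.
have tc' : (- t k) @[k --> \oo] --> (0 : R)^'.
  move=> A [e /= e0 hA]; have /cvgrPdist_lt/(_ _ e0) := tc; apply: filterS => k hk.
  apply: hA; last by rewrite oppr_eq0 gt_eqF.
  by rewrite /ball_/= sub0r opprK -normrN -[X in `|X|]sub0r.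
have := cvg_comp _ _ tc' d; move=> /cvgN; apply: cvg_trans.
apply: near_eq_cvg; apply: nearW => k /=.
rewrite -[LHS]/(- ((- t k)^-1 * (phi ((- t k) *: delta_mx ord0 i + x) - phi x))).
by rewrite invrN mulNr opprK mulrC scaleNr [- _ + x]addrC.
Qed.

End test_functions.

Section riesz.
Context {R : realType} {n : nat} (p : R) (p1 : 1 < p).
Local Notation mu := (@lebesgue R n).

Lemma Rintegral_translate (f : 'rV[R]_n -> R) (b : 'rV[R]_n) :
  measurable_fun setT f -> mu.-integrable setT (EFin \o f) ->
  \int[mu]_x f ((x : 'rV[R]_n) + b) = \int[mu]_x f x.
Proof.
move=> mf intf; have := Rintegral_affine b ltr01 mf intf.
rewrite expr1n invr1 mul1r => <-; apply: eq_Rintegral => x _.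
by rewrite scale1r.
Qed.

Lemma integrable_translate (f : 'rV[R]_n -> R) (b : 'rV[R]_n) :
  measurable_fun setT f -> mu.-integrable setT (EFin \o f) ->
  mu.-integrable setT (EFin \o (fun x : lebesgue_rV n => f ((x : 'rV[R]_n) + b))).
Proof.
move=> mf intf.
have := integrable_affine b ltr01 ((measurable_EFinP _ _).2 mf) intf.
by apply: eq_integrable => // x _ /=; rewrite scale1r.
Qed.

(** The quotients of F have a weak limit g. To recognize g, the quotient is moved onto the test
    function, where it is bounded with a common support and tends to minus the partial
    derivative. *)
Theorem weak_derivative_of_quotients (F : 'rV[R]_n -> R) (i : 'I_n) (M : R) (t : nat -> R) :
  continuous F -> F \in Lfun mu p%:E -> 0 <= M ->
  (forall k, 0 < t k <= 1) -> t @ \oo --> (0 : R) ->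
  (forall k, intp mu p (fun x : lebesgue_rV n =>
     ((F ((x : 'rV[R]_n) + t k *: delta_mx ord0 i) - F x) / t k)%R) <= (M `^ p)%:E)%E ->
  exists2 g : lebesgue_rV n -> R, g \in Lfun mu p%:E /\ (intp mu p g <= (M `^ p)%:E)%E &
    forall phi, test_function phi ->
      \int[mu]_x (F x * partial i phi x) = - \int[mu]_x (g x * phi x).
Proof.
move=> cF LF M0 t01 tc hM; have p0 : 0 < p by exact: lt_trans p1.
have t0 k : 0 < t k by case/andP: (t01 k).
have t1 k : t k <= 1 by case/andP: (t01 k).
set e := delta_mx ord0 i : 'rV[R]_n.
pose g k (x : lebesgue_rV n) : R := (F ((x : 'rV[R]_n) + t k *: e) - F x) / t k.
have cFt k : continuous (fun x : 'rV[R]_n => F (x + t k *: e)).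
  by move=> x; apply: (@continuous_comp _ _ _ (fun x : 'rV[R]_n => x + t k *: e) F);
      [exact: cvgD cvg_id (cvg_cst _)|exact: cF].
have cg k : continuous (g k : 'rV[R]_n -> R).
  by move=> x; exact: (cvgM (cvgB (@cFt k x) (@cF x)) (cvg_cst _)).
have mg k : measurable_fun setT (g k) by exact: measurable_continuous.
pose Q (j : nat) : set (lebesgue_rV n) := cube (0 : 'rV[R]_n) j%:R.
have mQ j : measurable (Q j) by exact: measurable_cube.
have Qoo j : (lebesgue_sf R n (Q j) < +oo)%E.
  have -> : lebesgue_sf R n (Q j) = ((2 * j%:R) ^+ n)%:E by exact: lebesgue_cube.
  by rewrite ltry.
have ndQ : nondecreasing_seq Q.
  move=> j k jk; apply/subsetPset; apply: cube_sub => //.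
  by rewrite subrr normr0 add0r ler_nat.
have [G [mG GM] hG] := @weak_limit _ _ R (lebesgue_sf R n) Q mQ Qoo ndQ (@bigcup_cube R n)
    p M g p1 M0 mg hM.
exists G.
  split => //; apply/(Lfun_intp mu G p0); split => //.
  by apply: le_lt_trans GM _; rewrite ltry.
move=> phi tphi.
have [N supp [K hK]] := test_function_supp tphi.
have cphi : continuous phi by case: tphi => sphi _; have [] := sphi [::].
have bphi : bounded_mfun (T := lebesgue_rV n) phi K by split => //; exact: measurable_continuous.
have N0 : 0 <= N%:R :> R by [].
have mF : measurable_fun setT F by exact: measurable_rV_continuous.
have [iFphi _] := Lfun_mul_supp (ltW p1) N0 LF cphi hK supp.
have cphit k : continuous (fun y : 'rV[R]_n => phi (y - t k *: e)).
  by move=> x; apply: (@continuous_comp _ _ _ (fun x : 'rV[R]_n => x - t k *: e) phi);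
      [exact: cvgD cvg_id (cvg_cst _)|exact: cphi].
(* discrete integration by parts *)
have parts k : \int[mu]_x (g k x * phi x) =
    \int[mu]_x (F x * ((phi ((x : 'rV[R]_n) - t k *: e) - phi x) / t k)).
  pose f (y : 'rV[R]_n) := F y * phi (y - t k *: e).
  have suppt y : ~ cube (t k *: e) N%:R y -> phi (y - t k *: e) = 0.
    by move=> ny; apply: supp; rewrite cubeE//= subr0; move: ny; rewrite cubeE.
  have [if_ _] := Lfun_mul_supp (ltW p1) N0 LF (@cphit k) (fun y => hK _) suppt.
  have mf : measurable_fun setT f.
    by apply: measurable_funM => //; exact: measurable_rV_continuous.
  have ift := integrable_translate (t k *: e) mf if_.
  have e1 := Rintegral_translate (t k *: e) mf if_.
  transitivity ((t k)^-1 * (\int[mu]_x f ((x : 'rV[R]_n) + t k *: e) - \int[mu]_x (F x * phi x))).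
    rewrite -RintegralB// -RintegralZl//; last exact: (integrableB measurableT ift iFphi).
    by apply: eq_Rintegral => x _; rewrite /g /f addrK; ring.
  rewrite e1 -RintegralB// -RintegralZl//; last exact: (integrableB measurableT if_ iFphi).
  by apply: eq_Rintegral => x _; rewrite /f; ring.
suff : \int[mu]_x (g k x * phi x) @[k --> \oo] --> - \int[mu]_x (F x * partial i phi x).
  by move=> /(hG phi K N bphi supp) ->; rewrite opprK.
under eq_fun do rewrite parts.
have [N' [K' hK'] supp'] := test_function_quotient i tphi.
pose d k (x : lebesgue_rV n) := (phi ((x : 'rV[R]_n) - t k *: e) - phi x) / t k.
have cd k : continuous (d k : 'rV[R]_n -> R).
  by move=> x; exact: (cvgM (cvgB (@cphit k x) (@cphi x)) (cvg_cst _)).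
have dK k x : `|d k x| <= K' by exact: hK'.
have dsupp k x : ~ cube (0 : 'rV[R]_n) N'%:R x -> d k x = 0 by exact: supp'.
have iFd k := (Lfun_mul_supp (ltW p1) (ler0n R N') LF (cd k) (dK k) (dsupp k)).1.
suff : \int[mu]_x (- 1 * (F x * d k x)) @[k --> \oo] --> \int[mu]_x (F x * partial i phi x).
  move=> /cvgN; apply: cvg_trans; apply: near_eq_cvg; apply: nearW => k /=.
  rewrite -[LHS]/(- \int[mu]_x (- 1 * (F x * d k x))).
  by rewrite (RintegralZl (-1) measurableT (iFd k)) mulN1r opprK.
have cdphi : continuous (partial i phi) by case: tphi => sphi _; have [] := sphi [:: i].
have mF' := measurable_fun_lebesgue mF.
apply: (@dominated_Rintegral _ (lebesgue_rV n) R mu _ _ (fun x => K' * `|F x * \1_(cube 0 N'%:R)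
    x|)).
- move=> k; apply: measurable_funM; first exact: measurable_cst.
  by apply: measurable_funM; [exact: mF'|exact: measurable_continuous].
- by apply: measurable_funM; [exact: mF'|exact: measurable_continuous].
- move=> x; under eq_fun do rewrite mulrCA mulN1r.
  apply: cvgM; first exact: cvg_cst.
  by rewrite -[X in _ --> X]opprK; apply: cvgN; exact: cvg_test_function_quotient.
- have := integrable_norm (integrable_Lfun_cube 0 (ltW p1) (ler0n R N') LF).
  by move=> h; have := integrableZl measurableT K' h.
- move=> x k; rewrite mulN1r normrN.
  have [xc|xc] := pselect (cube (0 : 'rV[R]_n) N'%:R x); last first.
    rewrite dsupp// mulr0 normr0 mulr_ge0//.
    by apply: le_trans (dK 0%N 0).
  by rewrite indicE mem_set// mulr1 normrM mulrC ler_wpM2r.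
Qed.

End riesz.

(** * The extension *)

Section distance.
Context {R : realType} {n : nat} (S : set 'rV[R]_n) (S0 : S !=set0).
Implicit Types (x y : 'rV[R]_n).

(** Real-valued form of [edist_inf], usable because S is nonempty here; the empty set is treated
    separately at the end. *)
Definition dist x : R := inf [set `|x - s| | s in S].

Let dist_has_inf x : has_inf [set `|x - s| | s in S].
Proof.
split; first by have [s Ss] := S0; exists `|x - s|, s.
by exists 0 => _ [s _ <-].
Qed.

Lemma dist_ge0 x : 0 <= dist x.
Proof.
apply: lb_le_inf; first by have [s Ss] := S0; exists `|x - s|, s.
by move=> _ [s _ <-].
Qed.

Lemma dist_le x s : S s -> dist x <= `|x - s|.
Proof. by move=> Ss; apply: ge_inf; [have [] := dist_has_inf x|exists s]. Qed.

Lemma dist_adherent x (e : R) : 0 < e -> exists2 s, S s & `|x - s| < dist x + e.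
Proof.
by move=> e0; have [_ [s Ss <-] h] := inf_adherent e0 (dist_has_inf x); exists s.
Qed.

Lemma dist_lip x y : dist x <= dist y + `|x - y|.
Proof.
apply/ler_addgt0Pr => e e0; have [s Ss h] := dist_adherent y e0.
apply: le_trans (dist_le x Ss) _; apply: le_trans (ler_distD y _ _) _.
by lra.
Qed.

Lemma dist_lip_norm x y : `|dist x - dist y| <= `|x - y|.
Proof.
rewrite ler_norml; have := dist_lip x y; have := dist_lip y x.
by rewrite [ `|y - x|]distrC; lra.
Qed.

Lemma continuous_dist : continuous dist.
Proof.
move=> x A /nbhs_ballP[e /= e0 hA]; apply/nbhs_ballP; exists e => // y.
rewrite -ball_normE/= => xy; apply: hA; rewrite -ball_normE/=.
exact: le_lt_trans (dist_lip_norm _ _) xy.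
Qed.

Lemma dist_eq0 x : closed S -> dist x = 0 <-> S x.
Proof.
move=> cS; split => [dx|Sx]; last first.
  by apply/eqP; rewrite eq_le dist_ge0 andbT; have := dist_le x Sx; rewrite subrr normr0.
rewrite (closure_id S).1// => U /nbhs_ballP[e /= e0 hU].
have [s Ss h] := dist_adherent x e0; exists s; split => //; apply: hU.
by rewrite -ball_normE/=; move: h; rewrite dx add0r.
Qed.

Lemma edist_normE x y : edist (x, y) = `|x - y|%:E.
Proof.
apply/eqP; rewrite eq_le; apply/andP; split.
  apply/lee_addgt0Pr => e e0; apply: ereal_inf_lbound; exists (`|x - y| + e) => //.
  by split; [rewrite ltr_wpDl|rewrite /= -ball_normE/= ltrDl].
apply: le_ereal_inf_tmp => _ [r [r0 xy] <-].
by move: xy; rewrite -ball_normE/= lee_fin => /ltW.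
Qed.

Lemma edist_inf_dist x : edist_inf S x = (dist x)%:E.
Proof.
apply/eqP; rewrite eq_le; apply/andP; split.
  apply/lee_addgt0Pr => e e0; have [s Ss h] := dist_adherent x e0.
  apply: (@le_trans _ _ (edist (x, s))); first by apply: ereal_inf_lbound; exists s.
  by rewrite edist_normE lee_fin ltW.
by apply: le_ereal_inf_tmp => _ [s Ss <-]; rewrite edist_normE lee_fin dist_le.
Qed.

Lemma nbhd_dist eps x : nbhd eps S x <-> dist x < eps.
Proof. by rewrite /nbhd/= edist_inf_dist lte_fin. Qed.

Lemma open_nbhd eps : open (nbhd eps S).
Proof.
rewrite (_ : nbhd eps S = dist @^-1` [set y | y < eps]).
  by apply: open_comp => [x _|]; [exact: continuous_dist|exact: open_lt].
by apply/seteqP; split => x /nbhd_dist.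
Qed.

Lemma cube_nbhd eps x r : 0 <= r -> dist x + r < eps -> cube x r `<=` nbhd eps S.
Proof.
move=> r0 h y; rewrite cubeE//= => yx; apply/nbhd_dist.
by have := dist_lip y x; lra.
Qed.

End distance.

Section weighted_average.
Context d (T : measurableType d) {R : realType} (mu : {measure set T -> \bar R}).
Local Notation Int f := (\int[mu]_x f x).
Implicit Types (u w : T -> R).

Definition wavg u w : R := Int (fun z => u z * w z) / Int w.

Lemma wavg_le u w (c o : R) : mu.-integrable setT (EFin \o w) ->
  mu.-integrable setT (EFin \o (fun z => u z * w z)) -> (forall z, 0 <= w z) -> 0 < Int w ->
  (forall z, w z != 0 -> `|u z - c| <= o) -> `|wavg u w - c| <= o.
Proof.
move=> iw iuw w0 W0 h.
have icw := integrableZl measurableT c iw.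
have iow := integrableZl measurableT o iw.
have -> : wavg u w - c = Int (fun z => u z * w z - c * w z) / Int w.
  by rewrite RintegralB// RintegralZl// /wavg mulrBl mulfK ?gt_eqF.
have id := integrableB measurableT iuw icw.
rewrite normrM normfV (gtr0_norm W0) ler_pdivrMr//.
apply: le_trans (le_normr_Rintegral measurableT id) _.
rewrite -RintegralZl//; apply: le_Rintegral => //; first exact: (integrable_norm id).
move=> z _; rewrite -mulrBl normrM (ger0_norm (w0 z)).
have [->|wz] := eqVneq (w z) 0; first by rewrite !mulr0.
by rewrite ler_wpM2r// h.
Qed.

(** The difference of the averages times the integral of w equals the integral of (u - c) (w - w')
    minus (wavg u w' - c) times the difference of the masses. Subtracting c makes the bound depend
    on the oscillation of u instead of its size. *)
Lemma wavg_diff u w w' (c o : R) : mu.-integrable setT (EFin \o w) ->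
  mu.-integrable setT (EFin \o w') ->
  mu.-integrable setT (EFin \o (fun z => u z * w z)) ->
  mu.-integrable setT (EFin \o (fun z => u z * w' z)) ->
  (forall z, 0 <= w' z) -> 0 < Int w -> 0 < Int w' ->
  (forall z, w z != 0 \/ w' z != 0 -> `|u z - c| <= o) ->
  `|wavg u w - wavg u w'| <= 2 * o * Int (fun z => `|w z - w' z|) / Int w.
Proof.
move=> iw iw' iuw iuw' w0' W0 W0' h.
set D := Int (fun z => `|w z - w' z|).
have hc : `|wavg u w' - c| <= o by apply: wavg_le => // z z0; apply: h; right.
have iww := integrableB measurableT iw iw'.
have icw := integrableZl measurableT c iw.
have icw' := integrableZl measurableT c iw'.
have idw := integrableB measurableT iuw icw.
have idw' := integrableB measurableT iuw' icw'.
have idd := integrableB measurableT idw idw'.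
have i1 : `|Int w - Int w'| <= D.
  by rewrite -RintegralB//; exact: le_normr_Rintegral measurableT iww.
have iD : mu.-integrable setT (EFin \o (fun z => o * `|w z - w' z|)).
  by have := integrableZl measurableT o (integrable_norm iww).
have i2 : `|Int (fun z => u z * w z - c * w z) - Int (fun z => u z * w' z - c * w' z)| <= o * D.
  rewrite -RintegralB//; apply: le_trans (le_normr_Rintegral measurableT idd) _.
  rewrite /D -RintegralZl//; last exact: (integrable_norm iww).
  apply: le_Rintegral => //; first exact: (integrable_norm idd).
  move=> z _; rewrite (_ : _ - _ = (u z - c) * (w z - w' z)); last by ring.
  rewrite normrM; have [e|ne] := eqVneq (w z - w' z) 0; first by rewrite e normr0 !mulr0.
  rewrite ler_wpM2r//; apply: h.
  have [wz|?] := eqVneq (w z) 0; last by left.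
  by right; move: ne; rewrite wz sub0r oppr_eq0.
rewrite !RintegralB// !RintegralZl// in i2.
rewrite (_ : 2 * o * D = o * D + o * D); last by ring.
rewrite ler_pdivlMr// -{1}(gtr0_norm W0) -normrM.
have -> : (wavg u w - wavg u w') * Int w =
   ((Int (fun z => u z * w z) - c * Int w) - (Int (fun z => u z * w' z) - c * Int w')) -
   (wavg u w' - c) * (Int w - Int w').
  by rewrite /wavg; field; rewrite !gt_eqF.
apply: le_trans (ler_normB _ _) _; apply: lerD => //.
by rewrite normrM ler_pM.
Qed.

End weighted_average.

(** A supremum need not be attained, but some element reaches half of it. In each cube this provides
    two points of S that nearly realize the oscillation of f. *)
Lemma near_max (R : realType) (A : set R) (B : R) : A !=set0 ->
  (forall a, A a -> 0 <= a <= B) -> exists2 a, A a & forall b, A b -> b <= 2 * a.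
Proof.
move=> A0 AB.
have ub : has_sup A by split => //; exists B => a /AB/andP[].
have [a0 Aa0] := A0; have a00 : 0 <= a0 by have /andP[] := AB _ Aa0.
have sA b : A b -> b <= sup A by move=> Ab; exact: sup_upper_bound.
have [s0|s0] := leP (sup A) 0.
  by exists a0 => // b /sA; lra.
have s20 : 0 < sup A / 2 by rewrite divr_gt0.
have [a Aa ha] := sup_adherent s20 ub; exists a => // b /sA; lra.
Qed.

Lemma sum_indic_int d (T : measurableType d) (R : realType) (mu : {measure set T -> \bar R})
    (I : Type) (s : seq I) (A : set T) (Q : I -> set T) (k : I -> R) (h : T -> R) :
  measurable A -> (forall i, measurable (Q i)) -> measurable_fun setT h ->
  (forall x, 0 <= h x) -> (forall i, 0 <= k i) ->
  (forall x, A x -> h x <= \sum_(i <- s) k i * \1_(Q i) x) ->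
  (\int[mu]_(x in A) (h x)%:E <= \sum_(i <- s) (k i)%:E * mu (Q i))%E.
Proof.
move=> mA mQ mh h0 k0 H.
have mk i : measurable_fun setT (fun x => k i * \1_(Q i) x).
  by apply: measurable_funM; [exact: measurable_cst|exact: measurable_indic].
have k1 i x : 0 <= k i * \1_(Q i) x by rewrite mulr_ge0// indicE.
apply: (@le_trans _ _ (\int[mu]_x (\sum_(i <- s) k i * \1_(Q i) x)%:E)%E).
  rewrite integral_setI_ge0//; apply: ge0_le_int.
  - by apply: measurable_funM => //; exact: measurable_indic.
  - exact: measurable_sum.
  - by move=> x; rewrite mulr_ge0// indicE.
  - move=> x; rewrite indicE; case: (boolP (x \in A)) => [/set_mem Ax|_].
      by rewrite mulr1; exact: H.
    by rewrite mulr0 sumr_ge0.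
under eq_integral do rewrite -sumEFin.
rewrite ge0_integral_sum//; first last.
  by move=> i x _; rewrite lee_fin.
  by move=> i; apply/measurable_EFinP.
rewrite le_eqVlt; apply/orP; left; apply/eqP/eq_bigr => i _.
rewrite ge0_intZ//.
by rewrite integral_indic// setIT.
Qed.

(** * From sums over disjoint cubes to an integral bound *)

Section covering.
Context {R : realType} {n : nat} (p eps eta lambda : R) (S : set 'rV[R]_n) (f : 'rV[R]_n -> R).
Context (n0 : (0 < n)%N) (np : n%:R < p).
Context (cs : cube_sums_bounded p eps eta S f lambda).
Local Notation mu := (@lebesgue R n).

Let p0 : 0 < p. Proof. by apply: le_lt_trans np. Qed.

Lemma cube_pair_le x r s s' : 0 < r -> cube x r `<=` nbhd eps S ->
  S s -> S s' -> cube x (eta * r) s -> cube x (eta * r) s' ->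
  `|f s - f s'| `^ p / (2 * r) `^ (p - n%:R) <= lambda.
Proof.
move=> r0 xS Ss Ss' xs xs'.
have := cs (m := 1) (c := fun=> x) (r := fun=> r) (x := fun=> s) (y := fun=> s').
rewrite big_ord1 diam_cube//; apply => //.
by apply/trivIsetP => i j _ _; rewrite !ord1.
Qed.

Lemma cube_seq_le (D : seq 'rV[R]_n) (r : 'rV[R]_n -> R) (s s' : 'rV[R]_n -> 'rV[R]_n) :
  uniq D -> trivIset [set` D] (fun x => cube x (r x)) ->
  (forall x, x \in D -> [/\ 0 < r x, cube x (r x) `<=` nbhd eps S,
      (cube x (eta * r x) `&` S) (s x) & (cube x (eta * r x) `&` S) (s' x)]) ->
  \sum_(x <- D) `|f (s x) - f (s' x)| `^ p / (2 * r x) `^ (p - n%:R) <= lambda.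
Proof.
move=> uD tD hD.
have inD (i : 'I_(size D)) : nth 0 D i \in D by exact: mem_nth.
have := cs (m := size D) (c := fun i => nth 0 D i) (r := fun i => r (nth 0 D i))
  (x := fun i => s (nth 0 D i)) (y := fun i => s' (nth 0 D i)).
rewrite (big_nth 0) big_mkord => h.
rewrite (eq_bigr (fun i : 'I_(size D) => `|f (s (nth 0 D i)) - f (s' (nth 0 D i))| `^ p /
    diam (cube (nth 0 D i) (r (nth 0 D i))) `^ (p - n%:R))); last first.
  by move=> i _; rewrite diam_cube//; have [] := hD _ (inD i).
apply: h; try by move=> i; have [] := hD _ (inD i).
apply/trivIsetP => i j _ _ ij.
have /trivIsetP := tD; apply; rewrite /= ?inD//.
by rewrite nth_uniq.
Qed.

(* On the 3-dilation of each cube of a disjoint Vitali subfamily, h is at most the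
   oscillation of f divided by the radius. *)
Theorem covering_le (A : set 'rV[R]_n) (r : 'rV[R]_n -> R) (h : lebesgue_rV n -> R) :
  compact A -> (forall x, A x -> 0 < r x) ->
  (forall x, A x -> cube x (r x) `<=` nbhd eps S) ->
  (forall x, A x -> (cube x (eta * r x) `&` S) !=set0) ->
  measurable_fun setT h -> (forall x, 0 <= h x) ->
  (forall x y o, A x -> A y -> cube x (3 * r x) y ->
     (forall s s', (cube x (eta * r x) `&` S) s -> (cube x (eta * r x) `&` S) s' ->
        `|f s - f s'| <= o) -> h y <= o / r x) ->
  (\int[mu]_(x in A) (h x `^ p)%:E <= (2 `^ p * 6 ^+ n * 2 `^ (p - n%:R) * lambda)%:E)%E.
Proof.
move=> cA r0 rS hS mh h0 hh.
(* [finite_vitali] asks for positive radii at every index; the value 1 is a default that is never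
   met on A. *)
pose r' x := if 0 < r x then r x else 1.
have r'0 x : 0 < r' x by rewrite /r'; case: ifP.
have r'E x : A x -> r' x = r x by move=> /r0 rx; rewrite /r' rx.
have [E EA AE] : exists2 E : seq 'rV[R]_n, (forall x, x \in E -> A x) &
    forall y, A y -> exists2 x, x \in E & cube x (r x) y.
  have op (x : 'rV[R]_n) : open [set y | `|x - y| < r x].
    rewrite openE => y /= h1; apply/nbhs_ballP; exists (r x - `|x - y|);
        first by rewrite /= subr_gt0.
    move=> z; rewrite -ball_normE/= => yz.
    by have := ler_distD y x z; lra.
  move: cA; rewrite compact_cover => /(_ _ A (fun x => [set y | `|x - y| < r x])).
  case=> [x Ax|x Ax|E EA AE].
  - exact: op.
  - by exists x => //=; rewrite subrr normr0; exact: r0.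
  exists (enum_fset E) => [x xE|y /AE[x /= xE xy]]; first exact/set_mem/EA.
  exists x => //; have Ax : A x by exact/set_mem/EA.
  rewrite cubeE/=; last exact/ltW/r0.
  by rewrite distrC ltW.
have [D [uD DE tD cD]] := @finite_vitali R n _ id r' E r'0.
have DA x : x \in D -> A x by move=> /DE/EA.
have pairs x : exists ss : 'rV[R]_n * 'rV[R]_n, A x ->
    [/\ (cube x (eta * r x) `&` S) ss.1, (cube x (eta * r x) `&` S) ss.2 &
     forall s s', (cube x (eta * r x) `&` S) s -> (cube x (eta * r x) `&` S) s' ->
        `|f s - f s'| <= 2 * `|f ss.1 - f ss.2|].
  have [Ax|nA] := pselect (A x); last by exists (0, 0).
  pose P : set R := [set `|f z.1 - f z.2| | z in
     (cube x (eta * r x) `&` S) `*` (cube x (eta * r x) `&` S)].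
  have [s0 hs0] := hS x Ax.
  have rx := r0 x Ax.
  have d0 : 0 < (2 * r x) `^ (p - n%:R) by rewrite powR_gt0// mulr_gt0.
  have l0 : 0 <= lambda.
    have [c1 c2] := hs0; apply: le_trans (cube_pair_le rx (rS x Ax) c2 c2 c1 c1).
    by rewrite divr_ge0 ?powR_ge0.
  have [|a|a [[s s'] [/= hs hs'] <-] ha] := @near_max R P ((lambda * (2 * r x) `^ (p - n%:R))
      `^ p^-1).
  - by exists `|f s0 - f s0|, (s0, s0).
  - move=> [[s s'] [/= [c1 c2] [c3 c4]] <-]; rewrite normr_ge0/=.
    have := cube_pair_le rx (rS x Ax) c2 c4 c1 c3; rewrite ler_pdivrMr// => hl.
    rewrite -[leLHS](@powRK_inv _ _ p) ?gt_eqF//.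
    by apply: ge0_ler_powR; rewrite ?nnegrE ?powR_ge0 ?invr_ge0 ?(ltW p0) ?mulr_ge0 ?(ltW d0).
  - exists (s, s') => _; split => // z z' hz hz'; apply: ha.
    by exists (z, z').
have [ss hss] := choice pairs.
pose a x := `|f (ss x).1 - f (ss x).2|.
have mA : measurable (A : set (lebesgue_rV n)).
  apply: measurable_lebesgue; rewrite -[A]setCK; apply: measurableC; apply: measurable_rV_open.
  by rewrite openC; apply: compact_closed => //; exact: norm_hausdorff.
pose k x := (2 * a x / r' x) `^ p.
pose Q x : set (lebesgue_rV n) := cube x (3 * r' x).
have hk y : A y -> h y `^ p <= \sum_(x <- D) k x * \1_(Q x) y.
  move=> Ay; have [x0 x0E x0y] := AE y Ay.
  have [x xD xx] := cD _ x0E.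
  have yQ : Q x y by apply: xx; rewrite r'E//; exact: EA.
  rewrite (big_rem x)//= indicE mem_set// mulr1.
  apply: (@le_trans _ _ (k x)); last first.
    by rewrite lerDl sumr_ge0// => z _; rewrite mulr_ge0 ?powR_ge0// indicE.
  have Ax := DA x xD; have [c1 c2 c3] := hss x Ax.
  apply: ge0_ler_powR; rewrite ?nnegrE ?(ltW p0)//.
    by apply: divr_ge0; [apply: mulr_ge0 => //; exact: normr_ge0|exact: ltW].
  rewrite r'E//; apply: hh => //.
  by move: yQ; rewrite /Q r'E.
have := @sum_indic_int _ _ _ mu _ D A Q k (fun y => h y `^ p) mA (fun x => measurable_cube _ _)
  (measurable_powR_fun _ mh) (fun y => powR_ge0 _ _) (fun x => powR_ge0 _ _) hk.
move=> /le_trans; apply.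
have hsum := @cube_seq_le D r (fun x => (ss x).1) (fun x => (ss x).2) uD.
have tD' : trivIset [set` D] (fun x => cube x (r x)).
  apply/trivIsetP => x y /= xD yD xy.
  have /trivIsetP := tD; move=> /(_ x y xD yD xy).
  by rewrite !r'E//; exact: DA.
have {}hsum := hsum tD'.
(* The constant: 2^p comes from [near_max], 6^n from the volume (6 r)^n of the 3-dilated cube, and
   2^(p - n) from the diameter 2 r in place of r. *)
apply: (@le_trans _ _ (\sum_(x <- D) (2 `^ p * 6 ^+ n * 2 `^ (p - n%:R) *
    (a x `^ p / (2 * r x) `^ (p - n%:R)))%:E)%E); last first.
  rewrite sumEFin lee_fin -mulr_sumr ler_wpM2l//.
  apply: hsum => x /DA Ax; have [c1 c2 _] := hss x Ax.
  by split => //; [exact: r0|exact: rS].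
rewrite big_seq [leRHS]big_seq; apply: lee_sum => x xD; have Ax := DA x xD.
have rx := r0 x Ax.
have r30 : 0 <= 3 * r x by rewrite mulr_ge0// ltW.
rewrite /Q /k r'E// lebesgue_cube// -EFinM lee_fin.
rewrite le_eqVlt; apply/orP; left; apply/eqP.
have a0 : 0 <= a x by exact: normr_ge0.
rewrite !powRM ?invr_ge0 ?mulr_ge0 ?(ltW rx)//.
rewrite (_ : 2 * (3 * r x) = 6 * r x); last by ring.
rewrite exprMn -(powR_inv1 (ltW rx)) -powRrM mulN1r powRN.
have -> : r x `^ (p - n%:R) = r x `^ p / r x ^+ n.
  by rewrite powRD_gt0// powRN powR_mulrn// ltW.
have : r x `^ p != 0 by rewrite gt_eqF// powR_gt0.
have : r x ^+ n != 0 by rewrite gt_eqF// exprn_gt0.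
have : (2 : R) `^ (p - n%:R) != 0 by rewrite gt_eqF// powR_gt0.
by move=> h1 h2 h3; field; rewrite h1 h2 h3.
Qed.

End covering.

Lemma max0_lip (R : realDomainType) (a b : R) : `|Num.max 0 a - Num.max 0 b| <= `|a - b|.
Proof.
rewrite ler_norml; case: (leP a 0) => ha; case: (leP b 0) => hb;
  have := ler_norm (a - b); have := ler_norm (b - a); rewrite (distrC b a);
  have := normr_ge0 (a - b); lra.
Qed.

Section cone.
Context d (T : measurableType d) {R : realType} (mu : {measure set T -> \bar R}).
Implicit Types (w : T -> R).

Lemma Rintegral_ge_cst w (Q : set T) (c V : R) : measurable Q -> mu Q = V%:E -> 0 <= c ->
  mu.-integrable setT (EFin \o w) -> (forall z, 0 <= w z) -> (forall z, Q z -> c <= w z) ->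
  c * V <= \int[mu]_z w z.
Proof.
move=> mQ QV c0 iw w0 cw.
have mw : measurable_fun setT w by exact/measurable_EFinP/(measurable_int mu iw).
rewrite -lee_fin fineK; last exact: integrable_fin_num iw.
have -> : (c * V)%:E = (\int[mu]_x (c * \1_Q x)%:E)%E.
  by rewrite ge0_intZ// integral_indic// setIT QV.
apply: ge0_le_int => //.
- by apply: measurable_funM => //; exact: measurable_indic.
- by move=> z; rewrite mulr_ge0// indicE.
- move=> z; rewrite indicE; case: (boolP (z \in Q)) => [/set_mem/cw|_]; first by rewrite mulr1.
  by rewrite mulr0.
Qed.

Lemma Rintegral_le_cst w (Q : set T) (c V : R) : measurable Q -> mu Q = V%:E -> 0 <= c ->
  mu.-integrable setT (EFin \o w) -> (forall z, 0 <= w z) -> (forall z, Q z -> w z <= c) ->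
  (forall z, ~ Q z -> w z = 0) ->
  \int[mu]_z w z <= c * V.
Proof.
move=> mQ QV c0 iw w0 cw wQ.
have mw : measurable_fun setT w by exact/measurable_EFinP/(measurable_int mu iw).
rewrite -lee_fin fineK; last exact: integrable_fin_num iw.
have -> : (c * V)%:E = (\int[mu]_x (c * \1_Q x)%:E)%E.
  by rewrite ge0_intZ// integral_indic// setIT QV.
apply: ge0_le_int => //.
- by apply: measurable_funM => //; exact: measurable_indic.
- move=> z; rewrite indicE; case: (boolP (z \in Q)) => [/set_mem/cw|/negP nQ];
    first by rewrite mulr1.
  by rewrite wQ ?mulr0// => Qz; apply: nQ; rewrite inE.
Qed.

End cone.

(** * Averages with conical weights *)

Section cones.
Context {R : realType} {n : nat} (p : R).
Local Notation mu := (@lebesgue R n).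
Hypothesis p1 : 1 < p.
Implicit Types (x z : 'rV[R]_n) (r : R).

(** This weight is 1-Lipschitz in the center and in the radius, so averages depend on both in a
    Lipschitz way; the indicator of a cube lacks that pointwise property. *)
Definition cone x r z := Num.max 0 (r - `|x - z|).

Lemma cone_ge0 x r z : 0 <= cone x r z. Proof. by rewrite le_max lexx. Qed.

Lemma cone_le x r z : 0 <= r -> cone x r z <= r.
Proof. by move=> r0; rewrite ge_max r0/=; have := normr_ge0 (x - z); lra. Qed.

Lemma cone_out x r z : 0 <= r -> cone x r z != 0 -> `|x - z| <= r.
Proof.
move=> r0; rewrite /cone; case: (leP (r - `|x - z|) 0) => [|h _]; last by lra.
by rewrite eqxx.
Qed.

Lemma cone_lip x r z x' r' z' :
  `|cone x r z - cone x' r' z'| <= `|x - x'| + `|r - r'| + `|z - z'|.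
Proof.
apply: le_trans (max0_lip _ _) _.
rewrite (_ : _ - _ = (`|x' - z'| - `|x - z|) + (r - r')); last by ring.
apply: le_trans (ler_normD _ _) _; rewrite addrAC lerD2r.
apply: le_trans (ler_dist_dist _ _) _.
rewrite (_ : _ - _ = (x' - x) + (z - z')).
  by rewrite (distrC x x') ler_normD.
by rewrite opprB addrACA [RHS]addrACA; congr (_ + _); rewrite addrC.
Qed.

Lemma measurable_cone x r : measurable_fun setT (cone x r : lebesgue_rV n -> R).
Proof.
apply: measurable_continuous => z A /nbhs_ballP[e /= e0 hA]; apply/nbhs_ballP; exists e => // y.
rewrite -ball_normE/= => zy; apply: hA; rewrite -ball_normE/=.
by apply: le_lt_trans (cone_lip _ _ _ _ _ _) _; rewrite !subrr !normr0 !add0r.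
Qed.

Lemma integrable_cone (u : @lebesgue_rV R n -> R) x r : 0 <= r -> measurable_fun setT u ->
  (\int[mu]_(z in cube x r) `|u z|%:E < +oo)%E ->
  mu.-integrable setT (EFin \o (fun z => u z * cone x r z)).
Proof.
move=> r0 mu_ uoo.
have [||//|//] := @integrable_supp _ _ _ mu u (cone x r) (cube x r) r (measurable_cube _ _) mu_
  (measurable_cone x r).
- by move=> z; rewrite ger0_norm ?cone_ge0//; exact: cone_le.
- move=> z; rewrite (cubeE _ r0)/= => nz; apply/eqP; apply: contra_notT nz.
  by rewrite distrC; exact: cone_out.
Qed.

Lemma integrable_cone1 x r : 0 <= r -> mu.-integrable setT (EFin \o (cone x r : lebesgue_rV n ->
    R)).
Proof.
move=> r0; rewrite (_ : EFin \o _ = EFin \o (fun z : lebesgue_rV n => 1 * cone x r z)).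
  apply: (integrable_cone (u := cst 1)) => //.
  under eq_integral do rewrite normr1.
  rewrite integral_cst; last exact: measurable_cube.
  by rewrite mul1e lebesgue_cube// ltry.
by apply/funext => z /=; rewrite mul1r.
Qed.

Lemma cone_mass x r : 0 < r -> r / 2 * r ^+ n <= \int[mu]_z (cone x r z : R).
Proof.
move=> r0; have r20 : 0 <= r / 2 by rewrite divr_ge0// ltW.
apply: (@Rintegral_ge_cst _ _ _ mu _ (cube x (r / 2))) => //.
- exact: measurable_cube.
- by rewrite lebesgue_cube// (_ : 2 * (r / 2) = r)//; field.
- by apply: integrable_cone1; exact: ltW.
- by move=> z; exact: cone_ge0.
- move=> z; rewrite (cubeE _ r20)/= distrC => h; rewrite le_max; apply/orP; right.
  move: h; move: (`|x - z|) => N; lra.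
Qed.

Lemma cone_diff x r x' r' t rho : 0 <= r -> 0 <= r' -> 0 <= rho ->
  `|x - x'| + `|r - r'| <= t -> r <= rho -> `|x - x'| + r' <= rho ->
  \int[mu]_z (`|cone x r z - cone x' r' z| : R) <= t * (2 * rho) ^+ n.
Proof.
move=> r0 r'0 rho0 ht hr hr'.
apply: (@Rintegral_le_cst _ _ _ mu _ (cube x rho)) => //.
- exact: measurable_cube.
- exact: lebesgue_cube.
- by apply: le_trans ht; rewrite addr_ge0.
- have := integrable_norm (integrableB measurableT (integrable_cone1 x r0)
    (integrable_cone1 x' r'0)).
  exact.
- move=> z _; apply: le_trans (cone_lip _ _ _ _ _ _) _.
  by rewrite subrr normr0 addr0.
- move=> z; rewrite (cubeE _ rho0)/= => nz; apply/eqP; rewrite normr_eq0 subr_eq0.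
  have -> : cone x r z = 0.
    apply/eqP; apply: contra_notT nz => /(cone_out r0); rewrite distrC => h.
    exact: le_trans h hr.
  rewrite eq_sym; apply: contra_notT nz => /(cone_out r'0) h.
  rewrite distrC; apply: le_trans (ler_distD x' _ _) _.
  by apply: le_trans hr'; rewrite lerD2l.
Qed.

Section averages.
Variable u : @lebesgue_rV R n -> R.
Hypotheses (mu_ : measurable_fun setT u) (uoo : (intp mu p u < +oo)%E).

Lemma integrable_mul_cone x r : 0 <= r -> mu.-integrable setT (EFin \o (fun z => u z * cone x r z)).
Proof.
move=> r0; apply: integrable_cone; [exact: r0|exact: mu_|].
apply: (@int_lt_pinfty _ _ _ mu _ _ p) => //; first exact: measurable_cube.
  by rewrite lebesgue_cube// ltry.
exact: ltW.
Qed.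

Lemma cone_mass_gt0 x r : 0 < r -> 0 < \int[mu]_z (cone x r z : R).
Proof.
by move=> r0; apply: lt_le_trans (cone_mass x r0); rewrite mulr_gt0 ?exprn_gt0// divr_gt0.
Qed.

Lemma wavg_cone_le x r c o : 0 < r -> (forall z, `|x - z| <= r -> `|u z - c| <= o) ->
  `|wavg mu u (cone x r) - c| <= o.
Proof.
move=> r0 h; apply: wavg_le.
- by apply: integrable_cone1; exact: ltW.
- by apply: integrable_mul_cone; exact: ltW.
- by move=> z; exact: cone_ge0.
- exact: cone_mass_gt0.
- by move=> z /(cone_out (ltW r0)); exact: h.
Qed.

(** Moving center and radius by t changes the weight by at most 2 t, on a cube of radius 3 r,
    against a mass of at least (r / 2) r^n: with the factor 2 o of [wavg_diff] this is 8 * 6^n (t /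
    r) o. The radius 3 r holds the second weight because |x - x'| + r' <= r + 2 t. *)
Lemma wavg_cone_diff x r x' r' t c o : 0 < r -> 0 < r' -> `|x - x'| <= t -> `|r - r'| <= t ->
  t <= r -> (forall z, `|x - z| <= 3 * r -> `|u z - c| <= o) ->
  `|wavg mu u (cone x r) - wavg mu u (cone x' r')| <= 8 * 6 ^+ n * (t / r) * o.
Proof.
move=> r0 r'0 xx rr tr h.
have o0 : 0 <= o.
  by apply: le_trans (h x _); rewrite ?subrr ?normr0 ?mulr_ge0// ltW.
have hr' : `|x - x'| + r' <= 3 * r.
  by have := ler_norm (r' - r); rewrite (distrC r' r); move: rr xx tr;
      move: `|r - r'| `|x - x'| => N M; lra.
have t0 : 0 <= t by exact: le_trans xx.
have h1 : `|wavg mu u (cone x r) - wavg mu u (cone x' r')| <=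
    2 * o * \int[mu]_z (`|cone x r z - cone x' r' z| : R) / \int[mu]_z (cone x r z : R).
  apply: (@wavg_diff _ _ _ mu u _ _ c o).
  - by apply: integrable_cone1; exact: ltW.
  - by apply: integrable_cone1; exact: ltW.
  - by apply: integrable_mul_cone; exact: ltW.
  - by apply: integrable_mul_cone; exact: ltW.
  - by move=> z; exact: cone_ge0.
  - exact: cone_mass_gt0.
  - exact: cone_mass_gt0.
  - move=> z [/(cone_out (ltW r0)) xz|/(cone_out (ltW r'0)) xz]; apply: h.
      by apply: le_trans xz _; lra.
    apply: le_trans (ler_distD x' _ _) _; apply: le_trans hr'.
    by rewrite lerD2l.
apply: le_trans h1 _.
have W := cone_mass x r0.
have D : \int[mu]_z (`|cone x r z - cone x' r' z| : R) <= (t + t) * (2 * (3 * r)) ^+ n.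
  apply: cone_diff => //; try exact: ltW.
  - by rewrite mulr_ge0// ltW.
  - exact: lerD.
  - by lra.
have Wpos : 0 < r / 2 * r ^+ n by rewrite mulr_gt0 ?exprn_gt0// divr_gt0.
rewrite ler_pdivrMr; last exact: lt_le_trans W.
apply: (@le_trans _ _ (8 * 6 ^+ n * (t / r) * o * (r / 2 * r ^+ n))); last first.
  apply: ler_wpM2l => //; rewrite !mulr_ge0// ?exprn_ge0// invr_ge0; exact: ltW.
apply: (@le_trans _ _ (2 * o * ((t + t) * (2 * (3 * r)) ^+ n))).
  by apply: ler_wpM2l => //; rewrite mulr_ge0.
rewrite (_ : 2 * (3 * r) = 6 * r); last by ring.
rewrite exprMn le_eqVlt; apply/orP; left; apply/eqP.
have : r != 0 by rewrite gt_eqF.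
by move: (r ^+ n) (6 ^+ n) => a b rn0; field.
Qed.

End averages.

End cones.

Lemma int_bigcup_le d (T : measurableType d) (R : realType) (mu : {measure set T -> \bar R})
    (A : (set T)^nat) (h : T -> R) (C : \bar R) :
  nondecreasing_seq A -> (forall N, measurable (A N)) -> measurable_fun setT h ->
  (forall x, 0 <= h x) -> (forall N, (\int[mu]_(x in A N) (h x)%:E <= C)%E) ->
  (\int[mu]_(x in \bigcup_N A N) (h x)%:E <= C)%E.
Proof.
move=> ndA mA mh h0 hC.
have mhA N : measurable_fun (A N) (EFin \o h).
  by apply: measurable_funTS; exact/measurable_EFinP.
have h0' N x : A N x -> (0 <= (EFin \o h) x)%E by move=> _; rewrite lee_fin.
have cv := @ge0_nondecreasing_set_cvg_integral _ _ _ A (EFin \o h) mu ndA mA mhA h0'.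
rewrite -(cvg_lim _ cv)//; apply: lime_le; first by apply/cvg_ex; eexists; exact: cv.
exact: nearW.
Qed.

Lemma measurable_excess d (T : measurableType d) (R : realType) (u w : T -> R) (a b c : R) :
  measurable_fun setT u -> measurable_fun setT w ->
  measurable_fun setT (fun x => Num.max 0 (u x / a - b * w x) / c).
Proof.
move=> mu_ mw; apply: measurable_funM => //; apply: measurable_maxr => //.
by apply: measurable_funB; apply: measurable_funM.
Qed.

Section intp_tools.
Context d (T : measurableType d) (R : realType) (mu : {measure set T -> \bar R}) (p : R).
Hypothesis p0 : 0 <= p.
Implicit Types (u v : T -> R).

Lemma intp_le_add v u1 u2 : measurable_fun setT v -> measurable_fun setT u1 ->
  measurable_fun setT u2 -> (forall x, `|v x| <= `|u1 x| + `|u2 x|) ->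
  (intp mu p v <= (2 `^ p)%:E * (intp mu p u1 + intp mu p u2))%E.
Proof.
move=> mv m1 m2 h.
have mp u : measurable_fun setT u -> measurable_fun setT (fun x => `|u x| `^ p).
  by move=> mu'; apply: measurable_powR_fun; exact: measurable_normr_fun.
rewrite -ge0_intD; last 4 first.
- exact: mp.
- exact: mp.
- by move=> x; exact: powR_ge0.
- by move=> x; exact: powR_ge0.
rewrite -ge0_intZ; last 3 first.
- exact: powR_ge0.
- by apply: measurable_funD; exact: mp.
- by move=> x; rewrite addr_ge0 ?powR_ge0.
apply: ge0_le_int.
- exact: mp.
- by apply: measurable_funM => //; apply: measurable_funD; exact: mp.
- by move=> x; exact: powR_ge0.
- move=> x; apply: le_trans (powRD_le _ _ p0) => //.
  by apply: ge0_ler_powR; rewrite ?nnegrE ?addr_ge0.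
Qed.

Lemma intpZ (k : R) u : measurable_fun setT u -> 0 <= k ->
  intp mu p (fun x => k * u x) = ((k `^ p)%:E * intp mu p u)%E.
Proof.
move=> mu' k0; rewrite /intp -ge0_intZ; last 3 first.
- exact: powR_ge0.
- by apply: measurable_powR_fun; exact: measurable_normr_fun.
- by move=> x; exact: powR_ge0.
by apply: eq_integral => x _; rewrite normrM (ger0_norm k0) powRM.
Qed.

Lemma intp_indic (A : set T) u : measurable A -> 0 < p -> (forall x, 0 <= u x) ->
  intp mu p (fun x => u x * \1_A x) = (\int[mu]_(x in A) (u x `^ p)%:E)%E.
Proof.
move=> mA p1 u0; rewrite integral_setI_ge0//; apply: eq_integral => x _.
rewrite indicE; case: (x \in A); rewrite ?mulr1 ?mulr0 ?ger0_norm//.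
by rewrite powR0// gt_eqF.
Qed.

End intp_tools.

(** Collects the constants for the difference quotients: P is 2^p, e is (4 / eps)^p, k and t belong
    to the regions far from and near S, a is the integral of |f o T|^p and l is lambda. *)
Lemma quotient_constant (R : realFieldType) (P k t e C a l : R) :
  1 <= P -> 0 <= k -> 0 <= t -> 0 <= e -> 0 <= C -> 0 <= a -> 0 <= l ->
  P * (e * a + P * (k * (C * l) + t * (C * l))) <=
  P * P * (e + k * C + t * C) * (a + l).
Proof.
move=> P1 k0 t0 e0 C0 a0 l0; rewrite -!mulrA ler_pM2l; last exact: lt_le_trans P1.
apply: (@le_trans _ _ (P * (e * a + (k * C * l + t * C * l)))).
  by rewrite (mulrDr P (e * a)) !mulrA lerD2r -mulrA ler_peMl// mulr_ge0.
rewrite ler_pM2l; last exact: lt_le_trans P1.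
have := mulr_ge0 (mulr_ge0 k0 C0) a0; have := mulr_ge0 (mulr_ge0 t0 C0) a0.
by have := mulr_ge0 e0 l0; lra.
Qed.

(** * The extension and its estimates *)

Section extension.
Context {R : realType} {n : nat} (p eps theta lambda : R).
Context (S : set 'rV[R]_n) (T : 'rV[R]_n -> 'rV[R]_n) (f : 'rV[R]_n -> R).
Hypotheses (n0 : (0 < n)%N) (np : n%:R < p) (eps0 : 0 < eps) (theta1 : 1 <= theta).
Hypotheses (cS : closed S) (S0 : S !=set0) (ST : forall x, nbhd eps S x -> S (T x)).
Hypothesis hT : forall x, nbhd eps S x -> (`|T x - x|%:E <= theta%:E * edist_inf S x)%E.
Hypothesis cs : cube_sums_bounded p eps (10 * theta + 1) S f lambda.
Local Notation mu := (@lebesgue R n).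
Local Notation d := (dist S).
Local Notation eta := (10 * theta + 1).

(** Set to 0 off the neighborhood, so that its integrals over the whole space are the integrals of f
    o T over the neighborhood. *)
Definition retract : lebesgue_rV n -> R := (f \o T) \_ (nbhd eps S).
Local Notation fT := retract.
Hypotheses (mfT : measurable_fun setT fT) (fToo : (intp mu p fT < +oo)%E).

Let p1 : 1 < p. Proof. by apply: le_lt_trans np; rewrite ler1n. Qed.
Let p0 : 0 < p. Proof. exact: lt_trans p1. Qed.
Let d0 x : 0 <= d x. Proof. exact: dist_ge0. Qed.
(** The empty family of cubes has sum 0. *)
Let lam0 : 0 <= lambda.
Proof.
have := cs (m := 0) (c := fun=> 0) (r := fun=> 1) (x := fun=> 0) (y := fun=> 0).
by rewrite big_ord0; apply => // -[].
Qed.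
Let le_theta (a : R) : 0 <= a -> a <= theta * a.
Proof. by move=> a0; rewrite ler_peMl. Qed.

Lemma retractP x : d x < eps -> [/\ fT x = f (T x), S (T x) & `|T x - x| <= theta * d x].
Proof.
move=> dx; have hx : nbhd eps S x by exact/nbhd_dist.
split; [by rewrite /retract patchE mem_set|exact: ST|].
by have := hT hx; rewrite edist_inf_dist// lee_fin.
Qed.

(** From |x - z| <= 3/50 d x one gets d z <= 53/50 d x, which stays below eps, and T z is within
    (53/50) theta d x + (3/50) d x <= (28/25) theta d x of x. The factor 3 is that of
    [wavg_cone_diff]. *)
Lemma retract_near x z : d x <= 3 / 4 * eps -> `|x - z| <= 3 * (d x / 50) ->
  [/\ fT z = f (T z), S (T z) & `|T z - x| <= 28 / 25 * (theta * d x)].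
Proof.
move=> dx xz; have dz := dist_lip S0 z x; have := d0 x => dx0.
have h1 : d z <= 53 / 50 * d x.
  by move: dz xz; rewrite (distrC z x); move: (`|x - z|) => N; lra.
have [-> Sz Tz] : [/\ fT z = f (T z), S (T z) & `|T z - z| <= theta * d z].
  apply: retractP; move: eps0; lra.
split => //; apply: le_trans (ler_distD z _ _) _.
have h2 : theta * d z <= 53 / 50 * (theta * d x).
  by rewrite mulrCA ler_wpM2l//; move: theta1; lra.
have h3 := le_theta dx0.
by move: xz; rewrite (distrC x z) => xz; lra.
Qed.

(* 1/50 makes all values averaged at x come from points of S at distance at most
   28/25 theta (d x), hence from the eta-dilations of the cubes of radius d / 4
   (or 10 t, near S) used in the coverings: this is where eta = 10 theta + 1 is
   used. *)
Definition extend0 x : R := if d x == 0 then f x else wavg mu fT (cone x (d x / 50)).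
Local Notation E := extend0.

Lemma extend0_le x c o : d x <= 3 / 4 * eps ->
  (forall s, S s -> `|s - x| <= 28 / 25 * (theta * d x) -> `|f s - c| <= o) ->
  `|E x - c| <= o.
Proof.
move=> dx h; rewrite /extend0; case: eqP => [/(dist_eq0 S0 _ cS) Sx|/eqP dx0].
  by apply: h; rewrite // subrr normr0 !mulr_ge0//; move: theta1; lra.
have {}dx0 : 0 < d x by rewrite lt_neqAle eq_sym dx0 d0.
apply: (@wavg_cone_le _ _ p) => //; first by rewrite divr_gt0.
move=> z xz; have [|-> Sz Tz] := @retract_near x z dx; last exact: h.
by apply: le_trans xz _; lra.
Qed.

(** The distance is 1-Lipschitz, so center and radius of the averaging weight both move by at most
    t; 50 t <= d x says that t does not exceed the radius. The constant 400 is 8 * 50. *)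
Lemma extend0_diff x x' t c o : 0 < d x -> d x <= 3 / 4 * eps -> `|x - x'| <= t ->
  50 * t <= d x ->
  (forall s, S s -> `|s - x| <= 28 / 25 * (theta * d x) -> `|f s - c| <= o) ->
  `|E x - E x'| <= 400 * 6 ^+ n * (t / d x) * o.
Proof.
move=> dx0 dx xx tx h; have dl := dist_lip S0 x x'; have dn := dist_lip_norm S0 x x'.
have dx'0 : 0 < d x' by lra.
rewrite /extend0 !gt_eqF// (_ : 400 * 6 ^+ n * (t / d x) = 8 * 6 ^+ n * (t / (d x / 50)));
    last first.
  by have : d x != 0 by [rewrite gt_eqF]; move: (6 ^+ n) => a dne; field.
apply: (@wavg_cone_diff _ _ p _ _ _ _ _ _ _ _ _ c) => //; try by rewrite divr_gt0.
- rewrite -mulrBl normrM (gtr0_norm (_ : 0 < (50 : R)^-1)) ?invr_gt0//.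
  have := le_trans dn xx; have := normr_ge0 (d x - d x'); lra.
- lra.
- move=> z xz; have [//|-> Sz Tz] := @retract_near x z dx; exact: h.
Qed.

(** What the hypothesis yields for a single cube of radius r. It tends to 0 with r because p > n,
    which gives the continuity of the extension on S. *)
Definition osc r := (lambda * (2 * r) `^ (p - n%:R)) `^ p^-1.

Lemma osc_le x (r : R) s s' : 0 < r -> cube x r `<=` nbhd eps S -> S s -> S s' ->
  `|s - x| <= eta * r -> `|s' - x| <= eta * r -> `|f s - f s'| <= osc r.
Proof.
move=> r0 xr Ss Ss' xs xs'.
have er0 : 0 <= eta * r by exact: le_trans xs.
have := cube_pair_le n0 cs (x := x) (r := r) (s := s) (s' := s') r0 xr Ss Ss'. 
have h0 : 0 < (2 * r) `^ (p - n%:R) by rewrite powR_gt0// mulr_gt0.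
rewrite (cubeE _ er0)/= => /(_ xs xs'); rewrite ler_pdivrMr// => hl.
rewrite -[leLHS](@powRK_inv _ _ p) ?gt_eqF//.
by apply: ge0_ler_powR; rewrite ?nnegrE ?powR_ge0 ?invr_ge0 ?(ltW p0) ?mulr_ge0 ?(ltW h0).
Qed.

Lemma osc_small (e : R) : 0 < e -> exists r, [/\ 0 < r, r < eps & osc r <= e].
Proof.
move=> e0; have l1 : 0 < lambda + 1 by move: lam0; lra.
have E0 := eps0.
have pn : 0 < p - n%:R by rewrite subr_gt0.
pose a := e `^ p / (lambda + 1).
have a0 : 0 < a by rewrite divr_gt0// powR_gt0.
pose b := a `^ (p - n%:R)^-1.
have b0 : 0 < b by rewrite powR_gt0.
exists (Num.min (b / 2) (eps / 2)).
have r0 : 0 < Num.min (b / 2) (eps / 2) by rewrite lt_min !divr_gt0.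
have rb : Num.min (b / 2) (eps / 2) <= b / 2 by rewrite ge_min lexx.
have re : Num.min (b / 2) (eps / 2) <= eps / 2 by rewrite ge_min lexx orbT.
move: (Num.min _ _) r0 rb re => r r0 rb re; split => //; first lra.
rewrite /osc -[leRHS](@powRK_inv _ _ p) ?gt_eqF ?(ltW e0)//.
apply: ge0_ler_powR; rewrite ?nnegrE ?powR_ge0 ?invr_ge0 ?(ltW p0) ?mulr_ge0 ?powR_ge0//.
apply: (@le_trans _ _ ((lambda + 1) * a)); last by rewrite /a mulrC divfK// gt_eqF.
apply: ler_pM; rewrite ?powR_ge0//; first lra.
rewrite -[leRHS](@powR_invK _ _ (p - n%:R)) ?(ltW a0) ?gt_eqF//.
apply: ge0_ler_powR; rewrite ?nnegrE ?(ltW pn) ?mulr_ge0 ?(ltW r0) ?(ltW b0)//.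
by rewrite -/b; lra.
Qed.

(** At a point of S the nearby values are averages of f over points of S inside one dilated cube of
    small radius, and [osc_small] applies. Off S the averages are locally Lipschitz by
    [extend0_diff]. *)
Lemma extend0_continuous x : d x <= 7 / 10 * eps -> {for x, continuous E}.
Proof.
move=> dx A; have E0 := eps0; have t1 := theta1; case/nbhs_ballP=> [e /= e0 hA]; apply/nbhs_ballP.
suff [r r0 hr] : exists2 r, 0 < r & forall y, `|x - y| < r -> `|E x - E y| < e.
  exists r => // y; rewrite -ball_normE/= => /hr xy; apply: hA.
  by rewrite -ball_normE.
have := d0 x; rewrite le_eqVlt => /orP[/eqP dx0|dx0].
  have Sx : S x by apply/(dist_eq0 S0 _ cS).
  have e20 : 0 < e / 2 by rewrite divr_gt0.
  have [r [r0 re hr]] := osc_small e20; exists (r / 2); first by rewrite divr_gt0.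
  move=> y xy; have dy := dist_lip S0 y x; rewrite -dx0 (distrC y x) in dy.
  have -> : E x = f x by rewrite /extend0 -dx0 eqxx.
  rewrite distrC; apply: (@le_lt_trans _ _ (e / 2)); last lra.
  have dy0 := d0 y; have hth := le_theta (ltW r0).
  apply: extend0_le => [|s Ss sy]; first lra.
  apply: le_trans hr; apply: (@osc_le x) => //.
  - by apply: cube_nbhd => //; [exact: ltW|rewrite -dx0; lra].
  - apply: le_trans (ler_distD y _ _) _.
    have : theta * d y <= theta * (r / 2) by rewrite ler_wpM2l//; lra.
    rewrite (distrC y x) mulrDl mul1r -mulrA; lra.
  - by rewrite subrr normr0 mulr_ge0//; lra.
have r40 : 0 < d x / 4 by rewrite divr_gt0.
pose K : R := 400 * 6 ^+ n / d x * osc (d x / 4).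
have K0 : 0 <= K.
  apply: mulr_ge0; last exact: powR_ge0.
  apply: divr_ge0; last exact: ltW.
  by apply: mulr_ge0; [exact: ler0n|apply: exprn_ge0; exact: ler0n].
exists (Num.min (d x / 50) (e / (K + 1))).
  by rewrite lt_min !divr_gt0//; lra.
move=> y; rewrite lt_min => /andP[xy xy'].
have [||_ STx Tx] := @retract_near x x; first lra.
  by rewrite subrr normr0 mulr_ge0// divr_ge0.
have hth := le_theta (ltW dx0).
apply: (@le_lt_trans _ _ (K * `|x - y|)).
  rewrite (_ : K * `|x - y| = 400 * 6 ^+ n * (`|x - y| / d x) * osc (d x / 4)); last first.
    rewrite /K; move: (osc _) (6 ^+ n) => a b; rewrite !mulrA; lra.
  apply: (@extend0_diff x y _ (f (T x))) => //; try lra.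
  move=> s Ss sx; apply: (@osc_le x) => //; try lra.
  by apply: cube_nbhd => //; lra.
apply: (@le_lt_trans _ _ (K * (e / (K + 1)))); first by rewrite ler_wpM2l// ltW.
have aux (k : R) : 0 <= k -> k * (e / (k + 1)) < e.
  by move=> k0; rewrite mulrCA gtr_pMr// ltr_pdivrMr ?mul1r//; lra.
exact: aux.
Qed.

Definition cutoff (s : R) : R := Num.max 0 (1 - Num.max 0 (4 * s / eps - 1)).

Let div_eps (s : R) : 4 * s / eps = 4 * (s / eps). Proof. by rewrite mulrA. Qed.

Lemma cutoff_ge0 s : 0 <= cutoff s. Proof. by rewrite le_max lexx. Qed.

Lemma cutoff_le1 s : cutoff s <= 1. Proof. by rewrite ge_max ler01 gerBl le_max lexx. Qed.

Lemma cutoff1 s : s <= eps / 4 -> cutoff s = 1.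
Proof.
move=> h; have {}h : s / eps <= 4^-1 by rewrite ler_pdivrMr// mulrC.
have e : Num.max 0 (4 * (s / eps) - 1) = 0 by apply: max_l; lra.
by rewrite /cutoff div_eps e subr0 max_r.
Qed.

Lemma cutoff0 s : eps / 2 <= s -> cutoff s = 0.
Proof.
move=> h; have {}h : 2^-1 <= s / eps by rewrite ler_pdivlMr// mulrC.
by rewrite /cutoff max_l// subr_le0 le_max div_eps; apply/orP; right; lra.
Qed.

Lemma cutoff_lip s s' : `|cutoff s - cutoff s'| <= 4 / eps * `|s - s'|.
Proof.
rewrite /cutoff !div_eps.
have -> : 4 / eps * `|s - s'| = `|4 * (s / eps) - 4 * (s' / eps)|.
  rewrite -mulrBr -mulrBl !normrM normfV (gtr0_norm eps0) (gtr0_norm (_ : 0 < 4 :> R))//.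
  by rewrite mulrAC mulrA.
move: (4 * (s / eps)) (4 * (s' / eps)) => a b; apply: le_trans (max0_lip _ _) _.
rewrite (_ : _ - _ = Num.max 0 (b - 1) - Num.max 0 (a - 1)); last by ring.
by apply: le_trans (max0_lip _ _) _; rewrite opprB addrA subrK distrC.
Qed.

Definition extend x : R := cutoff (d x) * E x.
Local Notation F := extend.

Lemma extend_out x : eps / 2 <= d x -> F x = 0.
Proof. by move=> /cutoff0 h; rewrite /extend h mul0r. Qed.

Lemma extend_on x : S x -> F x = f x.
Proof.
move=> /(dist_eq0 S0 x cS) dx; rewrite /extend /extend0 dx eqxx cutoff1 ?mul1r//.
by rewrite divr_ge0// ltW.
Qed.

Lemma extend_continuous : continuous F.
Proof.
have E0 := eps0; move=> x; have [dx|dx] := leP (d x) (7 / 10 * eps).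
  suff h1 : {for x, continuous (cutoff \o d)}.
    exact: (continuousM h1 (extend0_continuous dx)).
  move=> A /nbhs_ballP[e /= e0 hA]; apply/nbhs_ballP; exists (e * eps / 4).
    by rewrite /= divr_gt0// mulr_gt0.
  move=> y; rewrite -ball_normE/= => xy; apply: hA; rewrite -ball_normE/=.
  apply: le_lt_trans (cutoff_lip _ _) _.
  apply: le_lt_trans (ler_wpM2l _ (dist_lip_norm S0 x y)) _; first by rewrite divr_ge0// ltW.
  rewrite (_ : e = 4 / eps * (e * eps / 4)); last by field; rewrite gt_eqF.
  by rewrite ltr_pM2l// divr_gt0.
(* Here d x > 7/10 eps, so d > eps / 2 on the ball of radius eps / 5, where the cutoff vanishes. *)
move=> A /nbhs_ballP[e /= e0 hA]; apply/nbhs_ballP; exists (eps / 5); first by rewrite /= divr_gt0.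
move=> y; rewrite -ball_normE/= => xy; apply: hA; rewrite -ball_normE/=.
have := dist_lip S0 x y => dy.
rewrite !extend_out ?subrr ?normr0//; last lra.
by move: dy xy; move: (`|x - y|) => N; lra.
Qed.

(** Passes from the oscillation of f on the eta-dilation of the cube of radius d x / 4 to every y of
    its 3-dilation, the form in which the covering argument needs it. *)
Lemma extend_le x y o : d x <= 3 / 4 * eps -> d y <= 3 / 4 * eps -> `|y - x| <= 3 / 4 * d x ->
  (forall s s', S s -> S s' -> `|s - x| <= eta * (d x / 4) -> `|s' - x| <= eta * (d x / 4) ->
    `|f s - f s'| <= o) ->
  (forall s, S s -> `|s - y| <= 28 / 25 * (theta * d y) -> `|f s - f (T y)| <= o) /\ fT y = f (T y).
Proof.
move=> dx dy xy h; have E0 := eps0; have t1 := theta1.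
have hd := dist_lip S0 y x.
have dxt := le_theta (d0 x); have dyt := le_theta (d0 y).
(* As d y <= 7/4 d x, the distance from s to x is at most (49/25) theta d x + (3/4) d x, and theta
   >= 1 makes this at most (10 theta + 1) d x / 4. Here the size of eta matters. *)
have key s : `|s - y| <= 28 / 25 * (theta * d y) -> `|s - x| <= eta * (d x / 4).
  move=> sy; apply: le_trans (ler_distD y _ _) _.
  have : theta * d y <= theta * (7 / 4 * d x).
    by rewrite ler_wpM2l//; [lra|move: hd xy; move: (`|y - x|) => N; lra].
  have -> : theta * (7 / 4 * d x) = 7 / 4 * (theta * d x) by ring.
  have -> : eta * (d x / 4) = 10 / 4 * (theta * d x) + d x / 4 by field.
  move: sy xy (d0 x) (d0 y) dxt; move: (`|s - y|) (`|y - x|) (theta * d x) (theta * d y) (d x)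
      (d y).
  by move=> a1 a2 a3 a4 a5 a6; lra.
have [||-> Sy Ty] := @retract_near y y; first lra.
  by rewrite subrr normr0 mulr_ge0// divr_ge0.
by split => // s Ss sy; apply: h => //; apply: key.
Qed.

Lemma extend_bound x y o : d x <= 3 / 4 * eps -> d y <= 3 / 4 * eps -> `|y - x| <= 3 / 4 * d x ->
  (forall s s', S s -> S s' -> `|s - x| <= eta * (d x / 4) -> `|s' - x| <= eta * (d x / 4) ->
    `|f s - f s'| <= o) ->
  `|F y| <= `|fT y| + o.
Proof.
move=> dx dy xy h; have [hc ->] := extend_le dx dy xy h.
have := extend0_le dy hc; rewrite /extend normrM (ger0_norm (cutoff_ge0 _)) => h1.
apply: (@le_trans _ _ `|E y|); first by rewrite ler_piMl// cutoff_le1.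
by rewrite -lerBlDl; apply: le_trans h1; exact: lerB_dist.
Qed.

(** Product rule: the increment of the cutoff multiplies |E y| <= |fT y| + o, and the increment of
    the average gains the factor t / d y over the oscillation. *)
Lemma extend_diff x y v t o : d x <= 3 / 4 * eps -> d y <= 3 / 4 * eps -> `|y - x| <= 3 / 4 * d x ->
  (forall s s', S s -> S s' -> `|s - x| <= eta * (d x / 4) -> `|s' - x| <= eta * (d x / 4) ->
    `|f s - f s'| <= o) ->
  0 < t -> 50 * t <= d y -> `|v| <= t ->
  `|F (y + v) - F y| <= 4 / eps * t * (`|fT y| + o) + 400 * 6 ^+ n * (t / d y) * o.
Proof.
move=> dx dy xy h t0 ty vt; have [hc ->] := extend_le dx dy xy h.
have dy0 : 0 < d y by lra.
have yv : `|y - (y + v)| <= t by rewrite opprD addrA subrr sub0r normrN.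
have h2 := extend0_diff dy0 dy yv ty hc.
have := extend0_le dy hc => h1.
have h3 : `|E y| <= `|f (T y)| + o.
  by rewrite -lerBlDl; apply: le_trans h1; exact: lerB_dist.
rewrite /extend (_ : _ - _ = (cutoff (d (y + v)) - cutoff (d y)) * E y -
  cutoff (d (y + v)) * (E y - E (y + v))); last by ring.
apply: le_trans (ler_normB _ _) _; rewrite !normrM; apply: lerD.
  apply: ler_pM => //; apply: le_trans (cutoff_lip _ _) _.
  apply: ler_wpM2l; first by rewrite divr_ge0// ltW.
  by apply: le_trans (dist_lip_norm S0 _ _) _; rewrite distrC.
apply: le_trans h2; rewrite (ger0_norm (cutoff_ge0 _)).
by rewrite ler_piMl// cutoff_le1.
Qed.

(** At this scale averaging gains nothing, and both values are compared through one cube of radius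
    10 t: its eta-dilation has radius 100 theta t + 10 t, more than the required (28/25) 51 theta t
    + 31 t. The bound t <= eps / 300 keeps y and y + v where the cutoff is 1. *)
Lemma extend_near x y v t o : d x <= 50 * t -> d y <= 50 * t -> `|y - x| <= 30 * t ->
  0 < t -> t <= eps / 300 -> `|v| <= t ->
  (forall s s', S s -> S s' -> `|s - x| <= eta * (10 * t) -> `|s' - x| <= eta * (10 * t) ->
    `|f s - f s'| <= o) ->
  `|F (y + v) - F y| <= o.
Proof.
move=> dx dy xy t0 te vt h; have E0 := eps0; have t1 := theta1.
have dyv := dist_lip S0 (y + v) y; rewrite (_ : y + v - y = v) in dyv; last by rewrite addrC addKr.
have dyv' : d (y + v) <= 51 * t by lra.
have tt := le_theta (ltW t0).
have key (z s : 'rV[R]_n) : d z <= 51 * t -> `|z - x| <= 31 * t ->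
    `|s - z| <= 28 / 25 * (theta * d z) -> `|s - x| <= eta * (10 * t).
  move=> dz zx sz; apply: le_trans (ler_distD z _ _) _.
  have : theta * d z <= theta * (51 * t) by rewrite ler_wpM2l//; lra.
  have -> : theta * (51 * t) = 51 * (theta * t) by ring.
  have -> : eta * (10 * t) = 100 * (theta * t) + 10 * t by ring.
  move: sz zx tt t0; move: (`|s - z|) (`|z - x|) (theta * d z) (theta * t).
  by move=> a1 a2 a3 a4; lra.
have yvx : `|y + v - x| <= 31 * t.
  by rewrite addrAC; apply: le_trans (ler_normD _ _) _; lra.
rewrite /extend !cutoff1 ?mul1r; [|lra|lra].
apply: extend0_le; first lra.
move=> s Ss sy; rewrite distrC; apply: extend0_le; first lra.
move=> s' Ss' sy'; apply: h => //; [apply: (key y)|apply: (key (y + v))] => //; lra.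
Qed.

Let K400 : 0 <= 400 * 6 ^+ n :> R.
Proof. by apply: mulr_ge0; [exact: ler0n|apply: exprn_ge0; exact: ler0n]. Qed.

Let C0 : R := 2 `^ p * 6 ^+ n * 2 `^ (p - n%:R).

Definition slab (a b : R) : set 'rV[R]_n := [set x | a <= d x <= b].

Lemma closed_slab a b : closed (slab a b).
Proof.
rewrite (_ : slab a b = d @^-1` [set y | a <= y] `&` d @^-1` [set y | y <= b]).
  apply: closedI; apply: preimage_closed; try exact: closed_ge; try exact: closed_le.
    by move=> x _; exact: continuous_dist.
  by move=> x _; exact: continuous_dist.
by apply/seteqP; split => x /=; [move/andP|move=> [? ?]; apply/andP].
Qed.

Lemma measurable_slab a b : measurable (slab a b : set (lebesgue_rV n)).
Proof.
apply: measurable_lebesgue; rewrite -[slab a b]setCK; apply: measurableC.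
by apply: measurable_rV_open; rewrite openC; exact: closed_slab.
Qed.

(** [covering_le] requires a compact set, so the closed slab is exhausted by its intersections with
    growing cubes. The condition d x < eta r x puts a point of S into each dilated cube. *)
Lemma covering_slab (a b : R) (r : 'rV[R]_n -> R) (h : lebesgue_rV n -> R) :
  (forall x, slab a b x -> [/\ 0 < r x, d x + r x < eps & d x < eta * r x]) ->
  measurable_fun setT h -> (forall x, 0 <= h x) ->
  (forall x y o, slab a b x -> slab a b y -> `|y - x| <= 3 * r x ->
     (forall s s', S s -> S s' -> `|s - x| <= eta * r x -> `|s' - x| <= eta * r x ->
        `|f s - f s'| <= o) -> h y <= o / r x) ->
  (\int[mu]_(x in slab a b) (h x `^ p)%:E <= (C0 * lambda)%:E)%E.
Proof.
move=> hr mh h0 hh; have t1 := theta1.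
have mhp : measurable_fun setT (fun x => h x `^ p) by exact: measurable_powR_fun.
pose A N : set (lebesgue_rV n) := slab a b `&` cube 0 N%:R.
have AT : slab a b = \bigcup_N A N.
  by rewrite -setI_bigcupr bigcup_cube setIT.
have mA N : measurable (A N).
  by apply: measurableI; [exact: measurable_slab|exact: measurable_cube].
rewrite [X in (\int[mu]_(x in X) _)%E]AT.
have ndA : nondecreasing_seq A.
  move=> N M NM; rewrite subsetEset; apply: setIS; apply: cube_sub => //.
  by rewrite subrr normr0 add0r ler_nat.
apply: (@int_bigcup_le _ _ _ mu A (fun x => h x `^ p)) => // [x|N]; [exact: powR_ge0|];
    apply: (@covering_le _ _ p eps eta lambda S f n0 np cs _ r) => //.
- have cl : closed (slab a b `&` cube (0 : 'rV[R]_n) N%:R).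
    apply: closedI; [exact: closed_slab|apply: compact_closed; last exact: compact_cube].
    exact: norm_hausdorff.
  exact: (subclosed_compact cl (@compact_cube _ _ _ _) (@subIsetr _ _ _)).
- by move=> x [/hr[]].
- by move=> x [/hr[r0 dr _] _]; apply: cube_nbhd => //; exact: ltW.
- move=> x [/hr[r0 _ er] _]; have e0 : 0 < eta * r x - d x by rewrite subr_gt0.
  have [s Ss sx] := dist_adherent S0 x e0; exists s; split => //.
  have er0 : 0 <= eta * r x by rewrite mulr_ge0 ?(ltW r0)//; lra.
  by rewrite (cubeE _ er0)/= distrC ltW//; move: sx; rewrite [d x + _]addrC subrK.
- move=> x y o [Ax _] [Ay _]; have [r0 _ _] := hr x Ax.
  have r30 : 0 <= 3 * r x by rewrite mulr_ge0// ltW.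
  have er0 : 0 <= eta * r x by rewrite mulr_ge0 ?(ltW r0)//; lra.
  rewrite (cubeE _ r30) (cubeE _ er0)/= => xy hs; apply: hh => // s s' Ss Ss' sx sx'.
  exact: hs.
Qed.

Lemma measurable_extend : measurable_fun setT (F : lebesgue_rV n -> R).
Proof. by apply: measurable_continuous; exact: extend_continuous. Qed.

Lemma measurable_extend_sub (v : 'rV[R]_n) :
  measurable_fun setT (fun x : lebesgue_rV n => F ((x : 'rV[R]_n) + v) - F x : R).
Proof.
apply: measurable_funB; last exact: measurable_extend.
apply: (@measurable_continuous _ _ (fun x : 'rV[R]_n => F (x + v))) => x.
apply: (@continuous_comp _ _ _ (fun x : 'rV[R]_n => x + v) F); last exact: extend_continuous.
move=> A /nbhs_ballP[e e0 hA]; apply/nbhs_ballP; exists e => // y.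
rewrite -ball_normE/= => xy; apply: hA; rewrite -ball_normE/=.
by rewrite opprD addrACA subrr addr0.
Qed.

Lemma measurable_extend_diff (v : 'rV[R]_n) :
  measurable_fun setT (fun x : lebesgue_rV n => `|F ((x : 'rV[R]_n) + v) - F x| : R).
Proof. by apply: measurable_normr_fun; exact: measurable_extend_sub. Qed.

Lemma measurable_excess_diff (v : 'rV[R]_n) (t k : R) : measurable_fun setT
  (fun x : lebesgue_rV n =>
    Num.max 0 (`|F ((x : 'rV[R]_n) + v) - F x| / t - 4 / eps * `|fT x|) / k : R).
Proof.
apply: (@measurable_excess _ (lebesgue_rV n) R (fun x : lebesgue_rV n => `|F ((x : 'rV[R]_n) + v)
    - F x|)
  (fun x => `|fT x|)); first exact: measurable_extend_diff.
by apply: measurable_normr_fun; exact: mfT.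
Qed.

Let max0_div (a b c : R) : 0 < c -> 0 <= b -> a <= c * b -> Num.max 0 a / c <= b.
Proof. by move=> c0 b0 ab; rewrite ler_pdivrMr// mulrC ge_max ab mulr_ge0// ltW. Qed.

(** |F| may exceed |f o T| at the same point, but by at most the oscillation o, and o / eps <= o /
    (d / 4). The slabs that exhaust the region avoid S so that the radii d / 4 are positive. *)
Lemma excess_le : (\int[mu]_(x in [set x | (0 < d x <= 3 / 4 * eps)%R])
  ((Num.max 0 (`|F x|%R - `|fT x|%R)%R / eps)%R `^ p)%:E <= (C0 * lambda)%:E)%E.
Proof.
have E0 := eps0; have t1 := theta1.
pose h (x : lebesgue_rV n) : R := Num.max 0 (`|F x| - `|fT x|) / eps.
have mh : measurable_fun setT (h : lebesgue_rV n -> R).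
  apply: measurable_funM; last exact: measurable_cst.
  apply: measurable_maxr; first exact: measurable_cst.
  by apply: measurable_funB; apply: measurable_normr_fun; [exact: measurable_extend|exact: mfT].
have mhp : measurable_fun setT (fun x => h x `^ p) by exact: measurable_powR_fun.
pose A N : set (lebesgue_rV n) := slab N.+1%:R^-1 (3 / 4 * eps).
have AT : [set x | 0 < d x <= 3 / 4 * eps] = \bigcup_N A N.
  apply/seteqP; split => x /=.
    move=> /andP[dx0 dx]; exists (Num.truncn (d x)^-1) => //; rewrite /A/slab/= dx andbT.
    by rewrite -[leRHS]invrK lef_pV2 ?posrE ?invr_gt0//; exact/ltW/truncnS_gt.
  by move=> [N _ /andP[h1 ->]]; rewrite andbT; apply: lt_le_trans h1.
have mA N : measurable (A N) by exact: measurable_slab.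
rewrite [X in (\int[mu]_(x in X) _)%E]AT.
have Apos N x : A N x -> 0 < d x by move=> /andP[h1 _]; apply: lt_le_trans h1.
have ndA : nondecreasing_seq A.
  move=> N M NM; rewrite subsetEset => x /andP[h1 h2]; rewrite /A/slab/= h2 andbT.
  by apply: le_trans h1; rewrite lef_pV2 ?posrE// ler_nat ltnS.
apply: (@int_bigcup_le _ _ _ mu A (fun x => h x `^ p)) => // [x|N]; [exact: powR_ge0|];
    apply: (@covering_slab _ _ (fun x => d x / 4)) => //.
- move=> x Ax; have dx0 := Apos _ _ Ax; have /andP[_ dx] := Ax.
  have := le_theta (ltW dx0); rewrite mulrDl mul1r => hth.
  split; [by rewrite divr_gt0|lra|].
  by move: hth; rewrite (_ : 10 * theta * (d x / 4) = 10 / 4 * (theta * d x)); [lra|field].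
- by move=> x; rewrite divr_ge0 ?le_max ?lexx// ltW.
- move=> x y o Ax Ay xy ho; have dx0 := Apos _ _ Ax.
  have /andP[_ dx] := Ax; have /andP[_ dy] := Ay.
  have xy' : `|y - x| <= 3 / 4 * d x by lra.
  have := extend_bound dx dy xy' ho => hF.
  have o0 : 0 <= o.
    have [||_ STx Tx] := @retract_near x x; first lra.
      by rewrite subrr normr0 mulr_ge0// divr_ge0.
    have hth := le_theta (ltW dx0).
    have Tx' : `|T x - x| <= eta * (d x / 4) by lra.
    by have := ho _ _ STx STx Tx' Tx'; rewrite subrr normr0.
  have r0 : 0 < d x / 4 by rewrite divr_gt0.
  apply: max0_div => //; first by rewrite divr_ge0// ltW.
  apply: (@le_trans _ _ o); first by rewrite lerBlDl.
  by rewrite mulrA ler_pdivlMr// mulrC ler_wpM2r//; lra.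
Qed.

(** The term (4 / eps) |f o T| of [extend_diff] is in L_p by itself and is subtracted. What remains,
    4 o / eps + 400 * 6^n o / d y, is at most (4 + 400 * 6^n) o / (d x / 4), because d x / 4 is at
    most eps and, on the 3-dilated cube, at most d y. *)
Lemma excess_diff_le (v : 'rV[R]_n) t : 0 < t -> t <= eps / 300 -> `|v| <= t ->
  (\int[mu]_(x in slab (50 * t) (3 / 4 * eps))
    ((Num.max 0 (`|F (x + v) - F x|%R / t - 4 / eps * `|fT x|%R)%R / (4 + 400 * 6 ^+ n))%R `^ p)%:E
    <= (C0 * lambda)%:E)%E.
Proof.
move=> t0 te vt; have E0 := eps0; have t1 := theta1.
pose K : R := 400 * 6 ^+ n.
have K0 : 0 <= K := K400.
have K4 : 0 < 4 + K by lra.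
rewrite -/K; have KE : 400 * 6 ^+ n = K by []; clearbody K.
pose h (x : lebesgue_rV n) : R := Num.max 0 (`|F ((x : 'rV[R]_n) + v)
    - F x| / t - 4 / eps * `|fT x|) / (4 + K).
apply: (@covering_slab _ _ (fun x => d x / 4) h).
- move=> x /andP[dx1 dx]; have dx0 : 0 < d x by lra.
  have := le_theta (ltW dx0); rewrite mulrDl mul1r => hth.
  split; [by rewrite divr_gt0|lra|].
  by move: hth; rewrite (_ : 10 * theta * (d x / 4) = 10 / 4 * (theta * d x)); [lra|field].
- exact: measurable_excess_diff.
- by move=> x; rewrite divr_ge0 ?le_max ?lexx// ltW.
- move=> x y o /andP[dx1 dx] /andP[dy1 dy] xy ho; have dx0 : 0 < d x by lra.
  have dy0 : 0 < d y by lra.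
  have xy' : `|y - x| <= 3 / 4 * d x by lra.
  have := extend_diff dx dy xy' ho t0 dy1 vt => hF.
  have o0 : 0 <= o.
    have [||_ STx Tx] := @retract_near x x; first lra.
      by rewrite subrr normr0 mulr_ge0// divr_ge0.
    have hth := le_theta (ltW dx0).
    have Tx' : `|T x - x| <= eta * (d x / 4) by lra.
    by have := ho _ _ STx STx Tx' Tx'; rewrite subrr normr0.
  have r0 : 0 < d x / 4 by rewrite divr_gt0.
  apply: max0_div => //; first by rewrite divr_ge0// ltW.
  rewrite lerBlDl ler_pdivrMr//; apply: le_trans hF _.
  have hd := dist_lip S0 x y.
  have ry : d x / 4 <= d y by rewrite (distrC x y) in hd; lra.
  have oo : o / d y <= o / (d x / 4) by rewrite ler_wpM2l// lef_pV2.
  have oe : o / eps <= o / (d x / 4) by rewrite ler_wpM2l// lef_pV2 ?posrE//; lra.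
  move: (o / (d x / 4)) oo oe => w oo oe.
  rewrite KE.
  rewrite (_ : _ + _ = (4 / eps * `|fT y| + (4 * (o / eps) + K * (o / d y))) * t); last first.
    by have : d y != 0 /\ eps != 0 by [split; rewrite gt_eqF]; case=> ? ?; field; apply/andP.
  rewrite ler_wpM2r ?(ltW t0)// lerD2l (_ : (4 + K) * w = 4 * w + K * w); last by ring.
  by apply: lerD; apply: ler_wpM2l.
Qed.

(** The distance to S may vanish here, so the covering cubes have the constant radius 10 t, whose
    3-dilation is the 30 t of [extend_near]. *)
Lemma near_diff_le (v : 'rV[R]_n) t : 0 < t -> t <= eps / 300 -> `|v| <= t ->
  (\int[mu]_(x in slab 0 (50 * t))
    ((`|F (x + v) - F x|%R / t / 10)%R `^ p)%:E <= (C0 * lambda)%:E)%E.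
Proof.
move=> t0 te vt; have E0 := eps0; have t1 := theta1.
have tt := le_theta (ltW t0).
pose h (x : lebesgue_rV n) : R := `|F ((x : 'rV[R]_n) + v) - F x| / t / 10.
apply: (@covering_slab _ _ (fun x => 10 * t) h).
- move=> x /andP[dx1 dx]; split; [lra|lra|].
  by rewrite mulrDl mul1r (_ : 10 * theta * (10 * t) = 100 * (theta * t)); [lra|ring].
- apply: measurable_funM; last exact: measurable_cst.
  apply: measurable_funM; last exact: measurable_cst.
  exact: measurable_extend_diff.
- by move=> x; rewrite divr_ge0// divr_ge0// ltW.
- move=> x y o /andP[dx1 dx] /andP[dy1 dy] xy ho.
  have xy' : `|y - x| <= 30 * t by lra.
  have hF := extend_near dx dy xy' t0 te vt ho.
  rewrite /h !ler_pdivrMr// (_ : o / (10 * t) * 10 * t = o)//.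
  by field; rewrite gt_eqF.
Qed.

Lemma extend_intp (a : R) : intp mu p fT = a%:E ->
  (intp mu p F <= (2 `^ p * (1 + eps `^ p * C0) * (a + lambda))%:E)%E.
Proof.
move=> ha; have E0 := eps0.
have a0 : 0 <= a by rewrite -lee_fin -ha; exact: intp_ge0.
pose A : set (lebesgue_rV n) := [set x | 0 < d x <= 3 / 4 * eps].
pose h (x : lebesgue_rV n) : R := Num.max 0 (`|F x| - `|fT x|) / eps.
have h0 x : 0 <= h x by rewrite divr_ge0 ?le_max ?lexx// ltW.
have mA : measurable A.
  rewrite (_ : A = slab 0 (3 / 4 * eps) `\` slab 0 0).
    by apply: measurableD; exact: measurable_slab.
  apply/seteqP; split => x; rewrite /A/slab/= d0/=.
    by move=> /andP[h1 ->]; split => //; apply/negP; rewrite -ltNge.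
  by move=> [-> /negP]; rewrite -ltNge => ->.
have mh : measurable_fun setT (fun x => h x * \1_A x).
  apply: measurable_funM; last exact: measurable_indic.
  apply: measurable_funM; last exact: measurable_cst.
  apply: measurable_maxr; first exact: measurable_cst.
  by apply: measurable_funB; apply: measurable_normr_fun; [exact: measurable_extend|exact: mfT].
have mh' : measurable_fun setT (fun x => eps * (h x * \1_A x)).
  by apply: measurable_funM; [exact: measurable_cst|exact: mh].
(* Where 0 < d <= 3/4 eps, h is the excess divided by eps. On S the bound on T forces T x = x, and F
   x = f x. Farther away F is 0. *)
have hF (x : lebesgue_rV n) : `|F x| <= `|fT x| + `|eps * (h x * \1_A x)|.
  rewrite (ger0_norm (_ : 0 <= eps * (h x * \1_A x))); last first.
    by apply: mulr_ge0; [exact: ltW|apply: mulr_ge0; rewrite ?h0// indicE].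
  rewrite indicE; case: (boolP (x \in A)) => [xA|/negP xA].
    rewrite mulr1 /h mulrC divfK ?gt_eqF// -lerBlDl.
    by rewrite le_max lexx orbT.
  rewrite mulr0 mulr0 addr0; have [dx|dx] := leP (d x) (3 / 4 * eps).
    have /(dist_eq0 S0 _ cS) Sx : d x = 0.
      apply/eqP; rewrite eq_le d0 andbT leNgt; apply/negP => dx0; apply: xA.
      by rewrite inE /A/= dx0.
    have dx0 : d x = 0 by exact/(dist_eq0 S0 _ cS).
    have [|-> _] := @retractP x; first by rewrite dx0.
    rewrite dx0 mulr0 normr_le0 subr_eq0 => /eqP ->.
    by rewrite extend_on.
  by rewrite extend_out ?normr0//; lra.
apply: le_trans (intp_le_add mu (ltW p0) measurable_extend mfT mh' hF) _.
rewrite (@intpZ _ _ _ mu p eps (fun x => h x * \1_A x) mh (ltW E0))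
    (@intp_indic _ _ _ mu p A h mA p0 h0) ha.
apply: (@le_trans _ _ ((2 `^ p)%:E * (a%:E + (eps `^ p)%:E * (C0 * lambda)%:E))%E).
  by rewrite lee_pmul2l ?lte_fin ?powR_gt0// leeD2l// lee_pmul2l ?lte_fin ?powR_gt0//;
      exact: excess_le.
rewrite -[((eps `^ p)%:E * _)%E]EFinM -EFinD -EFinM lee_fin -mulrA ler_pM2l ?powR_gt0//.
have := powR_ge0 eps p; have : 0 <= C0 by rewrite !mulr_ge0 ?powR_ge0 ?exprn_ge0.
move: (eps `^ p) C0 lam0 => e C l0 C00 e00.
have := mulr_ge0 e00 C00; move: (e * C) (mulrA e C lambda) => ec -> ec0.
by have := mulr_ge0 ec0 a0; lra.
Qed.

Lemma extend_diff_intp (a : R) (v : 'rV[R]_n) t : intp mu p fT = a%:E ->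
  0 < t -> t <= eps / 300 -> `|v| <= t ->
  (intp mu p (fun x => (F (x + v) - F x) / t)%R <=
   (4 `^ p * ((4 / eps) `^ p + (4 + 400 * 6 ^+ n) `^ p * C0 + 10 `^ p * C0) * (a + lambda))%:E)%E.
Proof.
move=> ha t0 te vt; have E0 := eps0.
have a0 : 0 <= a by rewrite -lee_fin -ha; exact: intp_ge0.
have h1 := excess_diff_le t0 te vt; have h2 := near_diff_le t0 te vt.
have K0 : 0 < 4 + 400 * 6 ^+ n :> R by apply: ltr_pwDl K400; rewrite ltr0n.
move: (4 + 400 * 6 ^+ n : R) K0 h1 => K K0 h1.
pose A1 := slab (50 * t) (3 / 4 * eps) : set (lebesgue_rV n).
pose A2 := slab 0 (50 * t) : set (lebesgue_rV n).
pose g1 (x : lebesgue_rV n) : R := Num.max 0 (`|F ((x : 'rV[R]_n) + v)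
    - F x| / t - 4 / eps * `|fT x|) / K.
pose g2 (x : lebesgue_rV n) : R := `|F ((x : 'rV[R]_n) + v) - F x| / t / 10.
have mA1 : measurable A1 by exact: measurable_slab.
have mA2 : measurable A2 by exact: measurable_slab.
have mD := measurable_extend_diff v.
have g10 x : 0 <= g1 x by rewrite divr_ge0 ?le_max ?lexx// ltW.
have g20 x : 0 <= g2 x by rewrite divr_ge0// divr_ge0// ltW.
have mg1 : measurable_fun setT (fun x => g1 x * \1_A1 x).
  apply: measurable_funM; last exact: measurable_indic.
  exact: measurable_excess_diff.
have mg2 : measurable_fun setT (fun x => g2 x * \1_A2 x).
  apply: measurable_funM; last exact: measurable_indic.
  apply: measurable_funM; last exact: measurable_cst.
  by apply: measurable_funM; last exact: measurable_cst.
pose u1 (x : lebesgue_rV n) : R := 4 / eps * fT x.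
pose u2 x : R := K * (g1 x * \1_A1 x).
pose u3 x : R := 10 * (g2 x * \1_A2 x).
have mu1 : measurable_fun setT u1 by apply: measurable_funM; [exact: measurable_cst|exact: mfT].
have mu2 : measurable_fun setT u2 by apply: measurable_funM; [exact: measurable_cst|exact: mg1].
have mu3 : measurable_fun setT u3 by apply: measurable_funM; [exact: measurable_cst|exact: mg2].
have u20 x : 0 <= u2 x by apply: mulr_ge0; [exact: ltW|apply: mulr_ge0; rewrite ?g10// indicE].
have u30 x : 0 <= u3 x by apply: mulr_ge0; [exact: ler0n|apply: mulr_ge0; rewrite ?g20// indicE].
have mv : measurable_fun setT (fun x : lebesgue_rV n => (F ((x : 'rV[R]_n) + v) - F x) / t).
  apply: measurable_funM; last exact: measurable_cst.
  exact: measurable_extend_sub.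
(* Near S the term [u3] suffices; on the middle slab [u1] and [u2] do. Where d x > 3/4 eps, both x
   and x + v are at distance at least eps / 2 from S and the increment is 0. *)
have hD (x : lebesgue_rV n) : `|(F ((x : 'rV[R]_n) + v) - F x) / t| <= `|u1 x| + `|u2 x + u3 x|.
  rewrite normrM (gtr0_norm (_ : 0 < t^-1)) ?invr_gt0//.
  rewrite (ger0_norm (addr_ge0 (u20 x) (u30 x))).
  have [dx|dx] := leP (d x) (50 * t).
    apply: (@le_trans _ _ (u3 x)).
      rewrite /u3 /g2 indicE mem_set; last by rewrite /A2/slab/= d0.
      by rewrite mulr1 [10 * _]mulrC divfK ?pnatr_eq0.
    by rewrite addrA lerDr addr_ge0.
  have [dx'|dx'] := leP (d x) (3 / 4 * eps).
    apply: (@le_trans _ _ (`|u1 x| + u2 x)); last by rewrite lerD2l lerDl.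
    rewrite -lerBlDl /u2 /g1 indicE mem_set; last by rewrite /A1/slab/= dx' ltW.
    rewrite mulr1 [K * _]mulrC divfK ?gt_eqF// le_max; apply/orP; right.
    by rewrite /u1 normrM (gtr0_norm (_ : 0 < 4 / eps)) ?divr_gt0.
  have dv := dist_lip S0 x (x + v); rewrite opprD addrA subrr sub0r normrN in dv.
  rewrite !extend_out ?subrr ?normr0 ?mul0r; [|lra|lra].
  by rewrite !addr_ge0.
apply: le_trans (intp_le_add mu (ltW p0) mv mu1 (measurable_funD mu2 mu3) hD) _.
have h23 (x : lebesgue_rV n) : `|u2 x + u3 x| <= `|u2 x| + `|u3 x| by exact: ler_normD.
have := intp_le_add mu (ltW p0) (measurable_funD mu2 mu3) mu2 mu3 h23.
have e0 : 0 <= 4 / eps by rewrite divr_ge0// ltW.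
have t10 : 0 <= 10 :> R by exact: ler0n.
rewrite {1}/u1 (@intpZ _ _ _ mu p (4 / eps) fT mfT e0) ha.
rewrite (@intpZ _ _ _ mu p K (fun x => g1 x * \1_A1 x) mg1 (ltW K0)).
rewrite (@intpZ _ _ _ mu p 10 (fun x => g2 x * \1_A2 x) mg2 t10).
rewrite (@intp_indic _ _ _ mu p A1 g1 mA1 p0 g10) (@intp_indic _ _ _ mu p A2 g2 mA2 p0 g20) => h3.
have {}h3 : (intp mu p (fun x => u2 x + u3 x)%R <=
    (2 `^ p * (K `^ p * (C0 * lambda) + 10 `^ p * (C0 * lambda)))%:E)%E.
  apply: le_trans h3 _; rewrite EFinM EFinD !EFinM lee_pmul2l ?lte_fin ?powR_gt0//.
  by apply: leeD; rewrite lee_pmul2l ?lte_fin ?powR_gt0// -EFinM.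
apply: (@le_trans _ _ ((2 `^ p)%:E * ((4 / eps) `^ p * a +
    2 `^ p * (K `^ p * (C0 * lambda) + 10 `^ p * (C0 * lambda)))%:E)%E).
  by rewrite lee_pmul2l ?lte_fin ?powR_gt0// EFinD EFinM leeD2l.
rewrite -EFinM lee_fin.
have -> : (4 : R) `^ p = 2 `^ p * 2 `^ p by rewrite -powRM//; congr (_ `^ _); lra.
apply: quotient_constant; rewrite ?powR_ge0 ?lam0//.
  have h12 : 1 <= (2 : R) by rewrite ler1n.
  by have := ler_powR h12 (ltW p0); rewrite powRr0.
by rewrite !mulr_ge0 ?powR_ge0 ?exprn_ge0.
Qed.

End extension.

(** * The trace space *)

Lemma intp_ae_eq d (T : measurableType d) (R : realType) (mu : {measure set T -> \bar R})
    (p : R) (g h : T -> R) : measurable_fun setT g -> measurable_fun setT h ->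
  {ae mu, forall z, g z - h z = 0} -> intp mu p g = intp mu p h.
Proof.
move=> mg mh ae; apply: ae_eq_integral => //.
- by apply/measurable_EFinP; apply: measurable_powR_fun; exact: measurable_normr_fun.
- by apply/measurable_EFinP; apply: measurable_powR_fun; exact: measurable_normr_fun.
- by apply: filterS ae => z /eqP; rewrite subr_eq0 => /eqP ->.
Qed.

Section gradients.
Context {R : realType} {n : nat} (p : R).
Hypotheses (n0 : (0 < n)%N) (np : n%:R < p).
Local Notation mu := (@lebesgue R n).
Implicit Types (F : 'rV[R]_n -> R) (G : 'rV[R]_n -> 'rV[R]_n).

Let p1 : 1 < p. Proof. by apply: le_lt_trans np; rewrite ler1n. Qed.
Let p0 : 0 < p. Proof. exact: lt_trans p1. Qed.

Lemma intp_weak_derivative_unique (g h : lebesgue_rV n -> R) :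
  g \in Lfun mu p%:E -> h \in Lfun mu p%:E ->
  (forall phi : 'rV[R]_n -> R, test_function phi ->
     \int[mu]_x (g x * phi x) = \int[mu]_x (h x * phi x)) ->
  intp mu p g = intp mu p h.
Proof.
move=> Lg Lh gh.
have [mg _] := (Lfun_intp mu g p0).1 Lg; have [mh _] := (Lfun_intp mu h p0).1 Lh.
have p1' : 1 <= p := ltW p1.
have LH : (fun x => g x - h x) \in Lfun mu p%:E.
  have -> : (fun x => g x - h x) = (g - h)%R by [].
  by apply: rpredB.
have : {ae mu, forall z, g z - h z = 0}.
  apply: (Lfun_eq0_of_test p1' LH) => phi tphi.
  have [N supp [K hK]] := test_function_supp tphi.
  have cphi : continuous phi by case: tphi => sphi _; have [] := sphi [::].
  have N0 : 0 <= N%:R :> R by [].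
  have [ig _] := Lfun_mul_supp p1' N0 Lg cphi hK supp.
  have [ih _] := Lfun_mul_supp p1' N0 Lh cphi hK supp.
  transitivity (\int[mu]_x (g x * phi x - h x * phi x)).
    by congr (fine _); apply: eq_integral => x _; rewrite mulrBl.
  by rewrite RintegralB// gh// subrr.
exact: intp_ae_eq.
Qed.

(** [gradient] is an arbitrary representative picked by [get]; bounds on the constructed derivatives
    [g i] reach it through almost everywhere uniqueness. The factor n comes from summing over the
    components. *)
Lemma intp_gradient_le F (g : 'I_n -> lebesgue_rV n -> R) (B : R) :
  (forall i, g i \in Lfun mu p%:E) -> (forall i, (intp mu p (g i) <= B%:E)%E) ->
  (forall i phi, test_function phi ->
     \int[mu]_x (F x * partial i phi x) = - \int[mu]_x (g i x * phi x)) ->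
  (exists G, Lp_gradient p F G) /\
  (intp mu p (fun x => `|gradient p F x|%R) <= (n%:R * B)%:E)%E.
Proof.
move=> Lg gB wg.
have ex : exists G, Lp_gradient p F G.
  exists (fun x => \row_i g i x); split.
    by move=> i; rewrite (_ : (fun _ => _) = g i)//; apply/funext => x; rewrite mxE.
  move=> phi tphi i; rewrite wg//; congr (- _); congr (fine _); apply: eq_integral => x _.
  by rewrite mxE.
split => //.
have [LG wG] : Lp_gradient p F (gradient p F) by exact: getPex.
apply: (le_trans (intp_norm_le_sum n0 np LG)).
apply: (@le_trans _ _ (\sum_(i < n) B%:E)%E); last first.
  by rewrite sumEFin sumr_const card_ord lee_fin mulr_natl.
apply: lee_sum => i _.
rewrite (@intp_weak_derivative_unique _ (g i))// => phi tphi.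
by apply: oppr_inj; rewrite -wG// -wg.
Qed.

End gradients.

Section trace_extension.
Context {R : realType} {n : nat} (p eps theta : R).
Hypotheses (n0 : (0 < n)%N) (np : n%:R < p) (eps0 : 0 < eps) (theta1 : 1 <= theta).
Local Notation mu := (@lebesgue R n).
Local Notation eta := (10 * theta + 1).

Let p1 : 1 < p. Proof. by apply: le_lt_trans np; rewrite ler1n. Qed.
Let p0 : 0 < p. Proof. exact: lt_trans p1. Qed.

Lemma powR_bound (K a l : R) : 0 <= K -> 0 <= a -> 0 <= l ->
  (K * (a + l)) `^ p^-1 <= 2 * K `^ p^-1 * (a `^ p^-1 + l `^ p^-1).
Proof.
move=> K0 a0 l0; rewrite powRM ?addr_ge0// [2 * _]mulrC -mulrA ler_wpM2l ?powR_ge0//.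
exact: powRVD_le (ltW p1).
Qed.

Theorem trace_extension : exists2 K : R, 0 < K &
  forall (S : set 'rV[R]_n) (T : 'rV[R]_n -> 'rV[R]_n) (f : 'rV[R]_n -> R) (lambda : R),
  closed S -> S !=set0 -> (forall x, nbhd eps S x -> S (T x)) ->
  (forall x, nbhd eps S x -> (`|T x - x|%:E <= theta%:E * edist_inf S x)%E) ->
  retract eps S T f \in Lfun mu p%:E -> cube_sums_bounded p eps eta S f lambda ->
  exists2 F, W1_extension p S f F &
    (W1_norm p F <= K%:E * ('N[mu]_p%:E[EFin \o retract eps S T f] + (lambda `^ p^-1)%:E))%E.
Proof.
pose C0 : R := 2 `^ p * 6 ^+ n * 2 `^ (p - n%:R).
pose K1 : R := 2 `^ p * (1 + eps `^ p * C0).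
pose K2 : R := 4 `^ p * ((4 / eps) `^ p + (4 + 400 * 6 ^+ n) `^ p * C0 + 10 `^ p * C0).
have C00 : 0 <= C0 by rewrite !mulr_ge0 ?powR_ge0 ?exprn_ge0.
have K10 : 0 <= K1 by apply: mulr_ge0; rewrite ?powR_ge0// addr_ge0// mulr_ge0 ?powR_ge0.
have K20 : 0 <= K2.
  by apply: mulr_ge0; [exact: powR_ge0|apply: addr_ge0; [apply: addr_ge0|];
      rewrite ?mulr_ge0 ?powR_ge0].
pose K : R := 2 * K1 `^ p^-1 + 2 * (n%:R * K2) `^ p^-1 + 1.
have K0 : 0 < K.
  by apply: ltr_wpDl; [apply: addr_ge0; apply: mulr_ge0; rewrite ?powR_ge0|].
exists K => // S T f lambda cS S0 ST hT LfT cs.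
have [mfT fToo] := (Lfun_intp mu _ p0).1 LfT.
have [a a0 ha] := ge0_fin_ex (intp_ge0 mu p (retract eps S T f)) fToo.
have lam0 : 0 <= lambda.
  have := cs 0 (fun=> 0) (fun=> 1) (fun=> 0) (fun=> 0).
  by rewrite big_ord0; apply => // -[].
pose F := extend eps S T f.
have cF : continuous F := extend_continuous n0 np eps0 theta1 cS S0 ST hT cs mfT fToo.
have hF : (intp mu p F <= (K1 * (a + lambda))%:E)%E.
  have := extend_intp n0 np eps0 theta1 cS S0 ST hT cs mfT fToo ha; exact.
have LF : F \in Lfun mu p%:E.
  apply/(Lfun_intp mu F p0); split; first exact: measurable_continuous.
  by apply: le_lt_trans hF _; rewrite ltry.
have hQ (v : 'rV[R]_n) (t : R) : 0 < t -> t <= eps / 300 -> `|v| <= t ->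
    (intp mu p (fun x => (F (x + v) - F x) / t)%R <= (K2 * (a + lambda))%:E)%E.
  have := extend_diff_intp n0 np eps0 theta1 cS S0 ST hT cs mfT fToo ha; exact.
clearbody K1 K2.
pose M := (K2 * (a + lambda)) `^ p^-1.
have M0 : 0 <= M by exact: powR_ge0.
have al0 : 0 <= a + lambda by rewrite addr_ge0.
have MK : M `^ p = K2 * (a + lambda) by rewrite /M powR_invK ?mulr_ge0 ?gt_eqF.
(* The weak limit is taken over steps in ]0, 1], and the quotient estimate holds for steps up to eps
   / 300; t0 / (k + 1) meets both conditions and tends to 0. *)
pose t0 := Num.min 1 (eps / 300).
have t00 : 0 < t0 by rewrite lt_min ltr01; apply: divr_gt0; [exact: eps0|rewrite ltr0n].
pose t (k : nat) : R := t0 * k.+1%:R^-1.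
have tk0 k : 0 < t k by rewrite mulr_gt0.
have tk1 k : t k <= t0 by rewrite ler_piMr ?(ltW t00)// invf_le1 ?ler1n.
have tc : t @ \oo --> (0 : R).
  by rewrite -(mulr0 t0); apply: cvgM; [exact: cvg_cst|exact: cvg_harmonic].
have hg i : exists g : lebesgue_rV n -> R,
    [/\ g \in Lfun mu p%:E, (intp mu p g <= (M `^ p)%:E)%E &
    forall phi, test_function phi ->
      \int[mu]_x (F x * partial i phi x) = - \int[mu]_x (g x * phi x)].
  have [|k|g [h1 h2] h3] := @weak_derivative_of_quotients R n p p1 F i M t cF LF M0 _ tc.
  - move=> k; rewrite tk0/=; apply: le_trans (tk1 k) _; by rewrite ge_min lexx.
  - rewrite MK; apply: hQ => //.
      by apply: le_trans (tk1 k) _; rewrite ge_min lexx orbT.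
    rewrite normrZ (gtr0_norm (tk0 k)) ler_piMr ?(ltW (tk0 k))//.
    by apply/rV_norm_le => // j; rewrite mxE/=; case: (_ == _); rewrite ?normr1 ?normr0//.
  - by exists g.
have [g hg'] := choice hg.
have [] := @intp_gradient_le R n p n0 np F g (M `^ p).
- by move=> i; have [] := hg' i.
- by move=> i; have [] := hg' i.
- by move=> i; have [] := hg' i.
move=> exG hG; exists F.
  by split => // x Sx; exact: extend_on.
rewrite /W1_norm !Lnorm_intp ha poweR_EFin.
have [b b0 hb] := ge0_fin_ex (intp_ge0 mu p F) (le_lt_trans hF (ltry _)).
have [c c0 hc] := ge0_fin_ex (intp_ge0 mu p _) (le_lt_trans hG (ltry _)).
rewrite hb hc !poweR_EFin -!EFinD -EFinM lee_fin.
move: hF hG; rewrite hb hc !lee_fin MK => hF hG.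
have r1 : b `^ p^-1 <= 2 * K1 `^ p^-1 * (a `^ p^-1 + lambda `^ p^-1).
  apply: le_trans (powR_bound K10 a0 lam0).
  by apply: ge0_ler_powR; rewrite ?nnegrE ?invr_ge0 ?(ltW p0) ?mulr_ge0.
have r2 : c `^ p^-1 <= 2 * (n%:R * K2) `^ p^-1 * (a `^ p^-1 + lambda `^ p^-1).
  apply: le_trans (powR_bound _ a0 lam0); last by rewrite mulr_ge0.
  by apply: ge0_ler_powR; rewrite ?nnegrE ?invr_ge0 ?(ltW p0) ?mulr_ge0// -mulrA.
have := addr_ge0 (powR_ge0 a p^-1) (powR_ge0 lambda p^-1).
rewrite /K; move: (_ + _) r1 r2 => w r1 r2 w0.
move: (2 * _) (2 * _) r1 r2 => u v r1 r2.
by rewrite mulrDl mul1r mulrDl; lra.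
Qed.

End trace_extension.

Section necessity.
Context {R : realType} {n : nat} (p eps theta : R).
Hypotheses (n0 : (0 < n)%N) (np : n%:R < p) (eps0 : 0 < eps) (theta1 : 1 <= theta).
Local Notation mu := (@lebesgue R n).
Local Notation eta := (10 * theta + 1).

Let p1 : 1 < p. Proof. by apply: le_lt_trans np; rewrite ler1n. Qed.
Let p0 : 0 < p. Proof. exact: lt_trans p1. Qed.

(** For empty S the distance is the infimum of the empty set, +oo, so the neighborhood is empty. *)
Lemma measurable_nbhd (S : set 'rV[R]_n) : measurable (nbhd eps S : set (lebesgue_rV n)).
Proof.
have [->|/set0P S0] := eqVneq S set0; last first.
  by apply: measurable_lebesgue; apply: measurable_rV_open; exact: open_nbhd.
rewrite (_ : nbhd eps set0 = set0)//; apply/seteqP; split => x //.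
by rewrite /nbhd/= /edist_inf image_set0 ereal_inf0.
Qed.

Theorem trace_necessary : exists2 K : R, 0 < K &
  forall (S : set 'rV[R]_n) (T : 'rV[R]_n -> 'rV[R]_n) (f F : 'rV[R]_n -> R),
  (forall x, nbhd eps S x -> S (T x)) ->
  measurable_fun (nbhd eps S : set (lebesgue_rV n)) (T : lebesgue_rV n -> 'rV[R]_n) ->
  (forall x, nbhd eps S x -> (`|T x - x|%:E <= theta%:E * edist_inf S x)%E) ->
  W1_extension p S f F ->
  [/\ retract eps S T f \in Lfun mu p%:E,
      ('N[mu]_p%:E[EFin \o retract eps S T f] <= K%:E * W1_norm p F)%E &
      exists l : R, [/\ 0 <= l, cube_sums_bounded p eps eta S f l &
        ((l `^ p^-1)%:E <= K%:E * W1_norm p F)%E]].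
Proof.
have t1 := theta1; have eta1 : 1 <= eta by lra.
(* T moves no point of the neighborhood by more than theta * eps, which becomes the radius of the
   averaging cubes. *)
have rho0 : 0 < theta * eps by rewrite mulr_gt0//; lra.
have [K1 K10 H1] := cube_sums_le n0 np eta1.
have [K2 K20 H2] := intp_retraction_le n0 np rho0.
pose K := K1 `^ p^-1 + 2 * K2 `^ p^-1 + 1.
have k1 := powR_ge0 K1 p^-1; have k2 := powR_ge0 K2 p^-1.
exists K; first by rewrite /K; lra.
move=> S T f F ST mT hT [cF [LF exG] Ff].
have [LG wG] : Lp_gradient p F (gradient p F) by exact: getPex.
have hT' x : nbhd eps S x -> `|T x - x| <= theta * eps.
  move=> Sx; rewrite -lee_fin; apply: le_trans (hT x Sx) _; rewrite EFinM.
  by rewrite lee_pmul2l ?lte_fin ?ltW//; lra.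
have [mfT hfT] := H2 F (gradient p F) _ T LF LG wG cF (measurable_nbhd S) mT hT'.
have eT : (F \o T) \_ (nbhd eps S) = retract eps S T f.
  apply/funext => x; rewrite /retract !patchE; case: ifP => // /set_mem Sx.
  exact/Ff/ST.
rewrite eT in mfT hfT.
have [_ goo] := intp_norm_lt_pinfty n0 np LG.
have [mF Foo] := (Lfun_intp mu F p0).1 LF.
have [b b0 hb] := ge0_fin_ex (intp_ge0 mu p F) Foo.
have [c c0 hc] := ge0_fin_ex (intp_ge0 mu p _) goo.
have H1' := H1 F (gradient p F) LF LG wG cF; rewrite hc/= in H1'.
have fToo : (intp mu p (retract eps S T f) < +oo)%E.
  by apply: le_lt_trans hfT _; rewrite hb hc -EFinD -EFinM ltry.
have [a a0 ha] := ge0_fin_ex (intp_ge0 mu p (retract eps S T f)) fToo.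
have hN : W1_norm p F = (b `^ p^-1 + c `^ p^-1)%:E.
  by rewrite /W1_norm !Lnorm_intp hb hc !poweR_EFin.
have bp := powR_ge0 b p^-1; have cp := powR_ge0 c p^-1.
split.
- by apply/(Lfun_intp mu _ p0).
- rewrite hN Lnorm_intp ha poweR_EFin -EFinM lee_fin.
  move: hfT; rewrite ha hb hc -EFinD -EFinM lee_fin => h.
  apply: (@le_trans _ _ ((K2 * (b + c)) `^ p^-1)).
    by apply: ge0_ler_powR; rewrite ?nnegrE ?invr_ge0 ?(ltW p0) ?mulr_ge0 ?addr_ge0 ?(ltW K20).
  apply: le_trans (powR_bound n0 np (ltW K20) b0 c0) _.
  by apply: ler_wpM2r; rewrite ?addr_ge0// /K; lra.
- exists (K1 * c); split; first by rewrite mulr_ge0// ltW.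
    move=> m ce r x y r0 tr _ hx hy.
    have hx1 i : cube (ce i) (eta * r i) (x i) by have [] := hx i.
    have hy1 i : cube (ce i) (eta * r i) (y i) by have [] := hy i.
    apply: le_trans (H1' m ce r x y r0 tr hx1 hy1).
    rewrite le_eqVlt; apply/orP; left; apply/eqP/eq_bigr => i _.
    by have [_ Sx] := hx i; have [_ Sy] := hy i; rewrite !Ff.
  rewrite hN -EFinM lee_fin powRM ?(ltW K10)//.
  apply: ler_pM => //; first by rewrite /K; lra.
  by rewrite lerDr.
Qed.

End necessity.

Section empty.
Context {R : realType} {n : nat} (p : R).
Hypotheses (n0 : (0 < n)%N) (np : n%:R < p).
Local Notation mu := (@lebesgue R n).

(** For empty S the zero function extends every f. Its [gradient] is known to vanish only almost
    everywhere, so the norm is computed through [intp_gradient_le] with bound 0. *)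
Lemma W1_extension_zero (f : 'rV[R]_n -> R) :
  W1_extension p set0 f (fun=> 0) /\ (W1_norm p (fun _ : 'rV[R]_n => 0%R : R) <= 0)%E.
Proof.
have p0 : 0 < p by apply: le_lt_trans np.
have i0 : intp mu p (fun=> 0) = 0%E.
  by rewrite /intp integral0_eq// => x _; rewrite normr0 powR0// gt_eqF.
have L0 : (fun=> 0 : R) \in Lfun mu p%:E.
  by apply/(Lfun_intp mu _ p0); rewrite i0 ltry.
have [] := @intp_gradient_le R n p n0 np (fun=> 0) (fun=> fun=> 0) 0.
- by [].
- by move=> i; rewrite i0.
- have z0 (u : 'rV[R]_n -> R) : \int[mu]_x (0 * u x) = 0.
    by rewrite /Rintegral; under eq_integral do rewrite mul0r; rewrite integral0.
  by move=> i phi _; rewrite !z0 oppr0.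
move=> exG; rewrite mulr0 => hG; split; first by split => //; exact: cst_continuous.
rewrite /W1_norm !Lnorm_intp i0.
have -> : intp mu p (fun x => `|gradient p (fun=> 0) x|%R) = 0%E.
  by apply/eqP; rewrite eq_le hG intp_ge0.
by rewrite poweR_EFin powR0 ?adde0// gt_eqF ?invr_gt0.
Qed.

End empty.

Theorem theorem1p2 (R : realType) (n : nat) (p eps theta : R)
    (hn : (0 < n)%N) (hp : n%:R < p) (heps : 0 < eps) (htheta : 1 <= theta) :
  exists C : R, 1 <= C /\
  forall (S : set 'rV[R]_n) (T : 'rV[R]_n -> 'rV[R]_n) (f : 'rV[R]_n -> R),
  closed S ->
  (forall x, nbhd eps S x -> S (T x)) ->
  measurable_fun (nbhd eps S : set (lebesgue_rV n)) (T : lebesgue_rV n -> 'rV[R]_n) ->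
  (forall x, nbhd eps S x -> (`|T x - x|%:E <= theta%:E * edist_inf S x)%E) ->
  let eta := 10 * theta + 1 in
  let fT : lebesgue_rV n -> R := (f \o T) \_ (nbhd eps S) in
  let bounds := [set lambda | 0 < lambda /\
                   cube_sums_bounded p eps eta S f lambda] in
  let A := W1_trace_norm p S f in
  let B := ('N[lebesgue n]_p%:E[EFin \o fT] +
            ereal_inf [set (lambda `^ p^-1)%:E | lambda in bounds])%E in
  (W1_trace p S f <-> fT \in Lfun (lebesgue n) p%:E /\ bounds !=set0) /\
  (W1_trace p S f -> (C^-1%:E * A <= B /\ B <= C%:E * A)%E).
Proof.
have p1 : 1 < p by apply: le_lt_trans hp; rewrite ler1n.
have p0 : 0 < p by exact: lt_trans p1.
have [K1 K10 ext] := trace_extension hn hp heps htheta.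
have [K2 K20 nec] := trace_necessary hn hp heps htheta.
(* K1 serves the bound of A by B. K2 is paid twice in the other direction, once for the norm of f o
   T and once for the infimum over lambda. *)
pose C := 1 + K1 + 2 * K2.
have C1 : 1 <= C by rewrite /C -addrA lerDl addr_ge0 ?mulr_ge0// ltW.
have C0 : 0 < C by exact: lt_le_trans C1.
exists C; split => // S T f cS ST mT hT eta fT bounds A B.
have N0 : (0 <= 'N[lebesgue n]_p%:E[EFin \o fT])%E by exact: Lnorm_ge0.
have sufficient l : fT \in Lfun (lebesgue n) p%:E -> bounds l ->
    exists2 F, W1_extension p S f F &
      (W1_norm p F <= K1%:E * ('N[lebesgue n]_p%:E[EFin \o fT] + (l `^ p^-1)%:E))%E.
  move=> LfT [l0 hl]; have [S0|/set0P S0] := eqVneq S set0; last exact: (ext S T f l).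
  have [h1 h2] := W1_extension_zero hn hp f; exists (fun=> 0); first by rewrite S0.
  apply: le_trans h2 _; apply: mule_ge0; first by rewrite lee_fin ltW.
  by rewrite adde_ge0// lee_fin powR_ge0.
have necessary F : W1_extension p S f F ->
    fT \in Lfun (lebesgue n) p%:E /\ (B <= C%:E * W1_norm p F)%E /\ bounds !=set0.
  move=> hF; have [LfT hfT [l [l0 hl lF]]] := nec S T f F ST mT hT hF.
  have mono l' : 0 < l' -> l <= l' -> bounds l'.
    move=> l'0 ll'; split => // m c r x y h1 h2 h3 h4 h5.
    exact: le_trans (hl m c r x y h1 h2 h3 h4 h5) ll'.
  split => //; split; last by exists (l + 1); apply: mono; lra.
  apply/lee_addgt0Pr => e e0.
  have W0 : (0 <= W1_norm p F)%E by apply: adde_ge0; exact: Lnorm_ge0.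
  (* l itself may vanish, in which case it is not in [bounds]. *)
  pose lam := (l `^ p^-1 + e) `^ p.
  have q0 : 0 <= p^-1 by rewrite invr_ge0 ltW.
  have le0 : 0 <= l `^ p^-1 + e by rewrite addr_ge0 ?powR_ge0// ltW.
  have lamE : lam `^ p^-1 = l `^ p^-1 + e by rewrite /lam powRK_inv ?gt_eqF.
  have lam0 : 0 < lam by rewrite powR_gt0// ltr_wpDl ?powR_ge0.
  have llam : l <= lam.
    rewrite -[leLHS](@powR_invK _ _ p) ?gt_eqF//.
    by apply: ge0_ler_powR; rewrite ?nnegrE ?powR_ge0 ?(ltW p0)// lerDl ltW.
  have hinf : (ereal_inf [set (lambda `^ p^-1)%:E | lambda in bounds] <=
      (l `^ p^-1)%:E + e%:E)%E.
    by apply: ereal_inf_lbound; exists lam; [exact: mono|rewrite lamE].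
  apply: (@le_trans _ _ (K2%:E * W1_norm p F + (K2%:E * W1_norm p F + e%:E))%E).
    apply: leeD; first exact: hfT.
    by apply: le_trans hinf _; apply: leeD.
  rewrite addeA; apply: leeD => //; rewrite -ge0_muleDl ?lee_fin ?(ltW K20)// -EFinD.
  by apply: lee_wpmul2r => //; rewrite lee_fin /C; lra.
split.
  split => [[F /necessary[LfT [_ ?]]]//|[LfT [l hl]]].
  by have [F hF _] := sufficient l LfT hl; exists F.
move=> [F0 /necessary[LfT [_ [l0 hl0]]]]; split.
  (* Finiteness allows this norm to be moved to the other side, so that the bound on the infimum can
     be checked for each lambda separately. *)
  have LfTN : ('N[lebesgue n]_p%:E[EFin \o fT])%E \is a fin_num.
    have [_ fToo] := (Lfun_intp (lebesgue n) _ p0).1 LfT.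
    have [a a0 ha] := ge0_fin_ex (intp_ge0 (lebesgue n) p fT) fToo.
    by rewrite Lnorm_intp ha poweR_EFin.
  rewrite /B -leeBlDl//; apply: le_ereal_inf_tmp => _ [l hl <-].
  rewrite leeBlDl// lee_pdivrMl//.
  have [F hF hK] := sufficient l LfT hl.
  apply: (@le_trans _ _ (W1_norm p F)); first by apply: ereal_inf_lbound; exists F.
  apply: le_trans hK _; apply: lee_wpmul2r; first by rewrite adde_ge0// lee_fin powR_ge0.
  by rewrite lee_fin /C; lra.
(* The bound by the norm of F holds for every extension F, hence for the infimum that defines the
   trace norm. *)
rewrite -lee_pdivrMl//; apply: le_ereal_inf_tmp => _ [F hF <-].
by rewrite lee_pdivrMl//; have [_ []] := necessary F hF.
Qed.
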